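(* Let $n\ge 2$ and $1\le k<n$, and let $T\colon\mathbb{H}_n\to\mathbb{H}_n$ be a bijective real linear map. The following are equivalent. (a) $T$ preserves parallel pairs with respect to $w_k$ (i.e. $T(A)\parallel T(B)$ whenever $A\parallel B$). (b) $T$ preserves TEA pairs with respect to $w_k$. (c) There exist a nonzero $\mu\in\mathbb{R}$ and a unitary $U\in\mathbb{M}_n$ such that one of the following holds: (c.1) $\mu T$ has the form $A\mapsto U^*AU$ or $A\mapsto U^*A^tU$; (c.2) $n=2k>2$, $\mu T$ is unital (i.e. $\mu T(I)=I$), and there is $c\in\mathbb{R}\setminus\{0\}$ such that either $(\mu T)(A)=cU^*AU$ for all $A\in\mathbb{H}_n^0$, or $(\mu T)(A)=cU^*A^tU$ for all $A\in\mathbb{H}_n^0$; (c.3) $n=2$ and $\mu T$ is a bijective unital trace-preserving real linear map.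
   Context: $\mathbb{H}_n$ is the real vector space of $n\times n$ complex Hermitian matrices and $\mathbb{H}_n^0$ its subspace of trace-zero matrices. For $A\in\mathbb{M}_n$, $W_k(A)=\{\operatorname{tr}(AP): P=P^*=P^2,\ \operatorname{tr}P=k\}$ and $w_k(A)=\max\{|z|:z\in W_k(A)\}$. For $A,B\in\mathbb{H}_n$, $A\parallel B$ means $w_k(A+\mu B)=w_k(A)+w_k(B)$ for some $\mu\in\{1,-1\}$; $(A,B)$ is a TEA pair if $w_k(A+B)=w_k(A)+w_k(B)$. *)

(* Defs.v *)
From HB Require Import structures.
From mathcomp Require Import all_boot all_order all_algebra.
From mathcomp Require Import complex.
From mathcomp Require Import all_classical reals.
Set Implicit Arguments. Unset Strict Implicit. Unset Printing Implicit Defensive.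
Import Order.TTheory GRing.Theory Num.Theory.
Local Open Scope ring_scope.
Local Open Scope classical_set_scope.

Section Defs.
Variable R : realType.
Local Notation C := R[i].

Definition adjmx n (A : 'M[C]_n) : 'M[C]_n := (map_mx Num.conj A)^T.

Definition is_herm n (A : 'M[C]_n) : Prop := adjmx A = A.

Definition unitary n (U : 'M[C]_n) : Prop := adjmx U *m U = 1%:M.

Definition rscale n (a : R) (A : 'M[C]_n) : 'M[C]_n := (a%:C)%C *: A.

Definition rank_proj n (k : nat) (P : 'M[C]_n) : Prop :=
  adjmx P = P /\ P *m P = P /\ \tr P = k%:R.

Definition cmod (z : C) : R := complex.Re `|z|.

(* w_k(A) = max { |tr(AP)| : P = P^* = P^2, tr P = k } (the max is attained;
   expressed as the supremum of this nonempty bounded set of reals) *)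
Definition wk n (k : nat) (A : 'M[C]_n) : R :=
  sup [set cmod (\tr (A *m P)) | P in [set P | rank_proj k P]].

Definition parallel_k n (k : nat) (A B : 'M[C]_n) : Prop :=
  exists mu : R, (mu = 1 \/ mu = -1) /\
    wk k (A + rscale mu B) = wk k A + wk k B.

Definition TEA_k n (k : nat) (A B : 'M[C]_n) : Prop :=
  wk k (A + B) = wk k A + wk k B.

(* T : H_n -> H_n bijective real-linear (T given on all matrices, only its
   values on H_n matter) *)
Definition herm_real_linear n (T : 'M[C]_n -> 'M[C]_n) : Prop :=
  (forall A, is_herm A -> is_herm (T A)) /\
  (forall (a b : R) A B, is_herm A -> is_herm B ->
      T (rscale a A + rscale b B) = rscale a (T A) + rscale b (T B)).

Definition herm_bijective n (T : 'M[C]_n -> 'M[C]_n) : Prop :=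
  (forall A B, is_herm A -> is_herm B -> T A = T B -> A = B) /\
  (forall B, is_herm B -> exists2 A, is_herm A & T A = B).

End Defs.

(* Main.v *)
Require Import Defs.
From HB Require Import structures.
From mathcomp Require Import all_boot all_order all_algebra.
From mathcomp Require Import complex spectral sesquilinear.
From mathcomp Require Import all_classical reals.
From mathcomp Require Import ring lra.
Import Order.TTheory GRing.Theory Num.Theory.
Local Open Scope ring_scope.
Set Implicit Arguments. Unset Strict Implicit. Unset Printing Implicit Defensive.

(* A projection Q of rank k norms A when |tr (A Q)| = w_k(A); A and B are
   parallel exactly when some Q norms both, and a norming Q commutes with A.

   Let T preserve parallelism. The identity is parallel to everything, hence so
   is T(I), which forces T(I) to be scalar; normalise T(I) = I. The matrices
   normed by a fixed P contain an open part of the commutant P'. Adding up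
   images of elements of this part with suitable signs shrinks the set of common
   norming projections without emptying it, which yields Q with T(P') inside Q';
   after complexification, dimensions give T(P') = Q'. Intersecting commutants,
   T maps the algebras spanned by mutually orthogonal projections onto algebras.
   For n > 2 this makes the images of orthogonal rank-one projections commute and
   have two eigenvalues each, so that T(E) = a F + b(E) I with F of rank one and
   a independent of E. The map E |-> F extends to a Jordan *-automorphism, that
   is, to a unitary conjugation up to transposition. Finally E - I/(2k) is, up to
   scalars, the only matrix of the plane spanned by E and I, besides I, that is
   parallel to this whole plane, so b(E) = (1 - a)/(2k); summing over a basis,
   (1 - a)(n - 2k) = 0. If n = 2k, then w_k(A + tI) = w_k(A) + k|t| for traceless
   A, so the traceless and the scalar parts of T behave independently; for n = 2
   traceless TEA pairs are proportional, and any traceless part is allowed. *)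

(** * Hermitian matrices, unitary conjugation and real traces *)

(** Parallelism is known only up to a sign, and two images sharing some norming projection need not
    share one with a third image. The remedy is an accumulator [A] in the relative interior of a
    norming cone and a piece [B] of [A], tilted in a chosen direction, such that both [A + B] and
    [A - B] remain in that interior. Whichever sign parallelism selects, the result is the next
    accumulator, and each projection norming its image norms the images of [A] and [B]. Finitely
    many directions suffice, since a commutant has a finite spanning set.

    The number [1/(2k)] is a centring constant: [tr ((E - s I) Q)] runs over values from [- k s] to
    [1 - k s], an interval symmetric about 0 exactly when [s = 1/(2k)].

    The bound [n > 2] supplies a third index, hence nontrivial product relations between images of
    two orthogonal projections. For [n = 2] the complement of a rank-one projection has rank one
    too, so the coefficient [a] would be defined only up to sign. *)

Section Basics.
Variable R : realType.
Local Notation C := R[i].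

Lemma ReD (x y : C) : complex.Re (x + y) = complex.Re x + complex.Re y.
Proof. by case: x; case: y. Qed.
Lemma ReN (x : C) : complex.Re (- x) = - complex.Re x.
Proof. by case: x. Qed.
Lemma Re_sum (I : Type) (r : seq I) (P : pred I) (F : I -> C) :
  complex.Re (\sum_(i <- r | P i) F i) = \sum_(i <- r | P i) complex.Re (F i).
Proof. by apply: (big_morph _ ReD). Qed.
Lemma Re_realM (a : R) (x : C) : complex.Re ((a%:C)%C * x) = a * complex.Re x.
Proof. by case: x => x y /=; rewrite mul0r subr0. Qed.
Lemma Re_nat m : complex.Re (m%:R : C) = m%:R.
Proof. by rewrite -(rmorph_nat (real_complex R)). Qed.
Lemma conj_real (a : R) : Num.conj ((a%:C)%C : C) = (a%:C)%C.
Proof. by apply/CrealP; apply/complex_realP; exists a. Qed.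
Lemma cmod_real (z : C) : z \is Num.real -> cmod z = `|complex.Re z|.
Proof.
by move=> /complex_realP[a ->]; rewrite /cmod normc_def /= expr0n addr0 sqrtr_sqr.
Qed.

Definition sqmod (z : C) : R := complex.Re (z * Num.conj z).
Lemma sqmodE z : ((sqmod z)%:C)%C = z * Num.conj z.
Proof. by apply: RRe_real; apply: ger0_real; apply: mul_conjC_ge0. Qed.
Lemma sqmod_ge0 z : 0 <= sqmod z.
Proof. by rewrite -lecR sqmodE mul_conjC_ge0. Qed.
Lemma sqmod_eq0 z : (sqmod z == 0) = (z == 0).
Proof. by rewrite -(inj_eq (@complexI R)) sqmodE mul_conjC_eq0. Qed.

Variable n : nat.
Implicit Types A B X Y P Q U V : 'M[C]_n.

Lemma adjmxE A i j : adjmx A i j = Num.conj (A j i).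
Proof. by rewrite !mxE. Qed.
Lemma adjmxK A : adjmx (adjmx A) = A.
Proof. by apply/matrixP=> i j; rewrite !mxE conjCK. Qed.
Lemma adjmxD A B : adjmx (A + B) = adjmx A + adjmx B.
Proof. by apply/matrixP=> i j; rewrite !mxE rmorphD. Qed.
Lemma adjmxN A : adjmx (- A) = - adjmx A.
Proof. by apply/matrixP=> i j; rewrite !mxE rmorphN. Qed.
Lemma adjmxB A B : adjmx (A - B) = adjmx A - adjmx B.
Proof. by rewrite adjmxD adjmxN. Qed.
Lemma adjmxZ a A : adjmx (a *: A) = Num.conj a *: adjmx A.
Proof. by apply/matrixP=> i j; rewrite !mxE rmorphM. Qed.
Lemma adjmxM A B : adjmx (A *m B) = adjmx B *m adjmx A.
Proof. by rewrite /adjmx map_mxM trmx_mul. Qed.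
Lemma adjmx1 : adjmx 1%:M = 1%:M :> 'M[C]_n.
Proof. by rewrite /adjmx map_mx1 trmx1. Qed.
Lemma adjmx0 : adjmx 0 = 0 :> 'M[C]_n.
Proof. by rewrite /adjmx map_mx0 trmx0. Qed.
Lemma mxtrace_adj A : \tr (adjmx A) = Num.conj (\tr A).
Proof. by rewrite /adjmx mxtrace_tr /mxtrace rmorph_sum; apply: eq_bigr => i _; rewrite !mxE. Qed.

Lemma unitaryV U : unitary U -> U *m adjmx U = 1%:M.
Proof. exact: mulmx1C. Qed.
Lemma unitary_adj U : unitary U -> unitary (adjmx U).
Proof. by move=> hU; rewrite /unitary adjmxK; apply: unitaryV. Qed.
Lemma unitaryM U V : unitary U -> unitary V -> unitary (U *m V).
Proof.
by move=> hU hV; rewrite /unitary adjmxM mulmxA -(mulmxA _ _ U) hU mulmx1.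
Qed.
Lemma unitary1 : unitary (1%:M : 'M[C]_n).
Proof. by rewrite /unitary adjmx1 mulmx1. Qed.

Definition uconj U A := adjmx U *m A *m U.

Lemma uconjM U A B : unitary U -> uconj U (A *m B) = uconj U A *m uconj U B.
Proof.
move=> /unitaryV hU; rewrite /uconj !mulmxA.
by rewrite -(mulmxA (adjmx U *m A) U) hU mulmx1.
Qed.
Lemma uconjD U A B : uconj U (A + B) = uconj U A + uconj U B.
Proof. by rewrite /uconj mulmxDr mulmxDl. Qed.
Lemma uconjZ U a A : uconj U (a *: A) = a *: uconj U A.
Proof. by rewrite /uconj -scalemxAr -scalemxAl. Qed.
Lemma uconj0 U : uconj U 0 = 0.
Proof. by rewrite /uconj mulmx0 mul0mx. Qed.
Lemma uconj_sum U (I : Type) (r : seq I) (P : pred I) (F : I -> 'M[C]_n) :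
  uconj U (\sum_(i <- r | P i) F i) = \sum_(i <- r | P i) uconj U (F i).
Proof. by apply: (big_morph _ (uconjD U) (uconj0 U)). Qed.
Lemma uconj1 U : unitary U -> uconj U 1%:M = 1%:M.
Proof. by rewrite /uconj mulmx1. Qed.
Lemma uconj_adj U A : adjmx (uconj U A) = uconj U (adjmx A).
Proof. by rewrite /uconj !adjmxM adjmxK mulmxA. Qed.
Lemma uconj_tr U A : unitary U -> \tr (uconj U A) = \tr A.
Proof. by move=> /unitaryV hU; rewrite /uconj mxtrace_mulC mulmxA hU mul1mx. Qed.
Lemma uconjK U A : unitary U -> uconj (adjmx U) (uconj U A) = A.
Proof.
move=> /unitaryV hU; rewrite /uconj adjmxK !mulmxA hU mul1mx.
by rewrite -mulmxA hU mulmx1.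
Qed.
Lemma uconjKV U A : unitary U -> uconj U (uconj (adjmx U) A) = A.
Proof. by move=> hU; rewrite -{1}(adjmxK U) uconjK //; apply: unitary_adj. Qed.
Lemma uconj_comp U V A : uconj U (uconj V A) = uconj (V *m U) A.
Proof. by rewrite /uconj adjmxM !mulmxA. Qed.
Lemma uconj_herm U A : is_herm A -> is_herm (uconj U A).
Proof. by rewrite /is_herm uconj_adj => ->. Qed.
Lemma uconj_proj U k P : unitary U -> rank_proj k P -> rank_proj k (uconj U P).
Proof.
move=> hU [h1 [h2 h3]]; split; first by rewrite uconj_adj h1.
by rewrite -uconjM // h2 uconj_tr.
Qed.

Definition rdiag (d : 'I_n -> R) : 'M[C]_n := diag_mx (\row_i ((d i)%:C)%C).
Lemma rdiagE d i j : rdiag d i j = ((d i)%:C)%C *+ (i == j).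
Proof. by rewrite !mxE. Qed.
Lemma rdiagM d e : rdiag d *m rdiag e = rdiag (fun i => d i * e i).
Proof.
rewrite /rdiag mulmx_diag; congr diag_mx; apply/rowP=> i; rewrite !mxE.
by rewrite -rmorphM.
Qed.
Lemma rdiag_tr d : \tr (rdiag d) = ((\sum_i d i)%:C)%C.
Proof. by rewrite mxtrace_diag rmorph_sum; apply: eq_bigr => i _; rewrite !mxE. Qed.
Lemma rdiag_herm d : is_herm (rdiag d).
Proof.
apply/matrixP=> i j; rewrite adjmxE !rdiagE eq_sym; case: eqP => [->|_]; rewrite ?mulr1n ?mulr0n ?conj_real ?rmorph0 //.
Qed.
Lemma rdiag_sum d : rdiag d = \sum_i ((d i)%:C)%C *: delta_mx i i.
Proof. by rewrite /rdiag diag_mx_sum_delta; apply: eq_bigr => i _; rewrite mxE. Qed.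

Lemma herm_spectral A : is_herm A ->
  exists V, exists d : 'I_n -> R, unitary V /\ A = uconj V (rdiag d).
Proof.
move=> hA; have hA' : A \is hermsymmx.
  apply/is_hermitianmxP; rewrite expr0 scale1r -[LHS]hA.
  by rewrite /adjmx map_trmx.
have /orthomx_spectralP A_eq := hermitian_normalmx hA'.
have /mxOverP hr := hermitian_spectral_diag_real hA'.
have hU := spectral_unitarymx A.
have adjE : adjmx (spectralmx A) = map_mx Num.conj ((spectralmx A)^T).
  by rewrite /adjmx map_trmx.
exists (spectralmx A), (fun i => complex.Re (spectral_diag A 0 i)); split.
  by apply: mulmx1C; rewrite adjE; apply/unitarymxP.
have dE : rdiag (fun i => complex.Re (spectral_diag A 0 i)) = diag_mx (spectral_diag A).
  by congr diag_mx; apply/rowP=> i; rewrite mxE RRe_real //; apply: hr.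
by rewrite {1}A_eq (invmx_unitary hU) -adjE dE.
Qed.

Definition rtr X : R := complex.Re (\tr X).
Lemma rtrD X Y : rtr (X + Y) = rtr X + rtr Y.
Proof. by rewrite /rtr mxtraceD ReD. Qed.
Lemma rtrN X : rtr (- X) = - rtr X.
Proof. by rewrite /rtr -scaleN1r mxtraceZ mulN1r ReN. Qed.
Lemma rtrB X Y : rtr (X - Y) = rtr X - rtr Y.
Proof. by rewrite rtrD rtrN. Qed.
Lemma rtrZ a X : rtr (rscale a X) = a * rtr X.
Proof. by rewrite /rtr mxtraceZ Re_realM. Qed.
Lemma rtrC X Y : rtr (X *m Y) = rtr (Y *m X).
Proof. by rewrite /rtr mxtrace_mulC. Qed.
Lemma rtr_herm A : is_herm A -> \tr A = ((rtr A)%:C)%C.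
Proof.
by move=> hA; rewrite RRe_real //; apply/CrealP; rewrite -mxtrace_adj hA.
Qed.
Lemma rtr_hermM A B : is_herm A -> is_herm B -> \tr (A *m B) = ((rtr (A *m B))%:C)%C.
Proof.
move=> hA hB; rewrite RRe_real //; apply/CrealP.
by rewrite -mxtrace_adj adjmxM hA hB mxtrace_mulC.
Qed.
Lemma rtr_sq X : rtr (X *m adjmx X) = \sum_i \sum_j sqmod (X i j).
Proof.
rewrite /rtr /mxtrace Re_sum; apply: eq_bigr => i _.
by rewrite mxE Re_sum; apply: eq_bigr => j _; rewrite adjmxE.
Qed.
Lemma rtr_sq_ge0 X : 0 <= rtr (X *m adjmx X).
Proof.
by rewrite rtr_sq; apply: sumr_ge0 => i _; apply: sumr_ge0 => j _; apply: sqmod_ge0.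
Qed.
Lemma rtr_sq_eq0 X : rtr (X *m adjmx X) = 0 -> X = 0.
Proof.
rewrite rtr_sq => /eqP; rewrite psumr_eq0; last first.
  by move=> i _; apply: sumr_ge0 => j _; apply: sqmod_ge0.
move=> /allP h; apply/matrixP=> i j; rewrite mxE; apply/eqP.
move: (h i (mem_index_enum i)); rewrite implyTb psumr_eq0; last first.
  by move=> l _; apply: sqmod_ge0.
by move=> /allP/(_ j (mem_index_enum j)); rewrite implyTb sqmod_eq0.
Qed.

Lemma herm_rscale a A : is_herm A -> is_herm (rscale a A).
Proof. by rewrite /is_herm /rscale adjmxZ conj_real => ->. Qed.
Lemma hermD A B : is_herm A -> is_herm B -> is_herm (A + B).
Proof. by rewrite /is_herm adjmxD => -> ->. Qed.
Lemma hermN A : is_herm A -> is_herm (- A).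
Proof. by rewrite /is_herm adjmxN => ->. Qed.
Lemma herm1 : is_herm (1%:M : 'M[C]_n).
Proof. exact: adjmx1. Qed.
End Basics.

(** * The k-numerical radius is attained, and norming projections commute *)

(** Induction on [k], each time adding a largest remaining entry, which becomes the new threshold
    [c]. Keeping a threshold instead of a sorted list handles ties uniformly. *)
Lemma top_subset (R : realType) n (d : 'I_n -> R) k : (k < n)%N ->
  exists (S : {set 'I_n}) (c : R), [/\ #|S| = k,
    forall i, i \in S -> c <= d i & forall i, i \notin S -> d i <= c].
Proof.
elim: k => [n_gt0|k IHk lt_kn].
  pose i0 := Ordinal n_gt0.
  case: (@arg_maxP _ _ _ i0 predT d isT) => i _ hi.
  exists finset.set0, (d i); split; [by rewrite cards0|by move=> j; rewrite inE|].
  by move=> j _; apply: hi.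
have [S [c [cS hin hout]]] := IHk (ltnW lt_kn).
have [i0 hi0] : exists i0, i0 \in ~: S.
  by apply/card_gt0P; rewrite cardsCs finset.setCK card_ord cS subn_gt0 ltnW.
rewrite inE in hi0.
case: (@arg_maxP _ _ _ i0 (fun i => i \notin S) d hi0) => i hi himax.
exists (i |: S), (d i); split.
- by rewrite cardsU1 hi cS.
- move=> j; rewrite !inE => /orP[/eqP->//|jS].
  by apply: le_trans (hin _ jS); apply: hout.
- by move=> j; rewrite !inE negb_or => /andP[_ jS]; apply: himax.
Qed.

Lemma norming_sum (F : numDomainType) (a b wa wb : F) :
  a <= wa -> b <= wb -> wa + wb <= a + b -> a = wa /\ b = wb.
Proof.
move=> ha hb hab; have eb : b = wb.
  apply/eqP; rewrite eq_le hb -(lerD2l wa).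
  by apply: le_trans hab _; rewrite lerD2r.
by split=> //; apply/eqP; rewrite eq_le ha -(lerD2r wb) -{2}eb.
Qed.

Section Attained.
Variable R : realType.
Local Notation C := R[i].
Variables (n k : nat).
Implicit Types A B P Q : 'M[C]_n.

Definition dpart Q (i : 'I_n) : R := complex.Re (Q i i).

Lemma dpart_row Q i : rank_proj k Q ->
  dpart Q i = \sum_j sqmod (Q i j).
Proof.
move=> [h1 [h2 _]]; rewrite /dpart -[in LHS]h2 -[in X in _ *m X]h1 mxE Re_sum.
by apply: eq_bigr => j _; rewrite adjmxE.
Qed.

Lemma dpart_real Q i : rank_proj k Q -> Q i i = ((dpart Q i)%:C)%C.
Proof.
move=> [h1 _]; rewrite RRe_real //; apply/CrealP.
by rewrite -[in LHS]h1 adjmxE conjCK.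
Qed.

Lemma sqmod_dpart Q i : rank_proj k Q -> sqmod (Q i i) = dpart Q i ^+ 2.
Proof.
move=> h; apply: (@complexI R); rewrite sqmodE (dpart_real _ h) conj_real.
by rewrite -rmorphM.
Qed.

(** Compare diagonal entries in [Q = Q *m adjmx Q]. A diagonal entry equal to 0 or 1 makes the left
    side vanish, and with it the rest of row [i]. *)
Lemma dpart_split Q i : rank_proj k Q ->
  dpart Q i - dpart Q i ^+ 2 = \sum_(j | j != i) sqmod (Q i j).
Proof.
move=> h; apply/eqP; rewrite subr_eq -(sqmod_dpart _ h) [X in _ == X]addrC.
by rewrite (dpart_row i h) (bigD1 i).
Qed.

Lemma dpart_ge0 Q i : rank_proj k Q -> 0 <= dpart Q i.
Proof. by move=> h; rewrite (dpart_row i h); apply: sumr_ge0 => j _; apply: sqmod_ge0. Qed.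

Lemma dpart_le1 Q i : rank_proj k Q -> dpart Q i <= 1.
Proof.
move=> h; have := dpart_ge0 i h.
have : 0 <= dpart Q i - dpart Q i ^+ 2.
  by rewrite dpart_split //; apply: sumr_ge0 => j _; apply: sqmod_ge0.
by nra.
Qed.

Lemma dpart_off Q i : rank_proj k Q -> dpart Q i = 0 \/ dpart Q i = 1 ->
  forall j, j != i -> Q i j = 0.
Proof.
move=> h h01 j ji; have : dpart Q i - dpart Q i ^+ 2 = 0.
  by case: h01 => ->; rewrite ?expr0n ?expr1n subrr.
rewrite dpart_split // => /eqP; rewrite psumr_eq0; last by move=> l _; apply: sqmod_ge0.
by move=> /allP/(_ j (mem_index_enum j)); rewrite ji /= sqmod_eq0 => /eqP.
Qed.

Lemma dpart_sum Q : rank_proj k Q -> \sum_i dpart Q i = k%:R.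
Proof.
by move=> [_ [_ h]]; rewrite -Re_sum -/(mxtrace Q) h Re_nat.
Qed.

Lemma rtr_rdiagM d Q : rtr (rdiag d *m Q) = \sum_i d i * dpart Q i.
Proof.
rewrite /rtr /mxtrace Re_sum; apply: eq_bigr => i _.
by rewrite /rdiag mul_diag_mx !mxE Re_realM.
Qed.

Lemma rdiag_proj (S : {set 'I_n}) : #|S| = k ->
  rank_proj k (rdiag (fun i => (i \in S)%:R : R)).
Proof.
move=> cS; split; first exact: rdiag_herm.
split.
  by rewrite rdiagM; congr rdiag; apply/funext => i; case: (_ \in _); rewrite ?mulr1 ?mulr0.
rewrite rdiag_tr -(rmorph_nat (real_complex R)) -cS -sum1_card natr_sum.
by rewrite [in RHS]big_mkcond; congr real_complex_def; apply: eq_bigr => i _; case: (_ \in _).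
Qed.

(** Ky Fan's maximum principle for a diagonal matrix, with its equality case. There each index is at
    the threshold or has [Q i i] equal to 0 or 1, so [Q] has nonzero off-diagonal entries only
    between indices where [d] equals [c]. *)
Lemma diag_top (d : 'I_n -> R) (S : {set 'I_n}) c Q :
  #|S| = k -> (forall i, i \in S -> c <= d i) -> (forall i, i \notin S -> d i <= c) ->
  rank_proj k Q ->
  rtr (rdiag d *m Q) <= rtr (rdiag d *m rdiag (fun i => (i \in S)%:R)) /\
  (rtr (rdiag d *m rdiag (fun i => (i \in S)%:R)) = rtr (rdiag d *m Q) ->
    rdiag d *m Q = Q *m rdiag d).
Proof.
move=> cS hin hout hQ.
pose e i : R := (i \in S)%:R.
have hS := rdiag_proj cS.
have deE : dpart (rdiag e) = e by apply/funext => i; rewrite /dpart rdiagE eqxx.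
(* Both diagonals sum to [k], so [d i] may be replaced by [d i - c]; every summand then becomes
   nonnegative. *)
have key : rtr (rdiag d *m rdiag e) - rtr (rdiag d *m Q)
    = \sum_i (d i - c) * (e i - dpart Q i).
  rewrite !rtr_rdiagM deE -sumrB.
  have -> : \sum_i (d i * e i - d i * dpart Q i) =
     \sum_i (d i - c) * (e i - dpart Q i) + c * (\sum_i e i - \sum_i dpart Q i).
    by rewrite -sumrB mulr_sumr -big_split; apply: eq_bigr => i _ /=; ring.
  by rewrite -{2}deE !dpart_sum // subrr mulr0 addr0.
have pos i : 0 <= (d i - c) * (e i - dpart Q i).
  have h0 := dpart_ge0 i hQ; have h1 := dpart_le1 i hQ.
  rewrite /e; case: (boolP (i \in S)) => iS.
    by apply: mulr_ge0; rewrite subr_ge0 //; apply: hin.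
  by apply: mulr_le0; rewrite subr_le0 //; apply: hout.
rewrite -/e; split; first by rewrite -subr_ge0 key sumr_ge0.
move=> heq; move: key; rewrite heq subrr => /esym/eqP.
rewrite psumr_eq0 // => /allP h0.
have dich i : d i = c \/ (dpart Q i = 0 \/ dpart Q i = 1).
  move: (h0 i (mem_index_enum i)) => /=.
  rewrite mulf_eq0 !subr_eq0 => /orP[/eqP|/eqP]; first by left.
  by rewrite /e; case: (_ \in _) => h; right; [right|left].
apply/matrixP => i j; rewrite /rdiag mul_diag_mx mul_mx_diag !mxE mulrC.
have [->//|ij] := eqVneq i j.
have hji : Q i j = Num.conj (Q j i) by have [h _] := hQ; rewrite -{1}h adjmxE.
case: (dich i) => [di|/(dpart_off hQ) hi]; last by rewrite hi ?mul0r // eq_sym.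
case: (dich j) => [dj|/(dpart_off hQ) hj]; first by rewrite di dj.
by rewrite hji hj // rmorph0 !mul0r.
Qed.

Lemma top_proj A : (k < n)%N -> is_herm A ->
  exists2 Q0, rank_proj k Q0 & forall Q, rank_proj k Q ->
   rtr (A *m Q) <= rtr (A *m Q0) /\
   (rtr (A *m Q0) = rtr (A *m Q) -> A *m Q = Q *m A).
Proof.
move=> lt_kn /herm_spectral[V [d [hV ->]]].
have [S [c [cS hin hout]]] := top_subset d lt_kn.
have hS := rdiag_proj cS; set QS := rdiag _ in hS.
exists (uconj V QS); first exact: uconj_proj.
have trE X Y : rtr (uconj V X *m uconj V Y) = rtr (X *m Y).
  by rewrite -(uconjM _ _ hV) /rtr (uconj_tr _ hV).
move=> Q /(uconj_proj (unitary_adj hV)); rewrite -{2 3 4 5}(uconjKV Q hV).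
move: (uconj (adjmx V) Q) => Q' hQ'; rewrite (trE _ Q') (trE _ QS).
have [h1 h2] := diag_top cS hin hout hQ'; split; first exact: h1.
by move=> h; rewrite -!(uconjM _ _ hV) (h2 h).
Qed.

(** The supremum in [wk] is unfolded only here. It is a maximum because the extreme values of the
    trace are reached, at top projections of [A] and of [- A]. *)
Lemma wkP A : (k < n)%N -> is_herm A ->
  (forall Q, rank_proj k Q -> `|rtr (A *m Q)| <= wk k A) /\
  (exists2 Q, rank_proj k Q & `|rtr (A *m Q)| = wk k A).
Proof.
move=> lt_kn hA.
have [Q1 hQ1 h1] := top_proj lt_kn hA.
have [Q2 hQ2 h2] := top_proj lt_kn (hermN hA).
have [Q0 hQ0 h0] : exists2 Q0, rank_proj k Q0 &
    forall Q, rank_proj k Q -> `|rtr (A *m Q)| <= `|rtr (A *m Q0)|.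
  have hb Q : rank_proj k Q -> `|rtr (A *m Q)| <= `|rtr (A *m Q1)| \/ `|rtr (A *m Q)| <= `|rtr (A *m Q2)|.
    move=> hQ; have [l1 _] := h1 _ hQ; have [l2 _] := h2 _ hQ.
    rewrite !mulNmx !rtrN lerN2 in l2.
    case: (lerP 0 (rtr (A *m Q))) => hs.
      by left; apply: le_trans _ (ler_norm _); rewrite ger0_norm.
    right; rewrite ltr0_norm // -(normrN (rtr (A *m Q2))). apply: (le_trans _ (ler_norm _)). by rewrite lerN2.
  case: (lerP `|rtr (A *m Q1)| `|rtr (A *m Q2)|) => h.
    exists Q2 => // Q /hb [] // h'; exact: le_trans h' h.
  exists Q1 => // Q /hb [] // h'; exact: le_trans h' (ltW h).
have cE Q : rank_proj k Q -> cmod (\tr (A *m Q)) = `|rtr (A *m Q)|.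
  move=> hQ; rewrite cmod_real // rtr_hermM //; last by case: hQ.
  by apply/complex_realP; eexists.
have wE : wk k A = `|rtr (A *m Q0)|.
  rewrite /wk; apply/eqP; rewrite eq_le; apply/andP; split.
    apply: ge_sup; first by exists (cmod (\tr (A *m Q0))), Q0.
    by move=> _ [Q /= hQ <-]; rewrite cE // h0.
  apply: ub_le_sup; last by exists Q0 => //=; rewrite cE.
  by exists `|rtr (A *m Q0)| => _ [Q /= hQ <-]; rewrite cE // h0.
by rewrite wE; split => //; exists Q0.
Qed.

(** According to the sign of the trace, [Q] maximises the trace against [A] or against [- A], and
    the equality case of [top_proj] applies. *)
Lemma norming_comm A Q : (k < n)%N -> is_herm A -> rank_proj k Q ->
  `|rtr (A *m Q)| = wk k A -> A *m Q = Q *m A.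
Proof.
move=> lt_kn hA hQ hw; have [hub _] := wkP lt_kn hA.
case: (lerP 0 (rtr (A *m Q))) => hs.
  have [Q1 hQ1 /(_ Q hQ)[h1 h2]] := top_proj lt_kn hA.
  apply: h2; apply/eqP; rewrite eq_le h1 andbT.
  by rewrite ger0_norm // in hw; rewrite hw; apply: le_trans (hub _ hQ1); apply: ler_norm.
have [Q1 hQ1 /(_ Q hQ)[h1 h2]] := top_proj lt_kn (hermN hA).
suff : (- A) *m Q = Q *m (- A) by rewrite mulNmx mulmxN => /oppr_inj.
apply: h2; apply/eqP; rewrite eq_le h1 andbT.
rewrite ltr0_norm // in hw; rewrite !mulNmx !rtrN hw.
by apply: le_trans (hub _ hQ1); rewrite -normrN ler_norm.
Qed.

Lemma wk_unique A m : (k < n)%N -> is_herm A ->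
  (forall Q, rank_proj k Q -> `|rtr (A *m Q)| <= m) ->
  (exists2 Q, rank_proj k Q & `|rtr (A *m Q)| = m) -> wk k A = m.
Proof.
move=> lt_kn hA hub [Q hQ hQm]; have [hub' [Q' hQ' hQm']] := wkP lt_kn hA.
by apply/eqP; rewrite eq_le -{1}hQm' hub //= -hQm hub'.
Qed.

Lemma wk_rscale a A : (k < n)%N -> is_herm A -> wk k (rscale a A) = `|a| * wk k A.
Proof.
move=> lt_kn hA; have [hub [Q hQ hQw]] := wkP lt_kn hA.
apply: wk_unique => //; first exact: herm_rscale.
  by move=> P hP; rewrite -scalemxAl rtrZ normrM ler_wpM2l // hub.
by exists Q => //; rewrite -scalemxAl rtrZ normrM hQw.
Qed.

Lemma wk_add_norming A B : (k < n)%N -> is_herm A -> is_herm B ->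
  wk k (A + B) = wk k A + wk k B <->
  exists2 Q, rank_proj k Q &
    exists s : R, [/\ `|s| = 1, s * rtr (A *m Q) = wk k A & s * rtr (B *m Q) = wk k B].
Proof.
move=> lt_kn hA hB; have hAB := hermD hA hB.
have [ubA _] := wkP lt_kn hA; have [ubB _] := wkP lt_kn hB.
have [ubAB [Q hQ hw]] := wkP lt_kn hAB; split.
  move=> heq; exists Q => //.
  have [s s1 hs] : exists2 s : R, `|s| = 1 & `|rtr ((A + B) *m Q)| = s * rtr ((A + B) *m Q).
    case: (lerP 0 (rtr ((A + B) *m Q))) => h.
      by exists 1; rewrite ?normr1 // mul1r ger0_norm.
    by exists (-1); rewrite ?normrN1 // mulN1r ltr0_norm.
  exists s.
  have hle X : s * rtr (X *m Q) <= `|rtr (X *m Q)|.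
    by rewrite -[X in _ <= X]mul1r -s1 -normrM ler_norm.
  have h1 := le_trans (hle A) (ubA _ hQ).
  have h2 := le_trans (hle B) (ubB _ hQ).
  have h3 : s * rtr (A *m Q) + s * rtr (B *m Q) = wk k A + wk k B.
    by rewrite -mulrDr -rtrD -mulmxDl -hs hw.
  have h4 : wk k A + wk k B <= s * rtr (A *m Q) + s * rtr (B *m Q) by rewrite h3.
  have [e1 e2] := norming_sum h1 h2 h4.
  by split; [exact: s1|exact: e1|exact: e2].
move=> [P hP [s [s1 hsA hsB]]]; apply: wk_unique => //.
  move=> P' hP'; rewrite mulmxDl rtrD; apply: le_trans (ler_normD _ _) _.
  by apply: lerD; [apply: ubA|apply: ubB].
exists P => //; rewrite mulmxDl rtrD -[LHS]mul1r -s1 -normrM mulrDr hsA hsB.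
have wA0 : 0 <= wk k A by apply: le_trans (ubA _ hP).
have wB0 : 0 <= wk k B by apply: le_trans (ubB _ hP).
by rewrite ger0_norm; last exact: addr_ge0 wA0 wB0.
Qed.

(** The sign [mu] absorbs the two independent signs of the traces, so that only absolute values
    remain; for TEA pairs both traces must carry the same sign. *)
Lemma parallel_norming A B : (k < n)%N -> is_herm A -> is_herm B ->
  parallel_k k A B <-> exists2 Q, rank_proj k Q &
   `|rtr (A *m Q)| = wk k A /\ `|rtr (B *m Q)| = wk k B.
Proof.
move=> lt_kn hA hB; split.
  move=> [mu [hmu]].
  have mu1 : `|mu| = 1 by case: hmu => ->; rewrite ?normrN1 ?normr1.
  have -> : wk k B = wk k (rscale mu B) by rewrite wk_rscale // mu1 mul1r.
  move=> /(wk_add_norming lt_kn hA (herm_rscale mu hB))[Q hQ [s [s1 eA eB]]].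
  have [ubA _] := wkP lt_kn hA; have [ubB _] := wkP lt_kn (herm_rscale mu hB).
  have abs (x w : R) : 0 <= w -> s * x = w -> `|x| = w.
    by move=> w0 sx; rewrite -[LHS]mul1r -s1 -normrM sx ger0_norm.
  exists Q; first exact: hQ.
  split; first by apply: abs eA; apply: le_trans (ubA _ hQ).
  have hB' : `|rtr (rscale mu B *m Q)| = wk k (rscale mu B).
    by apply: abs eB; apply: le_trans (ubB _ hQ).
  by rewrite -hB' -scalemxAl rtrZ normrM mu1 mul1r.
move=> [Q hQ [hA1 hB1]].
have sgn (x : R) : exists2 s : R, s = 1 \/ s = -1 & `|x| = s * x.
  by case: (ger0P x) => _; [exists 1|exists (-1)]; rewrite ?mul1r ?mulN1r; auto.
have [sA hsA eA] := sgn (rtr (A *m Q)); have [sB hsB eB] := sgn (rtr (B *m Q)).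
have hmu : sA * sB = 1 \/ sA * sB = -1.
  by case: hsA => ->; case: hsB => ->; rewrite ?mulrNN ?mulrN ?mulNr ?mulr1; auto.
have mu1 : `|sA * sB| = 1 by case: hmu => ->; rewrite ?normrN1 ?normr1.
have sA2 : sA * sA = 1 by case: hsA => ->; rewrite ?mulrNN mulr1.
have hmB := herm_rscale (sA * sB) hB.
have wmB : wk k (rscale (sA * sB) B) = wk k B by rewrite (wk_rscale _ lt_kn hB) mu1 mul1r.
exists (sA * sB); split; first exact: hmu.
apply: etrans (congr1 (fun w => wk k A + w) wmB).
apply/(wk_add_norming lt_kn hA hmB); exists Q; first exact: hQ.
exists sA; split.
- by case: hsA => ->; rewrite ?normrN1 ?normr1.
- by rewrite -eA; exact: hA1.
- by rewrite wmB -scalemxAl rtrZ -hB1 eB !mulrA sA2 mul1r.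
Qed.

End Attained.

(** * Traces of pairs of projections; commutants of families of rank-k projections *)

Section Commutant.
Variable R : realType.
Local Notation C := R[i].
Variables (n k : nat).
Implicit Types (P Q X : 'M[C]_n).

(** The right side is a squared Hilbert-Schmidt norm. It vanishes only for [Q = P], and it is the
    small parameter in [proj_core]. *)
Lemma rtr_proj_split P Q : rank_proj k P -> rank_proj k Q ->
  k%:R - rtr (P *m Q) = rtr ((P *m (1%:M - Q)) *m adjmx (P *m (1%:M - Q))).
Proof.
move=> [p1 [p2 p3]] [q1 [q2 q3]].
have ZZ : (1%:M - Q) *m (1%:M - Q) = 1%:M - Q.
  by rewrite mulmxBr mulmx1 mulmxBl mul1mx q2 subrr subr0.
rewrite adjmxM adjmxB adjmx1 p1 q1 !mulmxA -(mulmxA P) ZZ.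
rewrite [in RHS]rtrC mulmxA p2 mulmxBr mulmx1 rtrB.
by rewrite /rtr p3 Re_nat.
Qed.

Lemma rtr_proj_le P Q : rank_proj k P -> rank_proj k Q -> rtr (P *m Q) <= k%:R.
Proof. by move=> hP hQ; rewrite -subr_ge0 rtr_proj_split // rtr_sq_ge0. Qed.

Lemma rtr_proj_ge0 P Q : rank_proj k P -> rank_proj k Q -> 0 <= rtr (P *m Q).
Proof.
move=> [p1 [p2 p3]] [q1 [q2 q3]].
suff -> : rtr (P *m Q) = rtr ((P *m Q) *m adjmx (P *m Q)) by apply: rtr_sq_ge0.
by rewrite adjmxM p1 q1 mulmxA -(mulmxA P) q2 [in RHS]rtrC mulmxA p2.
Qed.

Lemma rtr_proj_eq P Q : rank_proj k P -> rank_proj k Q -> rtr (P *m Q) = k%:R -> P = Q.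
Proof.
move=> hP hQ h.
have hPQ : P = P *m Q.
  apply/eqP; rewrite -subr_eq0 -{1}(mulmx1 P) -mulmxBr; apply/eqP.
  by apply: rtr_sq_eq0; rewrite -rtr_proj_split // h subrr.
have hQP : Q = Q *m P.
  apply/eqP; rewrite -subr_eq0 -{1}(mulmx1 Q) -mulmxBr; apply/eqP.
  by apply: rtr_sq_eq0; rewrite -rtr_proj_split // rtrC h subrr.
have [p1 _] := hP; have [q1 _] := hQ.
by rewrite -p1 hPQ adjmxM p1 q1 -hQP.
Qed.

(** [P] reaches the value [k] on itself, and [rtr_proj_eq] leaves no other maximiser. Hence being
    parallel to [P] means being normed by [P]. *)
Lemma wk_proj P Q : (k < n)%N -> rank_proj k P -> rank_proj k Q ->
  `|rtr (P *m Q)| = wk k P -> P = Q.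
Proof.
move=> lt_kn hP hQ; have [h1 [h2 h3]] := hP.
have [ub _] := wkP lt_kn h1; move=> h; apply: rtr_proj_eq => //.
have := ub _ hP; rewrite h2 {1}/rtr h3 Re_nat normr_nat -h.
rewrite ger0_norm ?rtr_proj_ge0 // => h'.
by apply/eqP; rewrite eq_le h' rtr_proj_le.
Qed.

Lemma rtr1_proj Q : rank_proj k Q -> rtr (1%:M *m Q) = k%:R.
Proof. by move=> [_ [_ h]]; rewrite mul1mx /rtr h Re_nat. Qed.

Lemma wk_one : (k < n)%N -> wk k (1%:M : 'M[C]_n) = k%:R.
Proof.
move=> lt_kn; have [_ [Q hQ <-]] := wkP lt_kn (@herm1 R n).
by rewrite rtr1_proj // normr_nat.
Qed.

Hypotheses (k_gt0 : (0 < k)%N) (lt_kn : (k < n)%N).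

Lemma subset_avoiding (i j : 'I_n) : i != j ->
  exists S : {set 'I_n}, [/\ #|S| = k.-1, i \notin S & j \notin S].
Proof.
move=> ij; have : (k.-1 <= #|~: [set i; j]|)%N.
  rewrite cardsCs finset.setCK card_ord cards2 ij.
  by case: k k_gt0 lt_kn => //= m _; case: n => // -[|p] //; rewrite !ltnS subSS subSS subn0.
move=> /card_geqP[s [us ss hs]]; exists [set x in s]; split.
- by rewrite -ss -(card_uniqP us); apply: eq_card => x; rewrite inE.
- by rewrite inE; apply/negP => /hs; rewrite !inE eqxx.
- by rewrite inE; apply/negP => /hs; rewrite !inE eqxx orbT.
Qed.

Definition subordinate (c : 'I_n -> nat) P := forall i j, c i != c j -> P i j = 0.

(** The projection is the coordinate projection onto [S] plus the rank-one projection onto the sum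
    of the basis vectors [i] and [j]; [2^-1] normalises [u], whose square length is 2. Its entry at
    [(i, j)] lets [commutant_diag] compare two diagonal entries. *)
Lemma diag_pair_proj (S : {set 'I_n}) (i j : 'I_n) :
  i != j -> #|S| = k.-1 -> i \notin S -> j \notin S ->
  exists2 P : 'M[C]_n, rank_proj k P & [/\ P i j = 2^-1 &
    forall a b, P a b != 0 -> a = b \/ (a \in [set i; j]) && (b \in [set i; j])].
Proof.
move=> ij cS iS jS.
pose u : 'rV[C]_n := \row_l (l \in [set i; j])%:R.
pose D : 'M[C]_n := rdiag (fun l => (l \in S)%:R : R).
have uu : u *m u^T = 2%:R%:M.
  apply/matrixP=> a b; rewrite !ord1 !mxE eqxx mulr1n.
  rewrite (eq_bigr (fun l => if l \in [set i; j] then 1 else 0)); last first.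
    by move=> l _; rewrite !mxE; case: (_ \in _); rewrite ?mulr1 ?mulr0.
  by rewrite -big_mkcond /= sumr_const cards2 ij.
have uD : u *m D = 0.
  apply/rowP=> l; rewrite /D /rdiag mul_mx_diag !mxE !inE.
  by case: eqP => [->|_]; [|case: eqP => [->|_]]; rewrite ?(negbTE iS) ?(negbTE jS) ?mulr0 ?mul0r.
have Du : D *m u^T = 0.
  apply/colP=> l; rewrite /D /rdiag mul_diag_mx !mxE !inE.
  by case: eqP => [->|_]; [|case: eqP => [->|_]]; rewrite ?(negbTE iS) ?(negbTE jS) ?mulr0 ?mul0r.
pose W : 'M[C]_n := 2^-1 *: (u^T *m u).
have two0 : (2 : C) != 0 by rewrite pnatr_eq0.
have WW : W *m W = W.
  rewrite /W -scalemxAl -scalemxAr mulmxA -(mulmxA u^T) uu mul_mx_scalar -scalemxAl.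
  by rewrite !scalerA mulVf // mulr1.
have WE a b : W a b = 2^-1 * ((a \in [set i; j])%:R * (b \in [set i; j])%:R).
  by rewrite mxE mxE big_ord1 !mxE.
have [d1 [d2 d3]] : rank_proj k.-1 D by exact: rdiag_proj cS.
have hW : adjmx W = W.
  apply/matrixP=> a b; rewrite adjmxE !WE !rmorphM fmorphV !rmorph_nat.
  by congr (_ * _); rewrite mulrC.
exists (D + W); first split.
- by rewrite adjmxD d1 hW.
- split.
    rewrite mulmxDl !mulmxDr d2 WW /W -scalemxAr -scalemxAl mulmxA Du mul0mx.
    by rewrite -mulmxA uD mulmx0 scaler0 addr0 add0r.
  rewrite mxtraceD d3 /W mxtraceZ mxtrace_mulC uu mxtrace_scalar mulr1n mulVf //.
  by rewrite natr1 prednK.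
split; first by rewrite mxE WE rdiagE (negbTE ij) !inE !eqxx orbT add0r mulr1 mulr1.
move=> a b; have [->|ab] := eqVneq a b; first by left.
rewrite mxE WE rdiagE (negbTE ab) mulr0n add0r => h; right; move: h; case: (a \in _); last by rewrite mul0r mulr0 eqxx.
by case: (b \in _); rewrite // !mulr0 eqxx.
Qed.

(** A bicommutant computation using rank-[k] projections only: coordinate projections remove
    off-diagonal entries, and those of [diag_pair_proj] equate diagonal entries within a block. With
    [diag_commutant] it presents the block-constant diagonals as an intersection of commutants, a
    shape that the preserver respects. *)
Lemma commutant_diag (c : 'I_n -> nat) X :
  (forall P, rank_proj k P -> subordinate c P -> X *m P = P *m X) ->
  (forall i j, i != j -> X i j = 0) /\ (forall i j, c i = c j -> X i i = X j j).
Proof.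
move=> hX.
have offd i j : i != j -> X i j = 0.
  move=> ij; have [S [cS iS jS]] := subset_avoiding ij.
  pose S' := i |: S.
  have hS' : rank_proj k (rdiag (fun l => (l \in S')%:R : R)).
    by apply: rdiag_proj; rewrite cardsU1 iS cS add1n prednK.
  have /(hX _ hS') : subordinate c (rdiag (fun l => (l \in S')%:R : R)).
    move=> a b cab; rewrite rdiagE; have /negbTE-> // : a != b.
    by apply: contraNneq cab => ->.
  move=> /matrixP/(_ i j); rewrite /rdiag mul_mx_diag mul_diag_mx !mxE !inE eqxx /=.
  by rewrite eq_sym (negbTE ij) (negbTE jS) /= mulr0 mul1r.
split=> // i j cij; have [->//|ij] := eqVneq i j.
have [S [cS iS jS]] := subset_avoiding ij.
have [P hP [Pij hsub]] := diag_pair_proj ij cS iS jS.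
have hsP : subordinate c P.
  move=> a b; apply: contra_neq_eq => /hsub[->//|/andP[]].
  by rewrite !inE => /orP[]/eqP-> /orP[]/eqP->.
have := hX _ hP hsP => /matrixP/(_ i j); rewrite !mxE.
rewrite (bigD1 i) //= big1 ?addr0; last by move=> l li; rewrite offd ?mul0r // eq_sym.
rewrite (bigD1 j) //= [in RHS]big1 ?addr0; last by move=> l li; rewrite offd ?mulr0.
rewrite Pij mulrC => /mulfI; apply.
by rewrite invr_eq0 pnatr_eq0.
Qed.

Lemma diag_commutant (c : 'I_n -> nat) X P :
  (forall i j, i != j -> X i j = 0) -> (forall i j, c i = c j -> X i i = X j j) ->
  subordinate c P -> X *m P = P *m X.
Proof.
move=> offd hc hP; apply/matrixP=> i j; rewrite !mxE.
rewrite (bigD1 i) //= big1 ?addr0; last by move=> l li; rewrite offd ?mul0r // eq_sym.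
rewrite (bigD1 j) //= [in RHS]big1 ?addr0; last by move=> l li; rewrite offd ?mulr0.
by have [/hc->|/hP->] := eqVneq (c i) (c j); rewrite ?mulr0 ?mul0r // mulrC.
Qed.

Lemma commute_all_scalar X :
  (forall P, rank_proj k P -> X *m P = P *m X) -> exists a, X = a%:M.
Proof.
move=> h; have [|offd hc] := @commutant_diag (fun=> 0%N) X; first by move=> P hP _; apply: h.
have i0 : 'I_n by exists 0%N; apply: leq_ltn_trans lt_kn.
exists (X i0 i0); apply/matrixP => i j; rewrite !mxE.
by case: eqP => [->|/eqP ij]; [rewrite mulr1n; apply: hc|rewrite offd].
Qed.

End Commutant.

(** * Norming cones of a projection *)

(** The scalar estimate behind [proj_core]: [K] is [k], [d] the defect [k - rtr (P *m Q)], [x] the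
    trace of the direction against [P], and [u], [v] its traces against two corners, both of order
    [d]. For the upper bound [- d] outweighs [t * (v - u)]; for the lower one [d <= K] leaves room
    of size [K]. *)
Lemma perturbation_bound (F : realFieldType) (t c d K m x u v : F) :
  0 <= c -> 1 <= K -> 0 <= d -> d <= K -> m = 2 * `|x| + c * K * 2 + 1 ->
  `|t| * m <= 1 -> `|u| <= c * d -> `|v| <= c * d ->
  `|K - d + t * (x - u + v)| <= K + t * x.
Proof.
move=> c0 K1 d0 dK mE tm hu hv.
have hcm : c * 2 <= m.
  rewrite mE; have := normr_ge0 x.
  have : 0 <= c * (K - 1) by rewrite mulr_ge0 // subr_ge0.
  by nra.
have hyx : `|v - u| <= 2 * c * d by apply: le_trans (ler_normB _ _) _; lra.
have hty : `|t * (v - u)| <= d.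
  rewrite normrM; apply: le_trans (ler_wpM2l (normr_ge0 t) hyx) _.
  have -> : `|t| * (2 * c * d) = (`|t| * (c * 2)) * d by ring.
  rewrite -[leRHS]mul1r ler_wpM2r //; apply: le_trans tm.
  by rewrite ler_wpM2l.
have htx : 2 * `|t * x| + `|t * (v - u)| <= K.
  apply: (@le_trans _ _ (`|t| * m)); last by lra.
  rewrite !normrM mulrCA -mulrDr ler_wpM2l //.
  apply: (@le_trans _ _ (2 * `|x| + 2 * c * d)); first by rewrite lerD2l.
  have : c * d <= c * K by rewrite ler_wpM2l.
  by rewrite mE; lra.
have -> : K - d + t * (x - u + v) = K + t * x + (t * (v - u) - d) by ring.
have h1 := ler_norm (- (t * x)); rewrite normrN in h1.
have h2 := ler_norm (- (t * (v - u))); rewrite normrN in h2.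
have h3 := ler_norm (t * (v - u)).
move: (t * x) (t * (v - u)) h1 h2 h3 htx hty => a b h1 h2 h3 htx hty.
by rewrite ler_norml; apply/andP; split; lra.
Qed.

Section Cones.
Variable R : realType.
Local Notation C := R[i].
Variables (n k : nat).
Hypotheses (k_gt0 : (0 < k)%N) (lt_kn : (k < n)%N).
Implicit Types (A B P Q X Y Z : 'M[C]_n).

Lemma rtr_herm_bound X : is_herm X ->
  exists2 c : R, 0 <= c & forall Z, `|rtr (X *m (Z *m adjmx Z))| <= c * rtr (Z *m adjmx Z).
Proof.
move=> /herm_spectral[V [d [hV ->]]].
exists (\sum_i `|d i|); first by apply: sumr_ge0.
move=> Z; pose W := adjmx (adjmx V) *m Z.
have hW : Z *m adjmx Z = uconj V (W *m adjmx W).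
  rewrite /W adjmxK -[LHS](uconjKV _ hV); congr uconj.
  by rewrite /uconj adjmxK adjmxM !mulmxA.
have hV' : unitary (adjmx V) by apply: unitary_adj.
have rowE i : complex.Re ((W *m adjmx W) i i) = \sum_j sqmod (W i j).
  by rewrite mxE Re_sum; apply: eq_bigr => j _; rewrite adjmxE.
rewrite hW -(uconjM _ _ hV) /rtr !(uconj_tr _ hV) -/(rtr (W *m _)) rtr_sq.
rewrite /mxtrace Re_sum mulr_suml; apply: le_trans (ler_norm_sum _ _ _) _.
apply: ler_sum => i _; rewrite /rdiag mul_diag_mx !mxE Re_realM.
rewrite normrM ler_wpM2l //.
have -> : \sum_j W i j * adjmx W j i = (W *m adjmx W) i i by rewrite mxE.
rewrite rowE ger0_norm ?sumr_ge0 // => [|j _]; last exact: sqmod_ge0.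
rewrite [leRHS](bigD1 i) //= lerDl; apply: sumr_ge0 => l _.
by apply: sumr_ge0 => j _; apply: sqmod_ge0.
Qed.

(** Dropping the absolute value on the right fixes the sign of the trace, which makes these matrices
    a convex cone. *)
Definition in_cone P A :=
  is_herm A /\ forall Q, rank_proj k Q -> `|rtr (A *m Q)| <= rtr (A *m P).

(** The algebraic interior of the cone relative to the commutant of [P]: [e] may depend on the
    direction [X], so no topology is involved. *)
Definition in_core P A :=
  is_herm A /\ forall X, is_herm X -> X *m P = P *m X ->
  exists2 e : R, 0 < e & forall t, `|t| <= e -> in_cone P (A + rscale t X).

Lemma rscale0 X : rscale 0 X = 0.
Proof. by rewrite /rscale scale0r. Qed.
Lemma rscale1 X : rscale 1 X = X.
Proof. by rewrite /rscale scale1r. Qed.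
Lemma rscaleN1 X : rscale (-1) X = - X.
Proof. by rewrite /rscale rmorphN1 scaleN1r. Qed.
Lemma rscaleD a b X : rscale (a + b) X = rscale a X + rscale b X.
Proof. by rewrite /rscale rmorphD scalerDl. Qed.
Lemma rscaleDr a X Y : rscale a (X + Y) = rscale a X + rscale a Y.
Proof. by rewrite /rscale scalerDr. Qed.
Lemma rscaleA a b X : rscale a (rscale b X) = rscale (a * b) X.
Proof. by rewrite /rscale scalerA -rmorphM. Qed.

Lemma coneD P A B : in_cone P A -> in_cone P B -> in_cone P (A + B).
Proof.
move=> [hA ubA] [hB ubB]; split; first exact: hermD.
move=> Q hQ; rewrite !mulmxDl !rtrD; apply: le_trans (ler_normD _ _) _.
by apply: lerD; [apply: ubA|apply: ubB].
Qed.

Lemma cone_scale P a A : 0 <= a -> in_cone P A -> in_cone P (rscale a A).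
Proof.
move=> a0 [hA ubA]; split; first exact: herm_rscale.
by move=> Q hQ; rewrite -!scalemxAl !rtrZ normrM ger0_norm // ler_wpM2l // ubA.
Qed.

Lemma core_cone P A : in_core P A -> in_cone P A.
Proof.
move=> [hA hc]; have [||e e0 /(_ 0)] := hc 0; first exact: adjmx0.
  by rewrite mul0mx mulmx0.
by rewrite rscale0 addr0 normr0; apply; apply: ltW.
Qed.

Lemma core_scale P a A : 0 < a -> in_core P A -> in_core P (rscale a A).
Proof.
move=> a0 [hA hc]; split; first exact: herm_rscale.
move=> X hX cX; have [e e0 he] := hc X hX cX.
exists (a * e); first by rewrite mulr_gt0.
move=> t ht; have -> : rscale a A + rscale t X = rscale a (A + rscale (t / a) X).
  by rewrite rscaleDr rscaleA mulrC divfK ?gt_eqF.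
apply: cone_scale; first exact: ltW.
by apply: he; rewrite normrM normfV (gtr0_norm a0) ler_pdivrMr // mulrC.
Qed.

Lemma core_shift P A X : in_core P A -> is_herm X -> X *m P = P *m X ->
  exists2 e : R, 0 < e & forall t, `|t| <= e -> in_core P (A + rscale t X).
Proof.
move=> [hA hc] hX cX; have [e e0 he] := hc X hX cX.
exists (e / 2); first by rewrite divr_gt0.
move=> t ht; split; first by apply/hermD/herm_rscale.
move=> Y hY cY; have [e' e0' he'] := hc Y hY cY.
exists (e' / 2); first by rewrite divr_gt0.
move=> u hu.
(* A perturbation in two directions is the midpoint of two perturbations in one direction of doubled
   size; hence both radii are halved. *)
have -> : A + rscale t X + rscale u Y =
    rscale 2^-1 (A + rscale (2 * t) X) + rscale 2^-1 (A + rscale (2 * u) Y).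
  rewrite !rscaleDr !rscaleA !mulrA mulVf ?pnatr_eq0 // !mul1r addrACA -rscaleD.
  have -> : 2^-1 + 2^-1 = 1 :> R by field.
  by rewrite rscale1 addrA.
have h2 (x y : R) : `|x| <= y / 2 -> `|2 * x| <= y.
  by rewrite ler_pdivlMr // normrM (gtr0_norm (ltr0Sn _ 1)) mulrC.
by apply: coneD; apply: cone_scale; rewrite ?invr_ge0 //; [apply/he/h2|apply/he'/h2].
Qed.

Lemma coreD P A B : in_core P A -> in_core P B -> in_core P (A + B).
Proof.
move=> [hA hc] cB; have [hB _] := cB; split; first exact: hermD.
move=> X hX cX; have [e e0 he] := hc X hX cX; exists e => // t ht.
by rewrite addrAC; apply: coneD (he t ht) (core_cone cB).
Qed.

(** Take [B = (A + e X) / 2], so that [A - B = (A - e X) / 2]; both stay in the core for small [e].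
    Thus [A + B] and [A - B] are admissible for either sign returned by parallelism, while [A] and
    [B] together recover [X]. *)
Lemma core_step P A X : in_core P A -> is_herm X -> X *m P = P *m X ->
  exists2 B, in_core P B & in_core P (A - B) /\
    exists a b : R, X = rscale a B + rscale b A.
Proof.
move=> cA hX cX; have [e e0 he] := core_shift cA hX cX.
have h2 : 0 < 2^-1 :> R by rewrite invr_gt0.
exists (rscale 2^-1 (A + rscale e X)).
  by apply: core_scale h2 _; apply: he; rewrite gtr0_norm.
split.
  have -> : A - rscale 2^-1 (A + rscale e X) = rscale 2^-1 (A + rscale (- e) X).
    apply/eqP; rewrite subr_eq -rscaleDr addrACA -rscaleD addNr rscale0 addr0.
    rewrite rscaleDr -rscaleD; have -> : 2^-1 + 2^-1 = 1 :> R by field.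
    by rewrite rscale1.
  by apply: core_scale h2 _; apply: he; rewrite normrN gtr0_norm.
exists (2 / e), (- e^-1); rewrite rscaleA rscaleDr rscaleA.
have -> : 2 / e * 2^-1 = e^-1 by field; rewrite gt_eqF.
by rewrite mulVf ?gt_eqF // rscale1 addrAC -rscaleD subrr rscale0 add0r.
Qed.

(** Passing from [P] to [Q] lowers the trace against [P] by [d]. As [X] commutes with [P], its trace
    changes only through the corners [P (1 - Q) P] and [(1 - P) Q (1 - P)], both of trace [d], so a
    small multiple of [X] cannot make up for the loss. *)
Lemma proj_core P : rank_proj k P -> in_core P P.
Proof.
move=> hP; have [p1 [p2 p3]] := hP; split=> // X hX cX.
have [c c0 hc] := rtr_herm_bound hX.
have k1 : (1 : R) <= k%:R by rewrite ler1n.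
pose m := 2 * `|rtr (X *m P)| + c * k%:R * 2 + 1.
have m_gt0 : 0 < m.
  by rewrite /m ltr_wpDl // addr_ge0 // !mulr_ge0 // ler0n.
exists m^-1; first by rewrite invr_gt0.
move=> t ht; split; first by apply/hermD/herm_rscale.
have tm : `|t| * m <= 1 by rewrite -ler_pdivlMr // mul1r.
move=> Q hQ; have [q1 [q2 q3]] := hQ.
rewrite !mulmxDl !rtrD -!scalemxAl !rtrZ p2.
have -> : rtr P = k%:R by rewrite /rtr p3 Re_nat.
pose d := k%:R - rtr (P *m Q).
have d_ge0 : 0 <= d by rewrite /d subr_ge0; apply: rtr_proj_le.
have pq0 : 0 <= rtr (P *m Q) by exact: rtr_proj_ge0 hP hQ.
pose Z1 := P *m (1%:M - Q); pose Z2 := (1%:M - P) *m Q.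
have idemC Y : Y *m Y = Y -> (1%:M - Y) *m (1%:M - Y) = 1%:M - Y.
  by move=> h; rewrite mulmxBr mulmx1 mulmxBl mul1mx h subrr subr0.
have Z1E : Z1 *m adjmx Z1 = P *m (1%:M - Q) *m P.
  by rewrite /Z1 adjmxM adjmxB adjmx1 p1 q1 !mulmxA -(mulmxA P) idemC.
have Z2E : Z2 *m adjmx Z2 = (1%:M - P) *m Q *m (1%:M - P).
  by rewrite /Z2 adjmxM adjmxB adjmx1 p1 q1 !mulmxA -(mulmxA _ Q Q) q2.
have d1 : rtr (Z1 *m adjmx Z1) = d by rewrite -(rtr_proj_split hP hQ).
have d2 : rtr (Z2 *m adjmx Z2) = d.
  rewrite Z2E rtrC mulmxA idemC // mulmxBl mul1mx rtrB {1}/rtr q3 Re_nat.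
  by [].
have split : rtr (X *m Q) = rtr (X *m P) - rtr (X *m (Z1 *m adjmx Z1))
     + rtr (X *m (Z2 *m adjmx Z2)).
  have cX' : X *m (1%:M - P) = (1%:M - P) *m X.
    by rewrite mulmxBr mulmx1 mulmxBl mul1mx cX.
  have e1 : rtr (X *m (Z1 *m adjmx Z1)) = rtr (X *m P) - rtr (X *m P *m Q).
    rewrite Z1E !mulmxA rtrC !mulmxA -cX -(mulmxA X) p2 mulmxBr mulmx1.
    by rewrite rtrB.
  have e2 : rtr (X *m (Z2 *m adjmx Z2)) = rtr (X *m Q) - rtr (X *m P *m Q).
    rewrite Z2E !mulmxA rtrC !mulmxA -cX' -(mulmxA X) idemC //.
    by rewrite mulmxBr mulmx1 mulmxBl rtrB.
  rewrite e1 e2; move: (rtr (X *m P)) (rtr (X *m Q)) (rtr (X *m P *m Q)) => a b c'.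
  by ring.
have b1 := hc Z1; have b2 := hc Z2; rewrite d1 in b1; rewrite d2 in b2.
have -> : rtr (P *m Q) = k%:R - d by rewrite /d opprB addrC subrK.
rewrite split; apply: perturbation_bound c0 k1 d_ge0 _ erefl tm b1 b2.
by rewrite /d lerBlDr lerDl.
Qed.

End Cones.

(** * Parallelism preservers and commutants *)

Lemma cartesian_mul (F : comPzRingType) (i a b x y : F) : i * i = -1 ->
  (a + i * b) * (x + i * y) = (a * x + - b * y) + i * (a * y + b * x).
Proof.
move=> h; have -> : (a + i * b) * (x + i * y) = a * x + i * i * b * y + i * (a * y + b * x).
  by ring.
by rewrite h mulN1r.
Qed.

Section Preserver.
Variable R : realType.
Local Notation C := R[i].
Variables (n k : nat).
Hypotheses (k_gt0 : (0 < k)%N) (lt_kn : (k < n)%N).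
Implicit Types (A B P Q X Y Z : 'M[C]_n).
Variable T : 'M[C]_n -> 'M[C]_n.
Hypothesis T_lin : herm_real_linear T.

Lemma T_herm A : is_herm A -> is_herm (T A). Proof. by case: T_lin => h _; apply: h. Qed.

Lemma T_add A B : is_herm A -> is_herm B -> T (A + B) = T A + T B.
Proof.
by case: T_lin => _ h hA hB; have := h 1 1 A B hA hB; rewrite !rscale1.
Qed.

Lemma T_scale a A : is_herm A -> T (rscale a A) = rscale a (T A).
Proof.
case: T_lin => _ h hA; have := h a 0 A A hA hA.
by rewrite !rscale0 !addr0.
Qed.

Lemma T_zero : T 0 = 0.
Proof. by rewrite -{1}(rscale0 (0 : 'M[C]_n)) T_scale ?rscale0 //; apply: adjmx0. Qed.

Section Parallel.
Hypothesis T_par : forall A B, is_herm A -> is_herm B ->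
  parallel_k k A B -> parallel_k k (T A) (T B).

Lemma cone_parallel P A B : rank_proj k P -> in_cone k P A -> in_cone k P B ->
  parallel_k k A B.
Proof.
have wE X : rank_proj k P -> in_cone k P X -> `|rtr (X *m P)| = wk k X.
  move=> hP [hX ub]; have [ub' [Q hQ hw]] := wkP lt_kn hX.
  apply/eqP; rewrite eq_le ub' //= -hw; apply: le_trans (ub _ hQ) _.
  exact: ler_norm.
move=> hP cA cB; apply/parallel_norming => //; [by case: cA|by case: cB|].
by exists P => //; rewrite !wE.
Qed.

(* The matrix [A] is a signed sum of matrices [B] of the core, so chosen that
   any [Q] norming [T A] norms every [T B], hence commutes with it. *)
Lemma commuting_family P (s : seq 'M[C]_n) : rank_proj k P ->
  (forall X, X \in s -> is_herm X /\ X *m P = P *m X) ->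
  exists2 A, in_core k P A & forall Q, rank_proj k Q ->
    `|rtr (T A *m Q)| = wk k (T A) -> forall X, X \in s -> T X *m Q = Q *m T X.
Proof.
move=> hP; elim: s => [|X s IHs] hs.
  by exists P; first exact: proj_core.
have [|A cA hA] := IHs; first by move=> Y Ys; apply: hs; rewrite inE Ys orbT.
have [hX cX] := hs X (mem_head _ _).
have hermA : is_herm A by case: cA.
have [B cB [cAB [a [b XE]]]] := core_step cA hX cX.
have hB : is_herm B by case: cB.
have [mu [hmu hw]] : parallel_k k (T A) (T B).
  by apply: T_par => //; apply: cone_parallel hP _ _; apply: core_cone.
have mu1 : `|mu| = 1 by case: hmu => ->; rewrite ?normrN1 ?normr1.
exists (A + rscale mu B).
  by case: hmu => ->; [rewrite rscale1; exact: coreD|rewrite rscaleN1; exact: cAB].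
move=> Q hQ.
rewrite T_add; [|exact: hermA|exact: herm_rscale].
rewrite (T_scale mu hB) hw mulmxDl rtrD -scalemxAl rtrZ => hwQ.
have hTA := T_herm hermA; have hTB := T_herm hB.
have [ubA _] := wkP lt_kn hTA; have [ubB _] := wkP lt_kn hTB.
have [nA nB] : `|rtr (T A *m Q)| = wk k (T A) /\ `|rtr (T B *m Q)| = wk k (T B).
  apply: norming_sum (ubA _ hQ) (ubB _ hQ) _; rewrite -hwQ.
  by apply: le_trans (ler_normD _ _) _; rewrite normrM mu1 mul1r.
have cTA := norming_comm lt_kn hTA hQ nA.
have cTB := norming_comm lt_kn hTB hQ nB.
move=> Y; rewrite inE => /orP[/eqP->|]; last exact: hA Q hQ nA Y.
rewrite XE T_add; [|exact: herm_rscale|exact: herm_rscale].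
rewrite (T_scale a hB) (T_scale b hermA) /rscale mulmxDl mulmxDr.
by rewrite -!scalemxAl -!scalemxAr cTA cTB.
Qed.

Lemma commuting_image P (s : seq 'M[C]_n) : rank_proj k P ->
  (forall X, X \in s -> is_herm X /\ X *m P = P *m X) ->
  exists2 Q, rank_proj k Q & forall X, X \in s -> T X *m Q = Q *m T X.
Proof.
move=> hP /(commuting_family hP)[A [hA _] h].
have [_ [Q hQ hw]] := wkP lt_kn (T_herm hA).
by exists Q => //; apply: h.
Qed.

Hypothesis T_surj : forall B, is_herm B -> exists2 A, is_herm A & T A = B.

(** Every [Q] norms the identity, so [T 1%:M] is parallel to each [P], which is a value of [T] by
    surjectivity. Only [P] norms [P]; hence [T 1%:M] commutes with all rank-[k] projections. *)
Lemma T_one : exists c : R, T 1%:M = rscale c 1%:M.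
Proof.
have hT1 := T_herm (@herm1 R n).
have [a ha] : exists a, T 1%:M = a%:M.
  apply: (commute_all_scalar k_gt0 lt_kn) => P hP.
  have [A hA TA] := T_surj (proj1 hP).
  have [|Q hQ [h1 h2]] := (parallel_norming lt_kn hT1 (proj1 hP)).1.
    rewrite -TA; apply: T_par => //; first exact: herm1.
    have [_ [Q hQ hw]] := wkP lt_kn hA.
    apply/parallel_norming => //; first exact: herm1.
    by exists Q; [exact: hQ|rewrite (wk_one _ lt_kn) (rtr1_proj hQ) normr_nat].
  rewrite (wk_proj lt_kn hP hQ h2); exact: norming_comm lt_kn hT1 hQ h1.
exists (complex.Re a); rewrite ha /rscale scalemx1; congr scalar_mx.
have i0 : 'I_n by exists 0%N; apply: leq_ltn_trans lt_kn.
rewrite RRe_real //; apply/CrealP.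
move: hT1 => /matrixP/(_ i0 i0).
by rewrite adjmxE ha !mxE eqxx mulr1n.
Qed.

End Parallel.

Definition reh X : 'M[C]_n := 2^-1 *: (X + adjmx X).
Definition imh X : 'M[C]_n := (2 * 'i%C)^-1 *: (X - adjmx X).

Lemma conj_i : Num.conj ('i%C : C) = - 'i%C.
Proof. by rewrite complexiE conjCi. Qed.

Lemma i_neq0 : ('i%C : C) != 0.
Proof. by rewrite complexiE neq0Ci. Qed.

Lemma reh_herm X : is_herm (reh X).
Proof.
by rewrite /is_herm adjmxZ adjmxD adjmxK addrC fmorphV rmorph_nat.
Qed.

Lemma imh_herm X : is_herm (imh X).
Proof.
rewrite /is_herm adjmxZ adjmxB adjmxK fmorphV rmorphM /= rmorph_nat conj_i mulrN.
by rewrite invrN scaleNr -scalerN opprB.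
Qed.

Lemma cartesianE X : X = reh X + 'i%C *: imh X.
Proof.
have h2 : (2 : C) != 0 by rewrite pnatr_eq0.
rewrite scalerA invfM mulrCA divff ?i_neq0 // mulr1 -scalerDr addrACA subrr addr0.
by rewrite -mulr2n -(scaler_nat 2 X) scalerA mulVf // scale1r.
Qed.

Lemma cartesian_inj A B A' B' : is_herm A -> is_herm B -> is_herm A' -> is_herm B' ->
  A + 'i%C *: B = A' + 'i%C *: B' -> A = A' /\ B = B'.
Proof.
move=> hA hB hA' hB' h.
have h2 : (2 : C) != 0 by rewrite pnatr_eq0.
have h' := congr1 (@adjmx R n) h.
rewrite !adjmxD !adjmxZ hA hB hA' hB' conj_i !scaleNr in h'.
have e1 : A *+ 2 = A' *+ 2.
  have : (A + 'i%C *: B) + (A - 'i%C *: B) = (A' + 'i%C *: B') + (A' - 'i%C *: B').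
    by rewrite h h'.
  by rewrite addrACA subrr addr0 [in RHS]addrACA subrr addr0 -!mulr2n.
have eA : A = A'.
  by apply: (scalerI h2); rewrite !scaler_nat.
split=> //; move: h; rewrite eA => /addrI; exact: (scalerI i_neq0).
Qed.

(** Hermitian matrices form only a real space and are not closed under products. The complex-linear
    extension allows commutants to be compared as complex subspaces and algebras to be
    multiplied. *)
Definition complexify X := T (reh X) + 'i%C *: T (imh X).
Local Notation L := complexify.

Lemma complexifyE A B : is_herm A -> is_herm B ->
  L (A + 'i%C *: B) = T A + 'i%C *: T B.
Proof.
move=> hA hB; rewrite /L; set X := A + _.
have [<- <-] := cartesian_inj hA hB (reh_herm X) (imh_herm X) (cartesianE X).
by [].
Qed.

Lemma complexify_herm A : is_herm A -> L A = T A.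
Proof.
move=> hA; have := complexifyE hA (@adjmx0 R n).
by rewrite T_zero !scaler0 !addr0.
Qed.

Lemma complexifyD X Y : L (X + Y) = L X + L Y.
Proof.
rewrite {1}(cartesianE X) {1}(cartesianE Y) addrACA -(scalerDr 'i%C).
rewrite (complexifyE (hermD (reh_herm X) (reh_herm Y)) (hermD (imh_herm X) (imh_herm Y))).
rewrite /L; move: (reh X) (imh X) (reh Y) (imh Y) (reh_herm X) (imh_herm X) (reh_herm Y)
  (imh_herm Y) => A B A' B' hA hB hA' hB'.
rewrite (T_add hA hA') (T_add hB hB').
by rewrite scalerDr addrACA.
Qed.

Lemma complexifyZ z X : L (z *: X) = z *: L X.
Proof.
have hr := reh_herm X; have hi := imh_herm X.
have key (A B : 'M[C]_n) : z *: (A + 'i%C *: B) =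
   (rscale (complex.Re z) A + rscale (- complex.Im z) B) +
   'i%C *: (rscale (complex.Re z) B + rscale (complex.Im z) A).
  apply/matrixP=> i j; rewrite !mxE {1}(complexE z) rmorphN.
  by apply: cartesian_mul; rewrite -expr2 sqr_i.
have hs a A : is_herm A -> is_herm (rscale a A) by exact: herm_rscale.
rewrite {1}(cartesianE X) key.
rewrite (complexifyE (hermD (hs _ _ hr) (hs _ _ hi)) (hermD (hs _ _ hi) (hs _ _ hr))).
rewrite /L; move: (reh X) (imh X) hr hi key => A B hr hi key.
rewrite (T_add (hs _ _ hr) (hs _ _ hi)) (T_add (hs _ _ hi) (hs _ _ hr)).
by rewrite !(T_scale _ hr) !(T_scale _ hi) -key.
Qed.

Lemma complexify_adj X : L (adjmx X) = adjmx (L X).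
Proof.
have hr := reh_herm X; have hi := imh_herm X.
have -> : adjmx X = reh X + 'i%C *: (rscale (-1) (imh X)).
  by rewrite {1}(cartesianE X) adjmxD adjmxZ hr hi conj_i rscaleN1 scalerN scaleNr.
rewrite (complexifyE hr (herm_rscale _ hi)) /L.
move: (reh X) (imh X) hr hi => A B hr hi; rewrite (T_scale _ hi) rscaleN1 adjmxD adjmxZ (T_herm hr) (T_herm hi) conj_i.
by rewrite scalerN scaleNr.
Qed.

Lemma complexify_inj : (forall A B, is_herm A -> is_herm B -> T A = T B -> A = B) ->
  injective L.
Proof.
move=> inj X Y h.
have [h1 h2] := cartesian_inj (T_herm (reh_herm X)) (T_herm (imh_herm X))
  (T_herm (reh_herm Y)) (T_herm (imh_herm Y)) h.
rewrite (cartesianE X) (cartesianE Y).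
by rewrite (inj _ _ (reh_herm X) (reh_herm Y) h1) (inj _ _ (imh_herm X) (imh_herm Y) h2).
Qed.

End Preserver.

(** * Similar idempotents and the image of a commutant *)

Lemma lin_stable_inj (K : fieldType) (V : vectType K) (f : 'End(V)) (U : {vspace V}) :
  injective f -> (f @: U <= U)%VS -> forall x, f x \in U -> x \in U.
Proof.
move=> finj fU x; have ker0 : lker f = 0%VS by apply/eqP/lker0P.
have : (f @: U)%VS == U by rewrite eqEdim fU /= limg_dim_eq ?ker0 ?capv0 //.
by move=> /eqP{1}<- /memv_imgP[y yU /finj->].
Qed.

Section Image.
Variable R : realType.
Local Notation C := R[i].
Variables (n k : nat).
Implicit Types (A B P Q X Y Z : 'M[C]_n).

Lemma idem_base P : P *m P = P -> row_base P *m col_base P = 1%:M.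
Proof.
move=> PP; apply: (row_free_inj (row_base_free P)); lazy beta; rewrite mul1mx.
apply: (row_full_inj (col_base_full P)).
lazy beta; rewrite (mulmxA _ (row_base P *m _)) (mulmxA _ (row_base P) (col_base P)) mulmx_base.
by rewrite -mulmxA mulmx_base PP.
Qed.

Lemma idem_trace P : P *m P = P -> \tr P = (\rank P)%:R.
Proof.
by move=> /idem_base BA; rewrite -{1}(mulmx_base P) mxtrace_mulC BA mxtrace1.
Qed.

Lemma idem_factor P r : P *m P = P -> \tr P = r%:R ->
  exists (A : 'M[C]_(n, r)) (B : 'M[C]_(r, n)), P = A *m B /\ B *m A = 1%:M.
Proof.
move=> PP trP; have rk : \rank P = r.
  by apply/eqP; rewrite -(eqr_nat C) -idem_trace // trP.
case: r / rk {trP}; exists (col_base P), (row_base P).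
by rewrite mulmx_base idem_base.
Qed.

(** [P] and [1 - P] factor as [A B] and [A' B'] through spaces of dimensions [r] and [n - r], and
    likewise [Q] as [D E] and [1 - Q] as [D' E']. Then [S = D B + D' B'] carries the range and the
    kernel of [P] to those of [Q]. *)
Lemma similar_idem P Q (r : nat) : P *m P = P -> Q *m Q = Q -> \tr P = r%:R -> \tr Q = r%:R ->
  (r <= n)%N -> exists S S', [/\ S *m S' = 1%:M, S' *m S = 1%:M & S *m P = Q *m S].
Proof.
move=> PP QQ trP trQ rn.
have idemC Y : Y *m Y = Y -> (1%:M - Y) *m (1%:M - Y) = 1%:M - Y.
  by move=> h; rewrite mulmxBr mulmx1 mulmxBl mul1mx h subrr subr0.
have trC Y : \tr Y = r%:R -> \tr (1%:M - Y) = (n - r)%:R.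
  by move=> h; rewrite raddfB /= mxtrace1 h natrB.
have [A [B [PE BA]]] := idem_factor PP trP.
have [D [E [QE ED]]] := idem_factor QQ trQ.
have [A' [B' [PE' BA']]] := idem_factor (idemC _ PP) (trC _ trP).
have [D' [E' [QE' ED']]] := idem_factor (idemC _ QQ) (trC _ trQ).
have orth Y Z (a b : nat) (F : 'M[C]_(n, a)) (G : 'M[C]_(a, n)) (H : 'M[C]_(n, b)) (K : 'M[C]_(b, n)) :
    Y = F *m G -> G *m F = 1%:M -> Z = H *m K -> K *m H = 1%:M -> Y *m Z = 0 -> G *m H = 0.
  move=> YE GF ZE KH YZ.
  have -> : G *m H = G *m (Y *m Z) *m H.
    by rewrite YE ZE !mulmxA GF mul1mx -!mulmxA KH mulmx1.
  by rewrite YZ mulmx0 mul0mx.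
have zr Y : Y *m Y = Y -> Y *m (1%:M - Y) = 0.
  by move=> h; rewrite mulmxBr mulmx1 h subrr.
have zl Y : Y *m Y = Y -> (1%:M - Y) *m Y = 0.
  by move=> h; rewrite mulmxBl mul1mx h subrr.
have BA0 : B *m A' = 0 by apply: orth PE BA PE' BA' (zr _ PP).
have AB0 : B' *m A = 0 by apply: orth PE' BA' PE BA (zl _ PP).
have ED0 : E *m D' = 0 by apply: orth QE ED QE' ED' (zr _ QQ).
have DE0 : E' *m D = 0 by apply: orth QE' ED' QE ED (zl _ QQ).
exists (D *m B + D' *m B'), (A *m E + A' *m E'); split.
- rewrite mulmxDl !mulmxDr !mulmxA -!(mulmxA _ B) -!(mulmxA _ B') BA BA0 AB0 BA'.
  by rewrite !mulmx1 !mulmx0 !mul0mx addr0 add0r -QE -QE' addrC subrK.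
- rewrite mulmxDl !mulmxDr !mulmxA -!(mulmxA _ E) -!(mulmxA _ E') ED ED0 DE0 ED'.
  by rewrite !mulmx1 !mulmx0 !mul0mx addr0 add0r -PE -PE' addrC subrK.
rewrite PE QE mulmxDl mulmxDr !mulmxA -!(mulmxA _ B A) -!(mulmxA _ B' A).
rewrite -!(mulmxA _ E D) -!(mulmxA _ E D') BA AB0 ED ED0.
by rewrite !mulmx1 !mulmx0 !mul0mx.
Qed.

Lemma commute_iff (f : {linear 'M[C]_n -> 'M[C]_n}) P Q :
  injective f -> rank_proj k P -> rank_proj k Q -> (k <= n)%N ->
  (* The similarity between [P] and [Q] turns [f] into an injective endomorphism that sends the
     commutant of [P] into itself. By finite dimension the image is the whole commutant, which
     yields the converse implication. *)
  (forall X, X *m P = P *m X -> f X *m Q = Q *m f X) ->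
  forall X, f X *m Q = Q *m f X <-> X *m P = P *m X.
Proof.
move=> finj [_ [PP trP]] [_ [QQ trQ]] kn hf X; split; last exact: hf.
have [S [S' [SS' S'S SP]]] := similar_idem PP QQ trP trQ kn.
pose g Y := S' *m f Y *m S.
have g_lin : linear g.
  by move=> a Y Z; rewrite /g linearP mulmxDr mulmxDl -scalemxAr -scalemxAl.
pose gl : {linear 'M[C]_n -> 'M[C]_n} := HB.pack g (GRing.isLinear.Build _ _ _ _ g g_lin).
pose h Y := Y *m P - P *m Y.
have h_lin : linear h.
  move=> a Y Z; rewrite /h mulmxDl mulmxDr -scalemxAr -scalemxAl scalerBr opprD.
  by rewrite addrACA.
pose hl : {linear 'M[C]_n -> 'M[C]_n} := HB.pack h (GRing.isLinear.Build _ _ _ _ h h_lin).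
have memh Y : (Y \in lker (linfun hl)) = (Y *m P == P *m Y).
  by rewrite memv_ker lfunE /= subr_eq0.
have comm_g Y : (g Y *m P = P *m g Y) <-> (f Y *m Q = Q *m f Y).
  have S'Q : S' *m Q = P *m S'.
    by rewrite -[LHS]mulmx1 -SS' !mulmxA -(mulmxA S' Q) -SP !mulmxA S'S mul1mx.
  rewrite /g; split=> e.
    have := congr1 (fun M => S *m M *m S') e.
    rewrite /= !mulmxA SS' mul1mx -(mulmxA _ S P) SP !mulmxA.
    by rewrite -!(mulmxA _ S S') SS' !mulmx1.
  by rewrite -mulmxA SP !mulmxA -S'Q -(mulmxA S' Q) -e !mulmxA.
move=> hX; apply/eqP; rewrite -memh.
apply: (@lin_stable_inj _ _ (linfun gl)).
- move=> Y Z; rewrite !lfunE /= => e; apply: finj.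
  have := congr1 (fun M => S *m M *m S') e.
  by rewrite /g /= !mulmxA SS' !mul1mx -!mulmxA SS' !mulmx1.
- apply/subvP => y /memv_imgP[Y + ->]; rewrite memh => /eqP cY.
  by rewrite memh lfunE /=; apply/eqP/comm_g/hf.
by rewrite memh lfunE /=; apply/eqP/comm_g.
Qed.

End Image.

Section CommutantImage.
Variable R : realType.
Local Notation C := R[i].
Variables (n k : nat).
Hypotheses (k_gt0 : (0 < k)%N) (lt_kn : (k < n)%N).
Implicit Types (A B P Q X Y Z : 'M[C]_n).
Variable T : 'M[C]_n -> 'M[C]_n.
Hypothesis T_lin : herm_real_linear T.
Hypothesis T_inj : forall A B, is_herm A -> is_herm B -> T A = T B -> A = B.
Hypothesis T_par : forall A B, is_herm A -> is_herm B ->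
  parallel_k k A B -> parallel_k k (T A) (T B).

Let L_lin : linear (complexify T).
Proof. by move=> a X Y; rewrite complexifyD // complexifyZ. Qed.
Definition complexify_linear : {linear 'M[C]_n -> 'M[C]_n} :=
  HB.pack (complexify T) (GRing.isLinear.Build _ _ _ _ (complexify T) L_lin).
Local Notation L := complexify_linear.

Lemma comm_adj X P : is_herm P -> X *m P = P *m X -> adjmx X *m P = P *m adjmx X.
Proof.
by move=> hP h; rewrite -[in LHS]hP -[in RHS]hP -!adjmxM h.
Qed.

Lemma commutant_image P : rank_proj k P ->
  exists2 Q, rank_proj k Q & forall X, L X *m Q = Q *m L X <-> X *m P = P *m X.
Proof.
move=> hP; have [p1 [p2 _]] := hP.
(* Compression to the two diagonal corners projects onto the commutant. Applied to matrix units it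
   gives a finite spanning family, whose Hermitian and imaginary parts form the list for
   [commuting_image]. *)
pose proj Y := P *m Y *m P + (1%:M - P) *m Y *m (1%:M - P).
have zr : P *m (1%:M - P) = 0 by rewrite mulmxBr mulmx1 p2 subrr.
have zl : (1%:M - P) *m P = 0 by rewrite mulmxBl mul1mx p2 subrr.
have projC Y : proj Y *m P = P *m proj Y.
  rewrite /proj; move: zr zl; set Pc := 1%:M - P => zr zl.
  rewrite mulmxDl mulmxDr -!mulmxA p2 zl !mulmx0 addr0.
  by rewrite !mulmxA zr !mul0mx addr0 p2.
have rehC Y : Y *m P = P *m Y -> reh Y *m P = P *m reh Y.
  move=> h; rewrite /reh -scalemxAl -scalemxAr mulmxDl mulmxDr h.
  by rewrite (comm_adj p1 h).
have imhC Y : Y *m P = P *m Y -> imh Y *m P = P *m imh Y.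
  move=> h; rewrite /imh -scalemxAl -scalemxAr mulmxBl mulmxBr h.
  by rewrite (comm_adj p1 h).
pose e (ij : 'I_n * 'I_n) : 'M[C]_n := proj (delta_mx ij.1 ij.2).
pose s := [seq reh (e ij) | ij <- enum {: 'I_n * 'I_n}] ++
          [seq imh (e ij) | ij <- enum {: 'I_n * 'I_n}].
have hs Y : Y \in s -> is_herm Y /\ Y *m P = P *m Y.
  rewrite mem_cat => /orP[]/mapP[ij _ ->].
    by split; [exact: reh_herm|apply/rehC/projC].
  by split; [exact: imh_herm|apply/imhC/projC].
have [Q hQ hcomm] := commuting_image k_gt0 lt_kn T_lin T_par hP hs.
exists Q => //; apply: (commute_iff _ hP hQ (ltnW lt_kn)).
  exact: complexify_inj T_lin T_inj.
move=> X cX.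
have XE : X = \sum_i \sum_j X i j *: e (i, j).
  have projD Y Z : proj (Y + Z) = proj Y + proj Z.
    by rewrite /proj; move: (1%:M - P) => Pc; rewrite !mulmxDr !mulmxDl addrACA.
  have projZ a Y : proj (a *: Y) = a *: proj Y.
    by rewrite /proj; move: (1%:M - P) => Pc; rewrite -!scalemxAr -!scalemxAl -scalerDr.
  have proj0 : proj 0 = 0 by rewrite /proj !mulmx0 !mul0mx addr0.
  have XP : X = proj X.
    rewrite /proj -cX -mulmxA p2 mulmxBl mul1mx -cX mulmxBr mulmx1 !mulmxBl.
    by rewrite -!mulmxA p2 subrr subr0 addrC subrK.
  rewrite [LHS]XP {1}(matrix_sum_delta X) (big_morph _ projD proj0).
  apply: eq_bigr => i _; rewrite (big_morph _ projD proj0).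
  apply: eq_bigr => j _; exact: projZ.
have -> : L X = \sum_i \sum_j X i j *: L (e (i, j)).
  rewrite {1}XE linear_sum; apply: eq_bigr => i _.
  by rewrite linear_sum; apply: eq_bigr => j _; rewrite linearZ.
rewrite mulmx_suml mulmx_sumr; apply: eq_bigr => i _.
rewrite mulmx_suml mulmx_sumr; apply: eq_bigr => j _.
rewrite -scalemxAl -scalemxAr; congr (_ *: _).
have c1 : T (reh (e (i, j))) *m Q = Q *m T (reh (e (i, j))).
  apply: hcomm; rewrite mem_cat; apply/orP; left; apply/mapP.
  by exists (i, j); [exact: mem_enum|].
have c2 : T (imh (e (i, j))) *m Q = Q *m T (imh (e (i, j))).
  apply: hcomm; rewrite mem_cat; apply/orP; right; apply/mapP.
  by exists (i, j); [exact: mem_enum|].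
rewrite /= /complexify mulmxDl mulmxDr c1 -scalemxAl -scalemxAr c2.
by [].
Qed.

End CommutantImage.

(** * Pairs of projections subject to product relations *)

Section Projections.
Variable R : realType.
Local Notation C := R[i].
Variable n : nat.
Implicit Types (A B F G M E X Y : 'M[C]_n).

Definition projection F := is_herm F /\ F *m F = F.

Lemma projectionC F : projection F -> projection (1%:M - F).
Proof.
move=> [h1 h2]; split; first by rewrite /is_herm adjmxB adjmx1 h1.
by rewrite mulmxBr mulmx1 mulmxBl mul1mx h2 subrr subr0.
Qed.

(* Self-adjointness forces the coefficients below to be real. *)
Lemma projection_comm F G (al be ga : C) : projection F -> projection G ->
  F != 0 -> F != 1%:M ->
  F *m G = al *: 1%:M + be *: F + ga *: G -> F *m G = G *m F.
Proof.
move=> [hF FF] [hG GG] F0 F1 FG.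
have real_coef (x y : C) E : E != 0 -> x *: E = y *: E -> x = y.
  by move=> E0 /eqP; rewrite -subr_eq0 -scalerBl scaler_eq0 (negbTE E0) orbF subr_eq0 => /eqP.
have key E (x : C) : E != 0 -> is_herm E -> E *m E = E -> E *m G = x *: E -> E *m G = G *m E.
  move=> E0 hE EE EG.
  have GE : G *m E = Num.conj x *: E by rewrite -[LHS]adjmxK adjmxM hE hG EG adjmxZ hE.
  rewrite EG GE; congr (_ *: _); apply: (real_coef _ _ E E0).
  by rewrite -{1}EE scalemxAl -EG -mulmxA GE -scalemxAr EE.
have [hFc FFc] := projectionC (conj hF FF).
have FcF : (1%:M - F) *m F = 0 by rewrite mulmxBl mul1mx FF subrr.
have Fc0 : 1%:M - F != 0 by rewrite subr_eq0 eq_sym.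
(* Multiplying the relation by [1 - F] removes [F *m G]. If [ga = 0] this forces [al = 0] and
   [F *m G] is a multiple of [F]; otherwise [(1 - F) *m G] is a multiple of [1 - F]. Either way
   [key] applies. *)
have [ga0|ga0] := eqVneq ga 0.
  have al0 : al = 0.
    have /eqP := congr1 (mulmx (1%:M - F)) FG.
    rewrite mulmxA FcF mul0mx ga0 scale0r addr0 mulmxDr.
    rewrite -!scalemxAr mulmx1 FcF.
    by rewrite scaler0 addr0 eq_sym scaler_eq0 (negbTE Fc0) orbF => /eqP.
  by apply: (key F be) => //; rewrite FG al0 ga0 !scale0r add0r addr0.
have h : (1%:M - F) *m G = G *m (1%:M - F).
  apply: (key _ (- al / ga)) => //.
  have := congr1 (mulmx (1%:M - F)) FG.
  rewrite mulmxA FcF mul0mx.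
  rewrite mulmxDr mulmxDr -!scalemxAr mulmx1 FcF.
  rewrite scaler0 addr0 => /esym/eqP; rewrite addr_eq0 => /eqP h.
  by rewrite mulrC -scalerA scaleNr h opprK scalerA mulVf // scale1r.
move: h; rewrite mulmxBl mulmxBr mul1mx mulmx1.
by move=> /addrI/oppr_inj.
Qed.

Lemma root_cell M E (x al be : C) : M *m E = x *: E ->
  M *m M = al *: 1%:M + be *: M -> E != 0 -> x * x = al + be * x.
Proof.
move=> ME MM E0; have := congr1 (mulmx^~ E) MM.
rewrite /= -mulmxA ME -scalemxAr ME scalerA mulmxDl -!scalemxAl mul1mx ME scalerA.
rewrite -scalerDl => /eqP; rewrite -subr_eq0 -scalerBl scaler_eq0 (negbTE E0) orbF.
by rewrite subr_eq0 => /eqP.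
Qed.

(** The joint cells [F G], [F (1 - G)], [(1 - F) G] and [(1 - F) (1 - G)] belong to the eigenvalues
    [a + a'], [a], [a'] and 0 of [M], and each nonzero cell gives a root of one quadratic. With
    [F = G] and [F + G = 1] excluded, at most two distinct roots leave only [a = a'] and an empty
    first or last cell. *)
Lemma two_valued_pair F G (a a' al be : C) : projection F -> projection G ->
  F *m G = G *m F -> F != 0 -> F != 1%:M -> G != 0 -> G != 1%:M ->
  F != G -> F + G != 1%:M -> a != 0 -> a' != 0 -> a + a' != 0 ->
  (a *: F + a' *: G) *m (a *: F + a' *: G) = al *: 1%:M + be *: (a *: F + a' *: G) ->
  a = a' /\ (F *m G = 0 \/ (1%:M - F) *m (1%:M - G) = 0).
Proof.
move=> [_ FF] [_ GG] FG F0 F1 G0 G1 nFG nFG1 a0 a'0 aa0; set M := _ + _ => MM.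
have c11 : M *m (F *m G) = (a + a') *: (F *m G).
  by rewrite /M mulmxDl -!scalemxAl mulmxA FF FG mulmxA GG scalerDl.
have c10 : M *m (F - F *m G) = a *: (F - F *m G).
  rewrite mulmxBr c11 /M mulmxDl -!scalemxAl FF -FG scalerDl scalerBr opprD.
  by rewrite addrACA subrr addr0.
have c01 : M *m (G - F *m G) = a' *: (G - F *m G).
  rewrite mulmxBr c11 /M mulmxDl -!scalemxAl GG scalerDl scalerBr opprD.
  by rewrite addrACA subrr add0r.
have c00 : M *m ((1%:M - F) *m (1%:M - G)) = 0 *: ((1%:M - F) *m (1%:M - G)).
  have -> : (1%:M - F) *m (1%:M - G) = 1%:M - F - (G - F *m G).
    by rewrite mulmxBr mulmx1 mulmxBl mul1mx.
  have MF : M *m F = a *: F + a' *: (F *m G).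
    by rewrite /M mulmxDl -!scalemxAl FF -FG.
  rewrite scale0r mulmxBr c01 mulmxBr mulmx1 MF /M.
  by apply/matrixP=> i j; rewrite !mxE; ring.
have r11 := root_cell c11 MM; have r10 := root_cell c10 MM.
have r01 := root_cell c01 MM; have r00 := root_cell c00 MM.
have e11F : F *m G = 0 -> F - F *m G != 0 /\ G - F *m G != 0 by move=> ->; rewrite !subr0.
have [e11|e11] := eqVneq (F *m G) 0.
  have [e10 e01] := e11F e11; split; last by left.
  have e00 : (1%:M - F) *m (1%:M - G) != 0.
    rewrite mulmxBr mulmx1 mulmxBl mul1mx e11 subr0 -addrA -opprD subr_eq0 eq_sym.
    exact: nFG1.
  have := r00 e00; rewrite !mulr0 addr0 => /esym al0.
  have ea : a = be by apply: (mulIf a0); rewrite r10 // al0 add0r.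
  by apply: (mulIf a'0); rewrite r01 // al0 add0r ea.
have [e00|e00] := eqVneq ((1%:M - F) *m (1%:M - G)) 0.
  have h : F + G = 1%:M + F *m G.
    apply/eqP; rewrite -subr_eq0 -oppr_eq0 -e00 mulmxBr mulmx1 mulmxBl mul1mx.
    by apply/eqP/matrixP=> i j; rewrite !mxE; ring.
  have e10 : F - F *m G != 0.
    rewrite (_ : F - F *m G = 1%:M - G) ?subr_eq0 1?eq_sym //.
    by apply/eqP; rewrite subr_eq addrAC -h addrK.
  have e01 : G - F *m G != 0.
    rewrite (_ : G - F *m G = 1%:M - F) ?subr_eq0 1?eq_sym //.
    by apply/eqP; rewrite subr_eq addrAC -h addrAC subrr add0r.
  split; last by right.
  have s11 := r11 e11; have s10 := r10 e10; have s01 := r01 e01.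
  have b1 : be = 2 * a + a'.
    apply: (mulIf a'0); have := congr2 (fun x y => x - y) s11 s10; rewrite /= => h'.
    have -> : be * a' = al + be * (a + a') - (al + be * a) by ring.
    by rewrite -h'; ring.
  have b2 : be = a + 2 * a'.
    apply: (mulIf a0); have := congr2 (fun x y => x - y) s11 s01; rewrite /= => h'.
    have -> : be * a = al + be * (a + a') - (al + be * a') by ring.
    by rewrite -h'; ring.
  have : a - a' = (2 * a + a') - (a + 2 * a') by ring.
  by rewrite -b1 -b2 subrr => /eqP; rewrite subr_eq0 => /eqP.
have := r00 e00; rewrite !mulr0 addr0 => /esym al0.
have eb : a + a' = be by apply: (mulIf aa0); rewrite r11 // al0 add0r.
have z10 : F - F *m G = 0.
  apply/eqP; apply: contraTT isT => /r10; rewrite al0 add0r -eb mulrDl => /eqP.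
  by rewrite -subr_eq0 opprD addrA subrr add0r oppr_eq0 mulf_eq0 (negbTE a0) (negbTE a'0).
have z01 : G - F *m G = 0.
  apply/eqP; apply: contraTT isT => /r01; rewrite al0 add0r -eb mulrDl addrC => /eqP.
  by rewrite -subr_eq0 opprD addrA subrr add0r oppr_eq0 mulf_eq0 (negbTE a0) (negbTE a'0).
by case/eqP: nFG; rewrite -(subr0 F) -z10 -[in RHS](subr0 G) -z01 !subKr.
Qed.

End Projections.

(** * Unital maps preserving commutants of rank-k projections *)

Section CommutantPreserver.
Variable R : realType.
Local Notation C := R[i].
Variables (n k : nat).
Implicit Types (A B F G M P Q X Y Z : 'M[C]_n).

(** A nonscalar Hermitian matrix satisfying a quadratic has exactly two eigenvalues; [F] is the
    spectral projection of the larger one. This choice makes [a] positive, so that sums of such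
    coefficients do not vanish when [two_valued_pair] is applied. *)
Lemma quad_projection B (al be : C) : is_herm B -> (forall x, B != x%:M) ->
  B *m B = al *: 1%:M + be *: B ->
  exists (a b : R) F, [/\ 0 < a, projection F & B = rscale a F + rscale b 1%:M].
Proof.
move=> /herm_spectral[V [d [hV BE]]] nsc BB.
have root l : ((d l)%:C * (d l)%:C = al + be * (d l)%:C)%C.
  have : rdiag d *m rdiag d = al *: 1%:M + be *: rdiag d.
    have dE : rdiag d = uconj (adjmx V) B by rewrite BE uconjK.
    have hV' := unitary_adj hV.
    by rewrite dE -uconjM // BB uconjD !uconjZ uconj1.
  move=> /matrixP/(_ l l); rewrite rdiagM !rdiagE !mxE eqxx !mulr1n mulr1 rmorphM.
  by [].
have [i [j dij]] : exists i j, d j < d i.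
  apply: contrapT => h; have dE i j : d i = d j.
    by apply/eqP; rewrite eq_le !leNgt; apply/andP; split; apply/negP => ?; apply: h; [exists i, j|exists j, i].
  have [x Bx] : exists x : C, rdiag d = x%:M.
    have [[i _]|no] := pselect (exists i : 'I_n, True).
      by exists ((d i)%:C)%C; apply/matrixP=> a b; rewrite rdiagE !mxE (dE a i).
    by exists 0; apply/matrixP=> a b; case: no; exists a.
  by have /eqP := nsc x; apply; rewrite BE Bx -scalemx1 uconjZ uconj1.
pose a := d i - d j; pose b := d j.
exists a, b, (uconj V (rdiag (fun l => (d l == d i)%:R))); split.
- by rewrite subr_gt0.
- split; first by apply/uconj_herm/rdiag_herm.
  rewrite -(uconjM _ _ hV) rdiagM.
  have -> // : (fun l => (d l == d i)%:R * (d l == d i)%:R) = (fun l => (d l == d i)%:R) :> (_ -> R).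
  by apply/funext => l; case: eqP; rewrite ?mulr1 ?mulr0.
rewrite BE -(uconj1 hV) /rscale -!uconjZ -uconjD; congr uconj.
apply/matrixP=> p q; rewrite !mxE; have [->|pq] := eqVneq p q; last by rewrite !mulr0n !mulr0 addr0.
rewrite !mulr1n mulr1 -rmorphM -rmorphD; congr real_complex_def.
have [->|dq] := eqVneq (d q) (d i); first by rewrite mulr1 /a /b subrK.
rewrite mulr0 add0r /b; apply: (@complexI R).
have sub0 (x y : R) : x != y -> ((x%:C)%C : C) - (y%:C)%C != 0.
  by move=> xy; rewrite subr_eq0 (inj_eq (@complexI R)).
have e1 : (d i)%:C%C + (d j)%:C%C = be.
  apply: (mulIf (sub0 _ _ (negbT (gt_eqF dij)))).
  have -> : be * ((d i)%:C - (d j)%:C)%C = ((al + be * (d i)%:C) - (al + be * (d j)%:C))%C by ring.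
  by rewrite -!root; ring.
have e2 : (d i)%:C%C + (d q)%:C%C = be.
  apply: (mulIf (sub0 _ _ dq)).
  have -> : be * ((d q)%:C - (d i)%:C)%C = ((al + be * (d q)%:C) - (al + be * (d i)%:C))%C by ring.
  by rewrite -!root; ring.
by apply: (addrI (d i)%:C%C); rewrite e1 e2.
Qed.

(** By [commutant_diag] and [diag_commutant], these are the matrices commuting with every rank-[k]
    projection subordinate to [c]. *)
Definition blockdiag (c : 'I_n -> nat) X :=
  (forall i j, i != j -> X i j = 0) /\ (forall i j, c i = c j -> X i i = X j j).

(** What is kept of a unital parallelism preserver after complexification. Stability under unitary
    conjugation of the argument ([cp_uconj]) transfers facts about diagonal units to every
    orthonormal frame. *)
Record commutant_preserver (L : 'M[C]_n -> 'M[C]_n) : Prop := CommutantPreserver {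
  cp_lin : linear L;
  cp_inj : injective L;
  cp_surj : forall Y, exists X, L X = Y;
  cp_adj : forall X, L (adjmx X) = adjmx (L X);
  cp_one : L 1%:M = 1%:M;
  cp_comm : forall P, rank_proj k P -> exists2 Q, rank_proj k Q &
     forall X, L X *m Q = Q *m L X <-> X *m P = P *m X }.

Lemma cp_uconj L V : unitary V -> commutant_preserver L ->
  commutant_preserver (fun X => L (uconj V X)).
Proof.
move=> hV [lin inj surj adj one comm]; split.
- by move=> a X Y; rewrite uconjD uconjZ lin.
- move=> X Y /inj h; have := congr1 (uconj (adjmx V)) h.
  by rewrite !uconjK.
- move=> Y; have [X <-] := surj Y; exists (uconj (adjmx V) X).
  by rewrite uconjKV.
- by move=> X; rewrite -uconj_adj adj.
- by rewrite uconj1.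
move=> P /(uconj_proj hV) /comm[Q hQ h]; exists Q => // X; rewrite h.
rewrite -!(uconjM _ _ hV); split=> [/(congr1 (uconj (adjmx V)))|->//].
by rewrite !uconjK.
Qed.

Variable L : 'M[C]_n -> 'M[C]_n.
Hypothesis L_cp : commutant_preserver L.
Hypotheses (k_gt0 : (0 < k)%N) (lt_kn : (k < n)%N).

Lemma cp0 : L 0 = 0.
Proof.
have := cp_lin L_cp (-1) 0 0; rewrite scaler0 addr0 => ->.
by rewrite scaleN1r addNr.
Qed.
Lemma cpD X Y : L (X + Y) = L X + L Y.
Proof. by have := cp_lin L_cp 1 X Y; rewrite !scale1r. Qed.
Lemma cpZ a X : L (a *: X) = a *: L X.
Proof. by have := cp_lin L_cp a X 0; rewrite cp0 !addr0. Qed.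
Lemma cp_sum (I : Type) (r : seq I) (p : pred I) (F : I -> 'M[C]_n) :
  L (\sum_(i <- r | p i) F i) = \sum_(i <- r | p i) L (F i).
Proof. by apply: (big_morph _ cpD cp0). Qed.
Lemma cp_herm X : is_herm X -> is_herm (L X).
Proof. by move=> h; rewrite /is_herm -(cp_adj L_cp) h. Qed.

(** Both images commute with every relevant [Q], hence so does their product. Surjectivity writes
    the product as [L Z], and the equivalence in [cp_comm] brings the commutation back to [Z]. *)
Lemma cp_block_mul c X Y : blockdiag c X -> blockdiag c Y ->
  exists2 Z, blockdiag c Z & L X *m L Y = L Z.
Proof.
move=> [oX cX] [oY cY]; have [Z LZ] := cp_surj L_cp (L X *m L Y).
exists Z => //; apply: (commutant_diag k_gt0 lt_kn) => P hP sP.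
have [Q hQ h] := cp_comm L_cp hP; apply/h; rewrite LZ.
have hX : L X *m Q = Q *m L X by apply/h/(diag_commutant oX cX).
have hY : L Y *m Q = Q *m L Y by apply/h/(diag_commutant oY cY).
by rewrite -mulmxA hY mulmxA hX mulmxA.
Qed.

Local Notation D i := (delta_mx i i : 'M[C]_n).

Lemma delta_herm i : is_herm (D i).
Proof. by apply/matrixP=> a b; rewrite !mxE rmorph_nat andbC. Qed.

Lemma cp_sum_delta : \sum_i L (D i) = 1%:M.
Proof.
rewrite -cp_sum -(cp_one L_cp); congr L; apply/matrixP=> a b; rewrite summxE !mxE.
rewrite (bigD1 a) //= big1 ?addr0; first by rewrite mxE eqxx eq_sym.
by move=> i ia; rewrite mxE eq_sym (negbTE ia).
Qed.

Lemma cp_two_block (c : pred 'I_n) X i l :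
  (forall a b, X a b = ((a == b) && c a)%:R) -> c i -> ~~ c l ->
  exists al be : C, L X *m L X = al *: 1%:M + be *: L X.
Proof.
move=> XE ci cl; have bX : blockdiag c X.
  split=> [a b ab|a b]; rewrite !XE ?(negbTE ab) // !eqxx /=.
  by case: (c a); case: (c b).
have [Z [oZ cZ] ->] := cp_block_mul bX bX.
exists (Z l l), (Z i i - Z l l).
rewrite -[X in _ *: X](cp_one L_cp) -!cpZ -cpD; congr L; apply/matrixP=> a b.
rewrite !mxE XE; have [<-|ab] := eqVneq a b; last by rewrite oZ // !mulr0 addr0.
case: (boolP (c a)) => ca /=.
  by rewrite !mulr1 addrC subrK; apply: cZ; rewrite ca ci.
by rewrite mulr1 mulr0 addr0; apply: cZ; rewrite (negbTE ca) (negbTE cl).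
Qed.

Lemma third_index (i j : 'I_n) : (2 < n)%N -> exists2 l, l != i & l != j.
Proof.
move=> n2; have : (0 < #|~: [set i; j]|)%N.
  rewrite cardsCs finset.setCK card_ord subn_gt0 cards2.
  by apply: leq_ltn_trans n2; case: (i != j).
by move=> /card_gt0P[l]; rewrite !inE negb_or => /andP[]; exists l.
Qed.

Lemma cp_delta_sq i : (2 < n)%N -> exists al be : C,
  L (D i) *m L (D i) = al *: 1%:M + be *: L (D i).
Proof.
move=> n2; have [l li _] := third_index i i n2.
apply: (@cp_two_block (pred1 i) _ i l) => //=.
move=> a b; rewrite mxE; congr (nat_of_bool _)%:R.
by case: eqP => [->|_]; [rewrite eq_sym andbT|rewrite andbF].
Qed.

Lemma cp_delta_pair_sq i j : i != j -> (2 < n)%N -> exists al be : C,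
  (L (D i) + L (D j)) *m (L (D i) + L (D j)) = al *: 1%:M + be *: (L (D i) + L (D j)).
Proof.
move=> ij n2; have [l li lj] := third_index i j n2.
rewrite -cpD; apply: (@cp_two_block (pred2 i j) _ i l) => /=.
- move=> a b; rewrite !mxE.
  have [->|ai] := eqVneq a i.
    by rewrite (negbTE ij) /= addr0 andbT eq_sym.
  have [->|aj] := eqVneq a j; last by rewrite andbF addr0.
  by rewrite /= add0r andbT eq_sym.
- by rewrite eqxx.
- by rewrite negb_or li lj.
Qed.

(** Here the blocks are [{i}], [{j}] and the rest, labelled 0, 1, 2; as [n > 2], the third is
    nonempty and the scalar coefficient is read off at its index [l]. *)
Lemma cp_delta_mul i j : i != j -> (2 < n)%N -> exists al be ga : C,
  L (D i) *m L (D j) = al *: 1%:M + be *: L (D i) + ga *: L (D j).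
Proof.
move=> ij n2; have [l li lj] := third_index i j n2.
pose c (a : 'I_n) := if a == i then 0%N else if a == j then 1%N else 2%N.
have bD x : x \in [:: i; j] -> blockdiag c (D x).
  rewrite !inE => /orP[]/eqP-> {x}; split=> [a b ab|a b]; rewrite !mxE.
  - by case: (eqVneq a i) ab => [->|//]; rewrite eq_sym => /negbTE->.
  - by rewrite !andbb /c; do 4 case: eqP => //.
  - by case: (eqVneq a j) ab => [->|//]; rewrite eq_sym => /negbTE->.
  - rewrite !andbb /c; have [->|ai] := eqVneq a i; have [->|bi] := eqVneq b i => //.
    + by case: eqP.
    + by case: eqP.
    + by do 2 case: eqP => //.
have [Z [oZ cZ] ->] := cp_block_mul (bD i (mem_head _ _)) (bD j (mem_last i [:: j])).
exists (Z l l), (Z i i - Z l l), (Z j j - Z l l).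
rewrite -[X in _ *: X](cp_one L_cp) -!cpZ -!cpD; congr L; apply/matrixP=> a b.
rewrite !mxE; have [<-|ab] := eqVneq a b; last first.
  rewrite oZ // mulr0 add0r.
  have h x : (a == x) && (b == x) = false.
    by apply/negP => /andP[/eqP ax /eqP bx]; rewrite ax bx eqxx in ab.
  by rewrite !h !mulr0 addr0.
rewrite !andbb mulr1; have [->|ai] := eqVneq a i.
  by rewrite (negbTE ij) mulr1 mulr0 addr0 addrC subrK.
have [->|aj] := eqVneq a j; first by rewrite mulr1 mulr0 addr0 addrC subrK.
by rewrite !mulr0 !addr0; apply: cZ; rewrite /c (negbTE ai) (negbTE aj) (negbTE li) (negbTE lj).
Qed.

Lemma cp_delta_indep i j (x y z : C) : i != j -> (2 < n)%N ->
  x *: 1%:M + y *: L (D i) + z *: L (D j) = 0 -> [/\ x = 0, y = 0 & z = 0].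
Proof.
move=> ij n2; have [l li lj] := third_index i j n2.
rewrite -(cp_one L_cp) -!cpZ -!cpD -[in RHS]cp0 => /(cp_inj L_cp)/matrixP h.
have := h l l; rewrite !mxE (negbTE li) (negbTE lj) !eqxx /= !mulr0 !addr0 mulr1 => x0.
have := h i i; rewrite !mxE (negbTE ij) !eqxx /= !mulr0 addr0 !mulr1 x0 add0r => y0.
have := h j j; rewrite !mxE eq_sym (negbTE ij) !eqxx /= !mulr0 addr0 !mulr1 x0 add0r => z0.
by [].
Qed.

End CommutantPreserver.

(** * Product relations under scalar shifts *)

Section Shift.
Variables (K : fieldType) (n : nat).
Implicit Types (F G X Y M : 'M[K]_n).

Lemma mul_shift F G (a b a' b' : K) :
  (a *: F + b *: 1%:M) *m (a' *: G + b' *: 1%:M) =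
  (a * a') *: (F *m G) + (a * b') *: F + (b * a') *: G + (b * b') *: 1%:M.
Proof.
rewrite mulmxDl !mulmxDr -!scalemxAl -!scalemxAr mul1mx !mulmx1 !scalerA.
by rewrite -!addrA.
Qed.

Lemma mul_unshift F G X Y (a b a' b' al be ga : K) : a != 0 -> a' != 0 ->
  X = a *: F + b *: 1%:M -> Y = a' *: G + b' *: 1%:M ->
  X *m Y = al *: 1%:M + be *: X + ga *: Y ->
  exists al' be' ga', F *m G = al' *: 1%:M + be' *: F + ga' *: G.
Proof.
move=> a0 a'0 -> ->; rewrite mul_shift => h.
exists ((al + be * b + ga * b' - b * b') / (a * a')), ((be - b') / a'), ((ga - b) / a).
apply/matrixP=> i j; have := congr1 (fun M : 'M_n => M i j) h; rewrite !mxE.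
move: (\sum_j0 _) (F i j) (G i j) ((i == j)%:R) => p f g o e.
apply: (mulfI (mulf_neq0 a0 a'0)); rewrite -[LHS](addrK (a * b' * f + b * a' * g + b * b' * o)).
rewrite !addrA e; by field; rewrite a0 a'0.
Qed.

Lemma sq_unshift M X (s al be : K) : X = M + s *: 1%:M ->
  X *m X = al *: 1%:M + be *: X ->
  M *m M = (al + be * s - s * s) *: 1%:M + (be - 2 * s) *: M.
Proof.
move=> ->; rewrite -{1 2}(scale1r M) mul_shift => h.
apply/matrixP=> i j; have := congr1 (fun M : 'M_n => M i j) h; rewrite !mxE.
move: (\sum_j0 _) (M i j) ((i == j)%:R) => p f o e.
rewrite -[LHS](addrK (2 * s * f + s * s * o)).
have -> : p + (2 * s * f + s * s * o) = 1 * 1 * p + 1 * s * f + s * 1 * f + s * s * o by ring.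
by rewrite e; ring.
Qed.

Lemma comb_unshift U V (x y z a b a' b' : K) :
  x *: 1%:M + y *: (a^-1 *: U - (b / a) *: 1%:M) + z *: (a'^-1 *: V - (b' / a') *: 1%:M) =
  (x - y * (b / a) - z * (b' / a')) *: 1%:M + (y / a) *: U + (z / a') *: V :> 'M_n.
Proof.
apply/matrixP=> p q; rewrite !mxE.
by move: (U p q) (V p q) ((p == q)%:R) => u v o; ring.
Qed.

Lemma shift_scalar X (a s : K) : a != 0 -> a *: X + s *: 1%:M = 1%:M ->
  X = ((1 - s) / a) *: 1%:M.
Proof.
move=> a0 h; apply: (scalerI a0); rewrite scalerA [a * _]mulrC divfK //.
by apply/eqP; rewrite scalerBl scale1r eq_sym subr_eq h.
Qed.

End Shift.

(** * Images of the diagonal matrix units *)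

Section Basis.
Variable R : realType.
Local Notation C := R[i].
Variables (n k : nat).
Variable L : 'M[C]_n -> 'M[C]_n.
Hypothesis L_cp : commutant_preserver k L.
Hypotheses (k_gt0 : (0 < k)%N) (lt_kn : (k < n)%N) (n_gt2 : (2 < n)%N).

Local Notation D i := (delta_mx i i : 'M[C]_n).
Local Notation rC x := ((x%:C)%C : C).

Lemma cp_delta_projection : exists (a b : 'I_n -> R) (F : 'I_n -> 'M[C]_n),
  forall i, [/\ 0 < a i, projection (F i) & L (D i) = rC (a i) *: F i + rC (b i) *: 1%:M].
Proof.
suff /choice[f hf] : forall i, exists t : R * R * 'M[C]_n,
    [/\ 0 < t.1.1, projection t.2 & L (D i) = rC t.1.1 *: t.2 + rC t.1.2 *: 1%:M].
  by exists (fun i => (f i).1.1), (fun i => (f i).1.2), (fun i => (f i).2).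
move=> i; have [j ji _] := third_index i i n_gt2.
have [al [be sq]] := cp_delta_sq L_cp k_gt0 lt_kn i n_gt2.
have [|x|a [b [F [a0 hF LE]]]] := quad_projection _ _ sq.
- exact: cp_herm L_cp _ (delta_herm _ _).
- rewrite eq_sym in ji.
  apply/eqP => Lx; have [|_ /eqP] := @cp_delta_indep _ _ _ L L_cp i j x (-1) 0 ji n_gt2.
  + by rewrite Lx scale0r addr0 scaleN1r scalemx1 subrr.
  + by rewrite oppr_eq0 oner_eq0.
by exists (a, b, F).
Qed.

Section Choice.
Variables (a b : 'I_n -> R) (F : 'I_n -> 'M[C]_n).
Hypothesis hF : forall i, [/\ 0 < a i, projection (F i) &
  L (D i) = rC (a i) *: F i + rC (b i) *: 1%:M].

Let aC0 i : rC (a i) != 0.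
Proof. by have [a0 _ _] := hF i; rewrite (inj_eq (@complexI R) _ 0) gt_eqF. Qed.

Let FE i : F i = (rC (a i))^-1 *: L (D i) - (rC (b i) / rC (a i)) *: 1%:M.
Proof.
have [_ _ ->] := hF i; rewrite scalerDr !scalerA mulVf // scale1r.
by rewrite [_ * rC (b i)]mulrC addrK.
Qed.

Let indep i j (x y z : C) : i != j ->
  x *: 1%:M + y *: F i + z *: F j = 0 -> y = 0 /\ z = 0.
Proof.
move=> ij; rewrite (FE i) (FE j) => h.
have [|_ y0 z0] := @cp_delta_indep _ _ _ L L_cp i j
   (x - y * (rC (b i) / rC (a i)) - z * (rC (b j) / rC (a j)))
   (y / rC (a i)) (z / rC (a j)) ij n_gt2.
  by rewrite -comb_unshift.
by split; apply/eqP; [move/eqP: y0|move/eqP: z0];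
   rewrite mulf_eq0 invr_eq0 (negbTE (aC0 _)) orbF.
Qed.

Let F_neq i : F i != 0 /\ F i != 1%:M.
Proof.
have [j ji _] := third_index i i n_gt2; rewrite eq_sym in ji.
split; apply/eqP => Fi.
  have [|/eqP] := @indep i j 0 1 0 ji; first by rewrite Fi !scale0r scaler0 !addr0.
  by rewrite oner_eq0.
have [|/eqP] := @indep i j 1 (-1) 0 ji; first by rewrite Fi scale0r scaleN1r scale1r addr0 subrr.
by rewrite oppr_eq0 oner_eq0.
Qed.

(** The product relation forces commutation, and the quadratic satisfied by the image of [D i + D j]
    then feeds [two_valued_pair]. The two alternatives exclude each other, since together they would
    give [F i + F j = 1]. *)
Let F_pair i j : i != j ->
  [/\ F i *m F j = F j *m F i, a i = a j,
      F i *m F j = 0 \/ (1%:M - F i) *m (1%:M - F j) = 0 &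
      ~ (F i *m F j = 0 /\ (1%:M - F i) *m (1%:M - F j) = 0)].
Proof.
move=> ij; have [ai pi Li] := hF i; have [aj pj Lj] := hF j.
have [Fi0 Fi1] := F_neq i; have [Fj0 Fj1] := F_neq j.
have Fij : F i != F j.
  apply/eqP => e; have [|/eqP] := @indep i j 0 1 (-1) ij.
    by rewrite e scale0r add0r scale1r scaleN1r subrr.
  by rewrite oner_eq0.
have Fij1 : F i + F j != 1%:M.
  apply/eqP => e; have [|/eqP] := @indep i j (-1) 1 1 ij.
    by rewrite !scale1r -addrA e scaleN1r addNr.
  by rewrite oner_eq0.
have comm : F i *m F j = F j *m F i.
  have [al [be [ga h]]] := cp_delta_mul L_cp k_gt0 lt_kn ij n_gt2.
  have [al' [be' [ga' h']]] := mul_unshift (aC0 i) (aC0 j) Li Lj h.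
  exact: projection_comm h'.
have [al [be sq]] := cp_delta_pair_sq L_cp k_gt0 lt_kn ij n_gt2.
have sumE : L (D i) + L (D j) =
    (rC (a i) *: F i + rC (a j) *: F j) + (rC (b i) + rC (b j)) *: 1%:M.
  by rewrite Li Lj addrACA scalerDl.
have aij0 : rC (a i) + rC (a j) != 0.
  by rewrite -rmorphD (inj_eq (@complexI R) _ 0) gt_eqF // addr_gt0.
have [/complexI aij alt] := two_valued_pair pi pj comm Fi0 Fi1 Fj0 Fj1 Fij Fij1
  (aC0 i) (aC0 j) aij0 (sq_unshift sumE sq).
split=> // -[d]; rewrite mulmxBr mulmx1 mulmxBl mul1mx d subr0 => /eqP.
by rewrite -addrA -opprD subr_eq0 eq_sym (negbTE Fij1).
Qed.

Let F_sym i j : F i *m F j = 0 -> F j *m F i = 0.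
Proof.
have [->//|/F_pair[-> _ _ _]] := eqVneq i j.
by [].
Qed.

(* If [F_i] were disjoint from [F_j] but jointly covering with [F_l], then
   [F_j <= 1 - F_i <= F_l] would be properly nested, which [F_pair] forbids. *)
Let F_triple i j l : i != j -> i != l -> j != l ->
  F i *m F j = 0 -> F i *m F l = 0.
Proof.
move=> ij il jl dij; have [_ _ [//|cil] _] := F_pair il.
have h : F j *m (1%:M - F l) = 0.
  have : F j *m ((1%:M - F i) *m (1%:M - F l)) = 0 by rewrite cil mulmx0.
  have hji : F j *m (1%:M - F i) = F j by rewrite mulmxBr mulmx1 (F_sym dij) subr0.
  by rewrite mulmxA hji.
have [_ _ [djl|cjl] _] := F_pair jl.
  have [/eqP[]] := F_neq j.
  by move: h; rewrite mulmxBr mulmx1 djl subr0.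
have [_ /eqP[]] := F_neq l; apply/eqP; rewrite eq_sym -subr_eq0; apply/eqP.
by move: cjl; rewrite mulmxBl mul1mx h subr0.
Qed.

Let F_all_disjoint i j : i != j -> F i *m F j = 0 ->
  forall p q, p != q -> F p *m F q = 0.
Proof.
move=> ij dij; have di q : q != i -> F i *m F q = 0.
  move=> qi; have [<-//|jq] := eqVneq j q.
  by apply: F_triple dij; rewrite // eq_sym.
move=> p q pq; have [pi|pi] := eqVneq p i.
  by rewrite pi; apply: di; rewrite -pi eq_sym.
have [qi|qi] := eqVneq q i.
  by apply: F_sym; rewrite qi; apply: di.
by apply: (@F_triple p i q) => //; [rewrite eq_sym|apply/F_sym/di].
Qed.

Lemma cp_choice_disjoint : exists (a' : R) (b' : 'I_n -> R) (G : 'I_n -> 'M[C]_n),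
  [/\ a' != 0, forall i, [/\ projection (G i), G i != 0 &
     L (D i) = rC a' *: G i + rC (b' i) *: 1%:M] &
     forall i j, i != j -> G i *m G j = 0].
Proof.
pose i0 : 'I_n := Ordinal (ltn_trans (ltn0Sn _) n_gt2).
have [j0 j0i0 _] := third_index i0 i0 n_gt2; rewrite eq_sym in j0i0.
have aE i : a i = a i0 by have [->//|/F_pair[]] := eqVneq i i0.
have a0 : a i0 != 0 by have [h _ _] := hF i0; rewrite gt_eqF.
have [dj|nd] := pselect (F i0 *m F j0 = 0).
  exists (a i0), b, F; split; [exact: a0| |].
    move=> i; have [_ pF LE] := hF i; have [F0 _] := F_neq i.
    by split; [exact: pF|exact: F0|rewrite LE aE].
  exact: F_all_disjoint j0i0 dj.
(* No pair is disjoint here, so all pairs are jointly covering and their complements are disjoint.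
   Passing to [1 - F i] reverses the sign of the coefficient and adds [a i0] to the scalar. *)
exists (- a i0), (fun i => b i + a i0), (fun i => 1%:M - F i); split.
- by rewrite oppr_eq0.
- move=> i; have [_ pF LE] := hF i; have [_ F1] := F_neq i; split.
  + exact: projectionC.
  + by rewrite subr_eq0 eq_sym.
  + rewrite LE aE rmorphN rmorphD scaleNr scalerBr scalerDl opprB.
    by rewrite addrA addrAC subrK addrC.
move=> i j ij; have [_ _ [dij|//] _] := F_pair ij.
by case: nd; apply: F_all_disjoint dij _ _ _.
Qed.

End Choice.

(** The [F i] are nonzero and mutually orthogonal, and their sum is scalar; it fixes each [F i], so
    it is the identity. Thus [n] positive ranks add up to [n]. *)
Lemma cp_basis : exists (a : R) (b : 'I_n -> R) (F : 'I_n -> 'M[C]_n),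
  [/\ a != 0, forall i, rank_proj 1 (F i) /\ L (D i) = rC a *: F i + rC (b i) *: 1%:M &
     forall i j, i != j -> F i *m F j = 0].
Proof.
have [a0 [b0 [F0 /cp_choice_disjoint[a [b [F [a_neq0 hF dF]]]]]]] := cp_delta_projection.
exists a, b, F; split=> // i0; have [[hF1 FF] Fn0 LE] := hF i0; split=> //.
split=> //; split=> //.
have sumF : \sum_i F i = 1%:M.
  have := cp_sum_delta L_cp; rewrite (eq_bigr (fun i => rC a *: F i + rC (b i) *: 1%:M)); last first.
    by move=> i _; have [] := hF i.
  rewrite big_split /= -scaler_sumr -scaler_suml => h.
  have aC : rC a != 0 by rewrite (inj_eq (@complexI R) _ 0).
  have [s sE] : exists s : C, \sum_i F i = s *: 1%:M.
    by exists ((1 - \sum_i rC (b i)) / rC a); exact: shift_scalar aC h.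
  have : (\sum_i F i) *m F i0 = F i0.
    rewrite mulmx_suml (bigD1 i0) //= FF big1 ?addr0 // => j ji.
    exact: dF.
  rewrite sE -scalemxAl mul1mx => /eqP; rewrite -subr_eq0 -{2}(scale1r (F i0)) -scalerBl.
  by rewrite scaler_eq0 (negbTE Fn0) orbF subr_eq0 => /eqP ->; rewrite scale1r.
have rkE i : \tr (F i) = (\rank (F i))%:R by have [[_ h] _ _] := hF i; apply: idem_trace.
have rk_pos i : (0 < \rank (F i))%N by have [_ h _] := hF i; rewrite lt0n mxrank_eq0.
have rk_sum : (\sum_i \rank (F i))%N = n.
  apply/eqP; rewrite -(eqr_nat C) natr_sum -[X in _ == X](mxtrace1 C n) -sumF raddf_sum.
  by apply/eqP; apply: eq_bigr => i _; rewrite -rkE.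
rewrite rkE; congr _%:R; apply/eqP; rewrite eqn_leq rk_pos andbT.
have : (\sum_(i | i != i0) 1 <= \sum_(i | i != i0) \rank (F i))%N by apply: leq_sum.
rewrite -(leq_add2l (\rank (F i0))).
have -> : (\rank (F i0) + \sum_(i | i != i0) \rank (F i) = n)%N.
  by rewrite -[RHS]rk_sum [RHS](bigD1 i0).
rewrite sum1_card cardC1 card_ord -[X in (_ <= X)%N](prednK (ltn_trans (ltn0Sn 1) n_gt2)) -[X in (_ <= X)%N]add1n.
by rewrite leq_add2r.
Qed.

End Basis.

(** * Rank-one projections *)

Lemma comb_sub (K : fieldType) n (E E' : 'M[K]_n) :
  E = 2 *: (E + 2 *: E') + (-1) *: (E + 4 *: E').
Proof. by apply/matrixP=> i j; rewrite !mxE; ring. Qed.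

Lemma comb_half (K : fieldType) n (E E' : 'M[K]_n) : (2 : K) != 0 ->
  E' = 2^-1 *: (E + 4 *: E') + (- 2^-1) *: (E + 2 *: E').
Proof. by move=> h; apply/matrixP=> i j; rewrite !mxE; field. Qed.

Section RankOne.
Variable R : realType.
Local Notation C := R[i].
Variable n : nat.
Implicit Types (E F G X Y : 'M[C]_n).
Local Notation D i := (delta_mx i i : 'M[C]_n).
Local Notation rC x := ((x%:C)%C : C).

Lemma rank_proj1_rank F : rank_proj 1 F -> \rank F = 1%N.
Proof.
by move=> [_ [FF trF]]; apply/eqP; rewrite -(eqr_nat C) -idem_trace // trF.
Qed.

(** A difference of two matrices of rank at most one has rank at most 2, so for [n > 2] it is no
    nonzero scalar; traces then compare the coefficients. *)
Lemma shifted_rank1_coef F F' (a b a' b' : R) : (2 < n)%N ->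
  rank_proj 1 F -> rank_proj 1 F' ->
  rC a *: F + rC b *: 1%:M = rC a' *: F' + rC b' *: 1%:M -> a = a'.
Proof.
move=> n2 hF hF' h.
have h' : rC a *: F - rC a' *: F' = (rC b' - rC b) *: 1%:M.
  rewrite scalerBl; apply/eqP; rewrite subr_eq addrAC.
  by rewrite eq_sym subr_eq addrC -h eqxx.
have rkZ (x : C) X : (\rank (x *: X) <= \rank X)%N.
  have [->|x0] := eqVneq x 0; first by rewrite scale0r mxrank0.
  by rewrite mxrank_scale_nz.
have b0 : rC b' - rC b = 0.
  apply/eqP; apply: contraTT isT => b0.
  have rkn : \rank ((rC b' - rC b) *: (1%:M : 'M[C]_n)) = n.
    by rewrite mxrank_scale_nz // mxrank1.
  have : (n <= 2)%N; last by rewrite leqNgt n2.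
  rewrite -{1}rkn -h'; apply: leq_trans (mxrank_add _ _) _.
  rewrite mxrank_opp (_ : 2 = \rank F + \rank F')%N ?leq_add ?rkZ //.
  by rewrite !rank_proj1_rank.
move/eqP: h'; rewrite b0 scale0r subr_eq0 => /eqP/(congr1 mxtrace).
have [_ [_ t]] := hF; have [_ [_ t']] := hF'.
by rewrite !mxtraceZ t t' !mulr1 => /complexI.
Qed.

Lemma rdiag_rank1 (e : 'I_n -> R) : rank_proj 1 (rdiag e) -> exists i, rdiag e = D i.
Proof.
move=> hP; have [_ [ee _]] := hP.
have e01 i : e i = 0 \/ e i = 1.
  move/matrixP: ee => /(_ i i); rewrite rdiagM !rdiagE eqxx !mulr1n => /complexI/eqP.
  rewrite -subr_eq0 -{3}(mulr1 (e i)) -mulrBr mulf_eq0 subr_eq0.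
  by move=> /orP[]/eqP->; auto.
have deE i : dpart (rdiag e) i = e i by rewrite /dpart rdiagE eqxx.
have se : \sum_i e i = 1.
  by apply: (etrans _ (dpart_sum hP)); apply: eq_bigr => i _; rewrite deE.
have [i ei] : exists i, e i = 1.
  apply: contrapT => no; move: se; rewrite big1 => [/eqP|i _].
    by rewrite eq_sym oner_eq0.
  by case: (e01 i) => // ei; case: no; exists i.
exists i; apply/matrixP=> a b; rewrite rdiagE mxE.
have [<-|ab] := eqVneq a b; last first.
  have -> // : (a == i) && (b == i) = false.
  by apply/negP => /andP[/eqP ai /eqP bi]; rewrite ai bi eqxx in ab.
rewrite mulr1n andbb; have [->|ai] := eqVneq a i; first by rewrite ei.
suff -> : e a = 0 by [].
apply/eqP; move/eqP: se; rewrite (bigD1 i) //= ei -subr_eq0 addrAC subrr add0r.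
rewrite psumr_eq0 => [/allP/(_ a (mem_index_enum a))|j _]; first by rewrite ai.
by case: (e01 j) => ->; rewrite ?ler01.
Qed.

(** For [A = E + 2 E'] one has [A^2 = E + 4 E'], so [E = 2 A - A^2] and [E' = (A^2 - A) / 2]. Being
    polynomials in [A], both are diagonalised along with it. *)
Lemma orth_rank1_diag E E' : rank_proj 1 E -> rank_proj 1 E' -> E *m E' = 0 ->
  exists V i j, [/\ unitary V, E = uconj V (D i) & E' = uconj V (D j)].
Proof.
move=> hE hE' EE'; have [h1 [h2 _]] := hE; have [h1' [h2' _]] := hE'.
have E'E : E' *m E = 0 by rewrite -[LHS]adjmxK adjmxM h1 h1' EE' adjmx0.
pose A := E + rscale 2 E'.
have [V [d [hV AE]]] : exists V, exists d, unitary V /\ A = uconj V (rdiag d).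
  by apply: herm_spectral; apply/hermD/herm_rscale.
have AA : A *m A = E + rscale 4 E'.
  rewrite /A /rscale mulmxDl !mulmxDr -!scalemxAl -!scalemxAr h2 h2' EE' E'E.
  by rewrite !scaler0 addr0 add0r scalerA -rmorphM; congr (_ + (real_complex_def _ _) *: _); ring.
have dA : rdiag d = uconj (adjmx V) A by rewrite AE uconjK.
have hV' := unitary_adj hV.
have dAA : rdiag (fun i => d i * d i) = uconj (adjmx V) (A *m A).
  by rewrite -rdiagM dA (uconjM _ _ hV').
have rdZ (c : R) e : rdiag (fun i => c * e i) = rscale c (rdiag e : 'M[C]_n).
  by apply/matrixP=> a b; rewrite !mxE rmorphM mulrnAr.
have rdD (e f : 'I_n -> R) : rdiag (fun i => e i + f i) = rdiag e + rdiag f :> 'M[C]_n.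
  by apply/matrixP=> a b; rewrite !mxE rmorphD mulrnDl.
have eE : uconj (adjmx V) E = rdiag (fun i => 2 * d i + (-1) * (d i * d i)).
  rewrite rdD !rdZ dAA dA /rscale -!uconjZ -uconjD AA /A /rscale; congr uconj.
  by rewrite rmorphN1 !rmorph_nat; exact: comb_sub.
have eE' : uconj (adjmx V) E' = rdiag (fun i => 2^-1 * (d i * d i) + (- 2^-1) * d i).
  rewrite rdD !rdZ dAA dA /rscale -!uconjZ -uconjD AA /A /rscale; congr uconj.
  by rewrite rmorphN /= !fmorphV !rmorph_nat; apply: comb_half; rewrite pnatr_eq0.
have := uconj_proj hV' hE; rewrite eE => /rdiag_rank1[i Ei].
have := uconj_proj hV' hE'; rewrite eE' => /rdiag_rank1[j Ej].
by exists V, i, j; split; [exact: hV|rewrite -Ei -eE|rewrite -Ej -eE']; rewrite uconjKV.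
Qed.

Lemma rank1_diag E : rank_proj 1 E -> exists V i, unitary V /\ E = uconj V (D i).
Proof.
move=> hE; have [h1 _] := hE; have [V [d [hV EE]]] := herm_spectral h1.
have hV' := unitary_adj hV.
have := uconj_proj hV' hE; rewrite EE uconjK // => /rdiag_rank1[i ->].
by exists V, i.
Qed.

Lemma delta_proj1 i : rank_proj 1 (D i).
Proof.
have -> : D i = rdiag (fun l => (l \in [set i])%:R : R).
  apply/matrixP=> a b; rewrite rdiagE mxE inE; have [->|ai] := eqVneq a i.
    by rewrite eq_sym; case: eqP.
  by rewrite rmorph0 mul0rn.
by apply: rdiag_proj; rewrite cards1.
Qed.

Lemma rank1_trace0 E G : rank_proj 1 E -> rank_proj 1 G -> rtr (E *m G) = 0 -> E *m G = 0.
Proof.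
move=> [p1 [p2 p3]] [q1 [q2 q3]] h; apply: rtr_sq_eq0.
by rewrite adjmxM p1 q1 mulmxA -(mulmxA E) q2 rtrC mulmxA p2.
Qed.

(** [E + E'] has rank at most 2, less than [n], hence a zero eigenvalue. On its eigenprojection [G]
    the two nonnegative traces sum to 0. *)
Lemma rank1_common_orth E E' : (2 < n)%N -> rank_proj 1 E -> rank_proj 1 E' ->
  exists2 G, rank_proj 1 G & E *m G = 0 /\ E' *m G = 0.
Proof.
move=> n2 hE hE'; have [h1 _] := hE; have [h1' _] := hE'.
have [V [d [hV AE]]] := herm_spectral (hermD h1 h1').
have [i di] : exists i, d i = 0.
  apply: contrapT => no.
  have : (E + E') \in unitmx.
    rewrite AE /uconj !unitmx_mul.
    have [-> ->] : adjmx V \in unitmx /\ V \in unitmx by apply: mulmx1_unit.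
    rewrite andbT /= unitmxE det_diag unitfE; apply/prodf_neq0 => i _.
    by rewrite mxE (inj_eq (@complexI R) _ 0); apply/eqP => di; apply: no; exists i.
  move=> /mxrank_unit rk; have : (n <= 2)%N; last by rewrite leqNgt n2.
  by rewrite -{1}rk; apply: leq_trans (mxrank_add _ _) _; rewrite !rank_proj1_rank.
have hG := uconj_proj hV (delta_proj1 i); exists (uconj V (D i)); first exact: hG.
have : rtr ((E + E') *m uconj V (D i)) = 0.
  rewrite AE -(uconjM _ _ hV).
  have -> : rdiag d *m D i = 0.
    apply/matrixP=> a b; rewrite /rdiag mul_diag_mx !mxE.
    by have [->|_] := eqVneq a i; rewrite ?di ?mul0r ?mulr0.
  by rewrite uconj0 /rtr mxtrace0.
rewrite mulmxDl rtrD => /eqP; rewrite paddr_eq0.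
- by move=> /andP[/eqP e1 /eqP e2]; split; apply: rank1_trace0.
- exact: rtr_proj_ge0 hE hG.
- exact: rtr_proj_ge0 hE' hG.
Qed.

End RankOne.

(** * Splitting the preserver into a frame map and a scalar part *)

Lemma comb_linear (K : fieldType) n (U V : 'M[K]_n) (c x b b' : K) :
  c *: (x *: U + V - (x * b + b') *: 1%:M) = x *: (c *: (U - b *: 1%:M)) + c *: (V - b' *: 1%:M).
Proof. by apply/matrixP=> i j; rewrite !mxE; ring. Qed.

Section Normalise.
Variable R : realType.
Local Notation C := R[i].
Variables (n k : nat).
Implicit Types (E F G X Y V : 'M[C]_n).
Variable L : 'M[C]_n -> 'M[C]_n.
Hypothesis L_cp : commutant_preserver k L.
Hypotheses (k_gt0 : (0 < k)%N) (lt_kn : (k < n)%N) (n_gt2 : (2 < n)%N).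
Local Notation D i := (delta_mx i i : 'M[C]_n).
Local Notation rC x := ((x%:C)%C : C).

Definition coef_at E (a : R) := exists (b : R) F, rank_proj 1 F /\ L E = rC a *: F + rC b *: 1%:M.

Lemma coef_at_unique E a a' : coef_at E a -> coef_at E a' -> a = a'.
Proof.
move=> [b [F [hF e]]] [b' [F' [hF' h]]]; rewrite e in h.
exact: shifted_rank1_coef n_gt2 hF hF' h.
Qed.

Lemma coef_at_unitary V : unitary V -> exists2 a : R, a != 0 &
  exists (b : 'I_n -> R) (F : 'I_n -> 'M[C]_n),
  [/\ forall i, rank_proj 1 (F i) /\ L (uconj V (D i)) = rC a *: F i + rC (b i) *: 1%:M &
     forall i j, i != j -> F i *m F j = 0].
Proof.
move=> hV; have [a [b [F [a0 h1 h2]]]] := cp_basis (cp_uconj hV L_cp) k_gt0 lt_kn n_gt2.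
by exists a => //; exists b, F.
Qed.

Lemma coef_at_orth E E' a : rank_proj 1 E -> rank_proj 1 E' -> E *m E' = 0 ->
  coef_at E a -> coef_at E' a.
Proof.
move=> hE hE' orth; have [V [i [j [hV -> ->]]]] := orth_rank1_diag hE hE' orth.
have [a' _ [b [F [hF _]]]] := coef_at_unitary hV => ha.
have [h1 e1] := hF i; have [h2 e2] := hF j.
rewrite (coef_at_unique ha (a' := a')); last by exists (b i), (F i).
by exists (b j), (F j).
Qed.

(** The coefficient agrees on orthogonal rank-one projections, and any two rank-one projections
    admit a third one orthogonal to both. *)
Lemma coef_global : exists2 a : R, a != 0 & forall E, rank_proj 1 E -> coef_at E a.
Proof.
pose i0 : 'I_n := Ordinal (ltn_trans (ltn0Sn _) n_gt2).
have [a a0 [b [F [hF _]]]] := coef_at_unitary (@unitary1 R n).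
exists a => // E hE.
have hD : rank_proj 1 (uconj 1%:M (D i0)) by apply: uconj_proj (delta_proj1 _ _); exact: unitary1.
have [G hG [o1 o2]] := rank1_common_orth n_gt2 hD hE.
have aD : coef_at (uconj 1%:M (D i0)) a by have [h1 e1] := hF i0; exists (b i0), (F i0).
apply: (coef_at_orth hG hE _ (coef_at_orth hD hG o1 aD)).
have [g _] := hG; have [e _] := hE.
by rewrite -[LHS]adjmxK adjmxM g e o2 adjmx0.
Qed.

Lemma cp_decompose : exists a (be : 'M[C]_n -> C) (S : 'M[C]_n -> 'M[C]_n),
  [/\ (a : R) != 0,
      forall X, L X = rC a *: S X + be X *: 1%:M,
      linear S, (forall X, S (adjmx X) = adjmx (S X)) &
   S 1%:M = 1%:M /\ forall V, unitary V ->
     (forall i, rank_proj 1 (S (uconj V (D i)))) /\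
     (forall i j, i != j -> S (uconj V (D i)) *m S (uconj V (D j)) = 0)].
Proof.
have [a a0 ha] := coef_global.
have aC : rC a != 0 by rewrite (inj_eq (@complexI R) _ 0).
have nC : (n%:R : C) != 0 by rewrite pnatr_eq0 -lt0n (ltn_trans (ltn0Sn _) n_gt2).
(* Taking traces in [L E = a F + b I] with [E] and [F] of trace 1 gives [b = (tr (L E) - a) / n].
   Writing [a * tr X] for [a] makes the formula linear, so [S] is linear by construction and sends
   [E] to [F]. *)
pose be X := (\tr (L X) - rC a * \tr X) / n%:R.
pose S X := (rC a)^-1 *: (L X - be X *: 1%:M).
have beD x X Y : be (x *: X + Y) = x * be X + be Y.
  rewrite /be (cp_lin L_cp) !mxtraceD !mxtraceZ.
  by move: (\tr X) (\tr Y) (\tr (L X)) (\tr (L Y)) (rC a) => p q r s t; field.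
have SE E b F : rank_proj 1 E -> rank_proj 1 F -> L E = rC a *: F + b *: 1%:M ->
    S E = F /\ be E = b.
  move=> [_ [_ tE]] [_ [_ tF]] LE.
  have bE : be E = b.
    rewrite /be LE mxtraceD !mxtraceZ tE tF mxtrace1.
    by rewrite addrAC subrr add0r mulfK.
  by split=> //; rewrite /S bE LE addrK scalerA mulVf // scale1r.
exists a, be, S; split=> //.
- by move=> X; rewrite /S scalerA divff // scale1r subrK.
- by move=> x X Y; rewrite /S beD (cp_lin L_cp) comb_linear.
- move=> X; have beJ : be (adjmx X) = Num.conj (be X).
    rewrite /be (cp_adj L_cp) !mxtrace_adj fmorph_div rmorphB rmorphM /= conj_real.
    by rewrite rmorph_nat.
  rewrite /S beJ (cp_adj L_cp) adjmxZ adjmxB adjmxZ adjmx1 fmorphV /= conj_real.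
  by [].
split.
  rewrite /S /be (cp_one L_cp) mxtrace1.
  have -> : (n%:R - rC a * n%:R) / n%:R = 1 - rC a.
    by rewrite -{1}(mul1r n%:R) -mulrBl mulfK.
  by rewrite scalerBl scale1r subKr scalerA mulVf // scale1r.
move=> V hV; have [a' _ [b [F [hF oF]]]] := coef_at_unitary hV.
have hE i : rank_proj 1 (uconj V (D i)) by apply: uconj_proj hV (delta_proj1 _ _).
have FE i : S (uconj V (D i)) = F i.
  have [h1 h2] := hF i.
  have e : a = a' by apply: (coef_at_unique (ha _ (hE i))); exists (b i), (F i).
  by rewrite -e in h2; have [] := SE _ _ _ (hE i) h1 h2.
by split=> [i|i j ij]; rewrite !FE; [have [] := hF i|apply: oF].
Qed.

End Normalise.

(** * Jordan homomorphisms and matrix units *)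

Section MatrixUnits.
Variables (K : fieldType) (n : nat).
Implicit Types (i j l : 'I_n) (x y z w : K).

Lemma mul_cross i j x y z w : i != j ->
  (x *: delta_mx i j + y *: delta_mx j i) *m (z *: delta_mx i j + w *: delta_mx j i) =
  (x * w) *: delta_mx i i + (y * z) *: delta_mx j j :> 'M_n.
Proof.
move=> ij; have ji : j != i by rewrite eq_sym.
rewrite mulmxDl !mulmxDr -!scalemxAl -!scalemxAr !mul_delta_mx.
rewrite (mul_delta_mx_0 _ _ _ ij) (mul_delta_mx_0 _ _ _ ji) !scaler0 add0r addr0.
by rewrite !scalerA.
Qed.

Lemma mul_chain i j l x y z w : i != j -> j != l -> i != l ->
  (x *: delta_mx i j + y *: delta_mx j i) *m (z *: delta_mx j l + w *: delta_mx l j) =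
  (x * z) *: delta_mx i l :> 'M_n.
Proof.
move=> ij jl il.
rewrite mulmxDl !mulmxDr -!scalemxAl -!scalemxAr mul_delta_mx.
rewrite (mul_delta_mx_0 _ _ _ ij) (mul_delta_mx_0 _ _ _ jl) (mul_delta_mx_0 _ _ _ il).
by rewrite !scaler0 !addr0 scalerA.
Qed.

Lemma comb_diag i j x y : i != j ->
  (x *: delta_mx i i + y *: delta_mx j j : 'M_n) i i = x.
Proof. by move=> ij; rewrite !mxE eqxx (negbTE ij) mulr1 mulr0 addr0. Qed.

Lemma comb_cross i j x y : i != j ->
  (x *: delta_mx i j + y *: delta_mx j i : 'M_n) i j = x.
Proof. by move=> ij; rewrite !mxE !eqxx (negbTE ij) mulr1 mulr0 addr0. Qed.

End MatrixUnits.

Section Jordan.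
Variable R : realType.
Local Notation C := R[i].
Variable n : nat.
Implicit Types (E F G X Y V : 'M[C]_n).
Local Notation D i := (delta_mx i i : 'M[C]_n).
Local Notation rC x := ((x%:C)%C : C).

Record jordan_star (S : 'M[C]_n -> 'M[C]_n) : Prop := JordanStar {
  js_lin : linear S;
  js_adj : forall X, S (adjmx X) = adjmx (S X);
  js_mul : forall X Y, S (X *m Y + Y *m X) = S X *m S Y + S Y *m S X }.

Lemma js_uconj V S : unitary V -> jordan_star S -> jordan_star (fun X => uconj V (S X)).
Proof.
move=> hV [lin adj mul]; split=> [a X Y|X|X Y].
- by rewrite lin uconjD uconjZ.
- by rewrite adj uconj_adj.
- by rewrite mul uconjD !(uconjM _ _ hV).
Qed.

Lemma adjmx_tr X : adjmx X^T = (adjmx X)^T.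
Proof. by apply/matrixP=> i j; rewrite !mxE. Qed.

Lemma js_tr S : jordan_star S -> jordan_star (fun X => S X^T).
Proof.
move=> [lin adj mul]; split=> [a X Y|X|X Y].
- by rewrite linearP lin.
- by rewrite -adj adjmx_tr.
- by rewrite -mul raddfD /= !trmx_mul addrC.
Qed.

Section Units.
Variable S : 'M[C]_n -> 'M[C]_n.
Hypothesis S_js : jordan_star S.
Hypothesis S_diag : forall i, S (D i) = D i.

Let S0 : S 0 = 0.
Proof. by have := js_lin S_js (-1) 0 0; rewrite scaler0 addr0 scaleN1r addNr. Qed.
Let SD X Y : S (X + Y) = S X + S Y.
Proof. by have := js_lin S_js 1 X Y; rewrite !scale1r. Qed.
Let SZ a X : S (a *: X) = a *: S X.
Proof. by have := js_lin S_js a X 0; rewrite S0 !addr0. Qed.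

Let p i j : C := S (delta_mx i j) i j.
Let q i j : C := S (delta_mx i j) j i.

(** The Jordan products with [D i] and with [D j] both fix [delta_mx i j]. As [S] fixes [D i] and
    [D j], a nonzero entry has exactly one index equal to [i] and exactly one equal to [j]. *)
Lemma js_unit_entry i j a b : i != j -> S (delta_mx i j) a b != 0 ->
  (a = i /\ b = j) \/ (a = j /\ b = i).
Proof.
move=> ij; set G := S _.
have row l : D l *m delta_mx i j + delta_mx i j *m D l = delta_mx i j ->
    ((a == l)%:R + (b == l)%:R) * G a b = G a b.
  move=> h; have := js_mul S_js (D l) (delta_mx i j); rewrite h S_diag -/G.
  move=> /matrixP/(_ a b) e; rewrite [RHS]e !mxE mulrDl; congr (_ + _).
    rewrite (bigD1 l) //= mxE eqxx andbT big1 ?addr0.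
      by case: eqP => [->|_]; rewrite ?mul1r ?mul0r.
    by move=> c cl; rewrite mxE (negbTE cl) andbF mul0r.
  rewrite (bigD1 l) //= mxE eqxx /= big1 ?addr0.
    by case: eqP => [->|_]; rewrite ?mul1r ?mulr1 ?mul0r ?mulr0.
  by move=> c cl; rewrite mxE (negbTE cl) mulr0.
have hi := row i; have hj := row j; have ji : j != i by rewrite eq_sym.
rewrite mul_delta_mx (mul_delta_mx_0 _ _ _ ji) addr0 in hi.
rewrite mul_delta_mx (mul_delta_mx_0 _ _ _ ji) add0r in hj.
move: (hi erefl) (hj erefl) => {hi hj} hi hj G0.
have one (x y : bool) : (x%:R + y%:R) * G a b = G a b -> x (+) y.
  rewrite -[RHS]mul1r => /(mulIf G0).
  case: x; case: y => //= /eqP; rewrite ?addr0 ?add0r //.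
    by rewrite -subr_eq0 addrK oner_eq0.
  by rewrite eq_sym oner_eq0.
have ij' := negbTE ij.
move: (one _ _ hi) (one _ _ hj).
have [ai|ai] := eqVneq a i; have [bi|bi] := eqVneq b i => //= _.
  by rewrite ai ij' /= => /eqP->; left.
by rewrite bi ij' addbF => /eqP->; right.
Qed.

Lemma js_unit i j : i != j -> S (delta_mx i j) = p i j *: delta_mx i j + q i j *: delta_mx j i.
Proof.
move=> ij; apply/matrixP=> a b; rewrite !mxE.
have [e|e] := eqVneq (S (delta_mx i j) a b) 0.
  rewrite e; case: (eqVneq a i) => [ai|ai]; case: (eqVneq b j) => [bj|bj] /=.
  - have eij : (i == j) = false by apply/negbTE.
    by rewrite ai bj eij /= mulr0 addr0 mulr1 /p; rewrite ai bj in e; rewrite e.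
  - by rewrite ai (negbTE ij) /= !mulr0 addr0.
  - by rewrite bj [j == i]eq_sym (negbTE ij) andbF !mulr0 addr0.
  - have [aj|_] := eqVneq a j; last by rewrite !mulr0 addr0.
    have [bi|_] := eqVneq b i; last by rewrite !mulr0 addr0.
    by rewrite mulr0 add0r mulr1 /q; rewrite aj bi in e; rewrite e.
case: (js_unit_entry ij e) => [[-> ->]|[-> ->]].
  by rewrite !eqxx (negbTE ij) /= mulr1 mulr0 addr0.
by rewrite !eqxx [j == i]eq_sym (negbTE ij) /= mulr1 mulr0 add0r.
Qed.

(** Off-diagonal units square to zero, and so must their images: a unit is kept or flipped up to a
    factor, never mixed. *)
Lemma js_pq i j : i != j -> p i j * q i j = 0.
Proof.
move=> ij; have := js_mul S_js (delta_mx i j) (delta_mx i j).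
have ji : j != i by rewrite eq_sym.
rewrite (mul_delta_mx_0 _ _ _ ji) addr0 S0 (js_unit ij) (mul_cross _ _ _ _ ij).
move=> /esym/matrixP/(_ i i); rewrite mxE (comb_diag _ _ ij) mxE.
by move=> /eqP; rewrite -mulr2n -mulr_natr mulf_eq0 pnatr_eq0 orbF => /eqP.
Qed.

Lemma js_conj i j : p j i = Num.conj (p i j) /\ q j i = Num.conj (q i j).
Proof.
have h : S (delta_mx j i) = adjmx (S (delta_mx i j)).
  rewrite -(js_adj S_js); congr S; apply/matrixP=> a b.
  by rewrite !mxE rmorph_nat andbC.
by split; rewrite /p /q h adjmxE.
Qed.

Lemma js_norm i j : i != j -> p i j * Num.conj (p i j) + q i j * Num.conj (q i j) = 1.
Proof.
move=> ij; have := js_mul S_js (delta_mx i j) (delta_mx j i).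
have [pc qc] := js_conj i j.
have ji : j != i by rewrite eq_sym.
rewrite !mul_delta_mx SD !S_diag (js_unit ij) (js_unit ji) pc qc.
rewrite [X in _ *m X + _]addrC [X in _ + X *m _]addrC !(mul_cross _ _ _ _ ij).
move=> /matrixP/(_ i i).
rewrite [X in X = _ -> _]mxE [X in _ = X -> _]mxE !(comb_diag _ _ ij) => h.
by have := h; rewrite !mxE eqxx (negbTE ij) addr0 [Num.conj (q i j) * _]mulrC => <-.
Qed.

Lemma js_triple i j l : i != j -> j != l -> i != l ->
  p i l = p i j * p j l /\ q i l = q i j * q j l.
Proof.
move=> ij jl il; have := js_mul S_js (delta_mx i j) (delta_mx j l).
have ji : j != i by rewrite eq_sym.
have lj : l != j by rewrite eq_sym.
have li : l != i by rewrite eq_sym.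
rewrite mul_delta_mx mul_delta_mx_0 // addr0 (js_unit ij) (js_unit jl) => h.
have hE : S (delta_mx i l) = (p i j * p j l) *: delta_mx i l + (q i j * q j l) *: delta_mx l i.
  rewrite h (mul_chain _ _ _ _ ij jl il) [X in _ + X *m _]addrC [X in _ + _ *m X]addrC.
  by rewrite (mul_chain _ _ _ _ lj ji li) [q j l * _]mulrC.
split; first by rewrite {1}/p hE (comb_cross _ _ il).
by rewrite {1}/q hE addrC (comb_cross _ _ li).
Qed.

(** If one unit is kept, [js_triple] and [js_norm] spread this along row [i0]. That row trivialises
    the multiplicative cocycle [p]: the numbers [u] are unimodular, [p a b] is the conjugate of
    [u a] times [u b], and [W] is the diagonal matrix of [u]. *)
Lemma js_straight i0 j0 : i0 != j0 -> p i0 j0 != 0 ->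
  exists2 W, unitary W & forall X, S X = uconj W X.
Proof.
move=> ij0 p0.
have pl l : i0 != l -> p i0 l != 0.
  move=> il; have [<-//|jl] := eqVneq j0 l.
  have [pE qE] := js_triple ij0 jl il.
  have q0 : q i0 j0 = 0 by have /eqP := js_pq ij0; rewrite mulf_eq0 (negbTE p0) => /eqP.
  have := js_norm il; rewrite qE q0 mul0r mul0r addr0 => h; apply: contra_eq_neq h => ->.
  by rewrite mul0r eq_sym oner_eq0.
pose u l : C := if l == i0 then 1 else p i0 l.
have u0 l : u l != 0.
  by rewrite /u; have [_|li] := eqVneq l i0; [exact: oner_neq0|apply: pl; rewrite eq_sym].
have pu a b : a != b -> p a b = Num.conj (u a) * u b.
  move=> ab; rewrite /u; have [ai|ai] := eqVneq a i0.
    by rewrite ai rmorph1 mul1r ifN // -ai eq_sym.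
  have [bi|bi] := eqVneq b i0; first by rewrite bi mulr1; have [] := js_conj i0 a.
  have [] := @js_triple a i0 b; rewrite // 1?eq_sym // => -> _.
  by have [-> _] := js_conj i0 a.
have SE a b : S (delta_mx a b) = (Num.conj (u a) * u b) *: delta_mx a b.
  have uu l : Num.conj (u l) * u l = 1.
    rewrite mulrC; rewrite /u; have [_|li] := eqVneq l i0; first by rewrite rmorph1 mulr1.
    rewrite eq_sym in li; have := js_norm li; have := js_pq li.
    by move=> /eqP; rewrite mulf_eq0 (negbTE (pl _ li)) => /eqP->; rewrite mul0r addr0.
  have [<-|ab] := eqVneq a b; first by rewrite S_diag uu scale1r.
  rewrite js_unit // -pu //; have /eqP := js_pq ab.
  rewrite mulf_eq0 pu // mulf_eq0 conjC_eq0 (negbTE (u0 _)) (negbTE (u0 _)) /= => /eqP->.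
  by rewrite scale0r addr0.
pose W : 'M[C]_n := diag_mx (\row_l u l).
have WE X : uconj W X = \matrix_(a, b) (Num.conj (u a) * u b * X a b).
  have aW : adjmx W = diag_mx (\row_l Num.conj (u l)).
    apply/matrixP=> a b; rewrite !mxE rmorphMn /= eq_sym.
    by case: eqP => [->|]; rewrite ?mulr0n.
  apply/matrixP=> a b; rewrite /uconj aW mul_diag_mx mul_mx_diag !mxE.
  by rewrite mulrAC.
exists W.
  have SD1 : S 1%:M = 1%:M.
    rewrite -[1%:M]/(1%:M : 'M[C]_n) (_ : 1%:M = \sum_i D i).
      rewrite (big_morph _ SD S0); by apply: eq_bigr => i _; rewrite S_diag.
    apply/matrixP=> a b; rewrite summxE !mxE (bigD1 a) //= mxE eqxx /= big1 ?addr0.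
      by rewrite eq_sym.
    by move=> i ia; rewrite mxE eq_sym (negbTE ia).
  rewrite /unitary; have <- : uconj W 1%:M = adjmx W *m W by rewrite /uconj mulmx1.
  rewrite WE; apply/matrixP=> a b; rewrite !mxE; have [<-|_] := eqVneq a b; last by rewrite mulr0.
  rewrite mulr1; have := S_diag a; rewrite SE => /matrixP/(_ a a).
  by rewrite !mxE !eqxx /= mulr1.
move=> X; rewrite WE.
have -> : S X = \sum_c \sum_d (Num.conj (u c) * u d * X c d) *: delta_mx c d.
  rewrite {1}(matrix_sum_delta X) (big_morph S SD S0); apply: eq_bigr => c _.
  rewrite (big_morph S SD S0); apply: eq_bigr => d _.
  by rewrite SZ SE scalerA mulrC.
rewrite [RHS]matrix_sum_delta; apply: eq_bigr => c _; apply: eq_bigr => d _.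
by rewrite mxE.
Qed.

End Units.

End Jordan.

(** * Maps sending orthonormal frames to orthonormal frames *)

Section Wigner.
Variable R : realType.
Local Notation C := R[i].
Variable n : nat.
Implicit Types (A B E F G X Y V : 'M[C]_n).
Local Notation D i := (delta_mx i i : 'M[C]_n).
Local Notation rC x := ((x%:C)%C : C).

Variable S : 'M[C]_n -> 'M[C]_n.
Hypothesis S_lin : linear S.
Hypothesis S_adj : forall X, S (adjmx X) = adjmx (S X).
Hypothesis S_one : S 1%:M = 1%:M.
Hypothesis S_frame : forall V, unitary V ->
   (forall i, rank_proj 1 (S (uconj V (D i)))) /\
   (forall i j, i != j -> S (uconj V (D i)) *m S (uconj V (D j)) = 0).

Let S0 : S 0 = 0.
Proof. by have := S_lin (-1) 0 0; rewrite scaler0 addr0 scaleN1r addNr. Qed.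
Let SD X Y : S (X + Y) = S X + S Y.
Proof. by have := S_lin 1 X Y; rewrite !scale1r. Qed.
Let SZ a X : S (a *: X) = a *: S X.
Proof. by have := S_lin a X 0; rewrite S0 !addr0. Qed.

(** [S] sends the eigenprojections of [A] to mutually orthogonal projections and keeps the
    eigenvalues, so it respects squares; polarisation then gives the Jordan identity. *)
Lemma frame_sq A : is_herm A -> S (A *m A) = S A *m S A.
Proof.
move=> /herm_spectral[V [d [hV ->]]]; have [h1 h2] := S_frame hV.
have SE (e : 'I_n -> R) : S (uconj V (rdiag e)) = \sum_i rC (e i) *: S (uconj V (D i)).
  rewrite rdiag_sum uconj_sum (big_morph S SD S0); apply: eq_bigr => i _.
  by rewrite uconjZ SZ.
rewrite -(uconjM _ _ hV) rdiagM !SE mulmx_suml; apply: eq_bigr => i _.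
rewrite mulmx_sumr (bigD1 i) //= big1 ?addr0 => [|j ji].
  rewrite -scalemxAl -scalemxAr scalerA -rmorphM.
  by have [_ [-> _]] := h1 i.
by rewrite -scalemxAl -scalemxAr h2 ?scaler0 // eq_sym.
Qed.

Lemma frame_jordan : jordan_star S.
Proof.
have hmul A B : is_herm A -> is_herm B -> S (A *m B + B *m A) = S A *m S B + S B *m S A.
  move=> hA hB; have := frame_sq (hermD hA hB).
  have eE (U W : 'M[C]_n) : (U + W) *m (U + W) = (U *m U + W *m W) + (U *m W + W *m U).
    by rewrite mulmxDl !mulmxDr [X in _ + X]addrC addrACA.
  rewrite SD !eE [S (_ + _ + _)]SD [S (A *m A + _)]SD (frame_sq hA) (frame_sq hB).
  by move=> /addrI.
split=> // X Y.
rewrite (cartesianE X) (cartesianE Y).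
move: (reh X) (imh X) (reh Y) (imh Y) (reh_herm X) (imh_herm X) (reh_herm Y) (imh_herm Y).
move=> A B A' B' hA hB hA' hB'.
have eE (U V U' V' : 'M[C]_n) : (U + 'i%C *: V) *m (U' + 'i%C *: V') + (U' + 'i%C *: V') *m (U + 'i%C *: V)
   = (U *m U' + U' *m U) + 'i%C *: (U *m V' + V' *m U)
   + 'i%C *: (V *m U' + U' *m V) + ('i%C * 'i%C) *: (V *m V' + V' *m V).
  rewrite !mulmxDl !mulmxDr -!scalemxAl -!scalemxAr !scalerDr !scalerA.
  move: (U *m U') (U' *m U) (V *m V') (V' *m V) => p1 p2 p3 p4.
  move: ('i%C *: (U *m V')) ('i%C *: (V' *m U)) ('i%C *: (V *m U')) ('i%C *: (U' *m V)).
  move=> q1 q2 q3 q4; move: (_ *: p3) (_ *: p4) => p5 p6.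
  by apply/matrixP=> i j; rewrite !mxE; ring.
have SL U V : S (U + 'i%C *: V) = S U + 'i%C *: S V by rewrite SD SZ.
rewrite (SL A B) (SL A' B') !eE [LHS]SD SZ !SL.
by rewrite (hmul _ _ hA hA') (hmul _ _ hA hB') (hmul _ _ hB hA') (hmul _ _ hB hB').
Qed.

(** Row [i] of [W] comes from a unitary diagonalising [S (D i)]. Unitarity of [W] follows from the
    images summing to the identity, without comparing rows. *)
Lemma frame_diag : exists2 W, unitary W & forall i, S (D i) = uconj W (D i).
Proof.
have [h1 h2] := S_frame (@unitary1 R n).
have u1 X : uconj 1%:M X = X by rewrite /uconj adjmx1 mulmx1 mul1mx.
have /choice[f hf] : forall i, exists t : 'M[C]_n * 'I_n,
    unitary t.1 /\ S (D i) = uconj t.1 (D t.2).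
  by move=> i; have [V [j hV]] := rank1_diag (h1 i); rewrite u1 in hV; exists (V, j).
pose W : 'M[C]_n := \matrix_(i, a) (f i).1 (f i).2 a.
have entry V j a b : uconj V (D j) a b = Num.conj (V j a) * V j b.
  rewrite /uconj mxE (bigD1 j) //= big1 ?addr0 => [|c cj].
    rewrite mxE (bigD1 j) //= big1 ?addr0 => [|d dj].
      by rewrite !mxE !eqxx mulr1.
    by rewrite [X in _ * X]mxE (negbTE dj) mulr0.
  by rewrite mxE big1 ?mul0r // => d _; rewrite [X in _ * X]mxE (negbTE cj) andbF mulr0.
have SW i : S (D i) = uconj W (D i).
  by have [_ ->] := hf i; apply/matrixP=> a b; rewrite !entry !mxE.
exists W => //.
have sumD : \sum_i D i = 1%:M.
  apply/matrixP=> a b; rewrite summxE !mxE (bigD1 a) //= mxE eqxx /= big1 ?addr0.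
    by rewrite eq_sym.
  by move=> i ia; rewrite mxE eq_sym (negbTE ia).
rewrite /unitary; have <- : uconj W 1%:M = adjmx W *m W by rewrite /uconj mulmx1.
rewrite -{1}sumD uconj_sum -[RHS]S_one -sumD (big_morph S SD S0).
by apply: eq_bigr => i _; rewrite SW.
Qed.

Lemma frame_preserver_form : (1 < n)%N -> exists2 W, unitary W &
  (forall X, S X = uconj W X) \/ (forall X, S X = uconj W X^T).
Proof.
move=> n1; have [W hW SW] := frame_diag; have hW' := unitary_adj hW.
pose S2 X := uconj (adjmx W) (S X).
have S2_js : jordan_star S2 by apply: js_uconj hW' frame_jordan.
have S2_diag i : S2 (D i) = D i by rewrite /S2 SW uconjK.
have SE X : S X = uconj W (S2 X) by rewrite /S2 uconjKV.
pose i0 : 'I_n := Ordinal (ltnW n1); pose i1 : 'I_n := Ordinal n1.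
have i01 : i0 != i1 by [].
(* By [js_norm] the two coefficients of this unit are not both zero; if the straight one vanishes,
   precomposition with the transpose exchanges them. *)
have [p0|p0] := eqVneq (S2 (delta_mx i0 i1) i0 i1) 0; last first.
  have [V hV VE] := js_straight S2_js S2_diag i01 p0.
  exists (V *m W); first exact: unitaryM.
  by left=> X; rewrite SE VE uconj_comp.
pose S3 X := S2 X^T.
have S3_js : jordan_star S3 by apply: js_tr.
have S3_diag i : S3 (D i) = D i by rewrite /S3 trmx_delta.
have q0 : S3 (delta_mx i0 i1) i0 i1 != 0.
  rewrite /S3 trmx_delta; have := js_norm S2_js S2_diag i01; rewrite p0 mul0r add0r => h.
  have [_ qc] := js_conj S2_js i0 i1.
  rewrite qc conjC_eq0; apply: contra_eq_neq h => ->.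
  by rewrite mul0r eq_sym oner_eq0.
have [V hV VE] := js_straight S3_js S3_diag i01 q0.
exists (V *m W); first exact: unitaryM.
by right=> X; rewrite SE -uconj_comp -VE /S3 trmxK.
Qed.

End Wigner.

(** * Invariance and special values of the k-numerical radius *)

Lemma norm_add_cancel (F : realFieldType) (a z : F) : a != 0 -> `|a + z| = `|z| ->
  a = - (2 * z).
Proof.
move=> a0 /eqP; rewrite eqr_norm2 => /orP[/eqP h|/eqP h]; last by lra.
by case/eqP: a0; lra.
Qed.

Section NormInvariance.
Variable R : realType.
Local Notation C := R[i].
Variables (n k : nat).
Implicit Types (A B E F P Q X Y U : 'M[C]_n).
Hypotheses (k_gt0 : (0 < k)%N) (lt_kn : (k < n)%N).

Lemma wk_uconj U A : unitary U -> is_herm A -> wk k (uconj U A) = wk k A.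
Proof.
move=> hU hA; have [ub [Q hQ hw]] := wkP lt_kn hA.
have hU' := unitary_adj hU.
apply: wk_unique; [exact: lt_kn|exact: uconj_herm| |].
  move=> P hP; rewrite -(uconjKV P hU) -(uconjM _ _ hU) /rtr (uconj_tr _ hU).
  by apply: ub; apply: uconj_proj.
exists (uconj U Q); first exact: uconj_proj.
by rewrite -(uconjM _ _ hU) /rtr (uconj_tr _ hU).
Qed.

Lemma herm_tr A : is_herm A -> is_herm A^T.
Proof. by move=> hA; rewrite /is_herm adjmx_tr hA. Qed.

Lemma proj_tr P : rank_proj k P -> rank_proj k P^T.
Proof.
move=> [h1 [h2 h3]]; split; first exact: herm_tr.
by rewrite -trmx_mul h2 mxtrace_tr.
Qed.

Lemma wk_tr A : is_herm A -> wk k A^T = wk k A.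
Proof.
move=> hA; have [ub [Q hQ hw]] := wkP lt_kn hA.
have tE P : rtr (A^T *m P) = rtr (A *m P^T).
  by rewrite /rtr -mxtrace_tr trmx_mul trmxK mxtrace_mulC.
apply: wk_unique; [exact: lt_kn|exact: herm_tr| |].
  by move=> P hP; rewrite tE; apply/ub/proj_tr.
by exists Q^T; [exact: proj_tr|rewrite tE trmxK].
Qed.

Lemma wk_ge0 A : is_herm A -> 0 <= wk k A.
Proof. by move=> hA; have [_ [Q _ <-]] := wkP lt_kn hA. Qed.

Lemma wk_le_add A B : is_herm A -> is_herm B -> wk k (A + B) <= wk k A + wk k B.
Proof.
move=> hA hB; have [ubA _] := wkP lt_kn hA; have [ubB _] := wkP lt_kn hB.
have [_ [Q hQ <-]] := wkP lt_kn (hermD hA hB).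
rewrite mulmxDl rtrD; apply: le_trans (ler_normD _ _) _.
by apply: lerD; [apply: ubA|apply: ubB].
Qed.

Lemma wk_eq0_scalar A : is_herm A -> wk k A = 0 -> exists a, A = a%:M.
Proof.
move=> hA w0; apply: (commute_all_scalar k_gt0 lt_kn) => P hP.
apply: (norming_comm lt_kn hA hP); have [ub _] := wkP lt_kn hA.
by rewrite w0; apply/eqP; rewrite eq_le normr_ge0 andbT -w0; apply: ub.
Qed.

(** For [n = 2k] the complement of a norming [Q] also has rank [k] and gives the opposite trace on
    [A]; one of the two matches the sign of [t]. *)
Lemma wk_traceless_shift A (t : R) : n = (2 * k)%N -> is_herm A -> \tr A = 0 ->
  wk k (A + rscale t 1%:M) = wk k A + k%:R * `|t|.
Proof.
move=> nk hA trA; have [ub [Q hQ hw]] := wkP lt_kn hA.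
have h1 : is_herm (rscale t 1%:M : 'M[C]_n) by apply/herm_rscale/herm1.
have tE P : rank_proj k P -> rtr ((A + rscale t 1%:M) *m P) = rtr (A *m P) + k%:R * t.
  by move=> hP; rewrite mulmxDl rtrD -scalemxAl rtrZ (rtr1_proj hP) mulrC.
have ktE : `|k%:R * t| = k%:R * `|t| by rewrite normrM normr_nat.
apply: wk_unique; [exact: lt_kn|exact: hermD| |].
  move=> P hP; rewrite (tE _ hP) -ktE; apply: le_trans (ler_normD _ _) _.
  by rewrite lerD2r; apply: ub.
have hQc : rank_proj k (1%:M - Q).
  have [q1 [q2 q3]] := hQ; split; first by rewrite adjmxB adjmx1 q1.
  split; first by rewrite mulmxBr mulmx1 mulmxBl mul1mx q2 subrr subr0.
  have nE : n%:R = k%:R + k%:R :> C by rewrite -natrD addnn -mul2n -nk.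
  by rewrite raddfB /= mxtrace1 q3 nE addrK.
have qcE : rtr (A *m (1%:M - Q)) = - rtr (A *m Q).
  by rewrite mulmxBr mulmx1 rtrB /rtr trA sub0r.
have abs_same (x y : R) : (0 <= x) = (0 <= y) -> `|x + y| = `|x| + `|y|.
  case: (ger0P y) => hy; case: (ger0P x) => hx // _.
    by rewrite ger0_norm ?addr_ge0.
  by rewrite ltr0_norm ?ltr_nDl ?opprD // ltW.
have [same|diff] := boolP ((0 <= rtr (A *m Q)) == (0 <= k%:R * t)).
  by exists Q; [exact: hQ|rewrite (tE _ hQ) (abs_same _ _ (eqP same)) hw ktE].
exists (1%:M - Q); first exact: hQc.
rewrite (tE _ hQc) qcE -ktE -hw -(normrN (rtr (A *m Q))).
have [q0|q0] := eqVneq (rtr (A *m Q)) 0; first by rewrite q0 oppr0 normr0 !add0r.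
apply: abs_same; rewrite oppr_ge0.
move: diff; case: (ltgtP 0 (rtr (A *m Q))) q0 => //; by case: (0 <= k%:R * t).
Qed.

Lemma rtr_rank1_bounds E Q : rank_proj 1 E -> rank_proj k Q ->
  0 <= rtr (E *m Q) /\ rtr (E *m Q) <= 1.
Proof.
move=> [e1 [e2 e3]] [q1 [q2 q3]].
have h0 Y : is_herm Y -> Y *m Y = Y -> 0 <= rtr (E *m Y).
  move=> y1 y2; suff -> : rtr (E *m Y) = rtr ((E *m Y) *m adjmx (E *m Y)) by apply: rtr_sq_ge0.
  by rewrite adjmxM e1 y1 mulmxA -(mulmxA E) y2 [in RHS]rtrC mulmxA e2.
split; first exact: h0.
have [c1 c2] := projectionC (conj q1 q2).
have := h0 _ c1 c2; rewrite mulmxBr mulmx1 rtrB subr_ge0.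
by rewrite {2}/rtr e3.
Qed.

Lemma rank1_extremes E : rank_proj 1 E ->
  (exists2 Q, rank_proj k Q & rtr (E *m Q) = 1) /\
  (exists2 Q, rank_proj k Q & rtr (E *m Q) = 0).
Proof.
move=> /rank1_diag[V [i [hV ->]]].
have [j _ ji] : exists2 j : 'I_n, True & i != j.
  have : (0 < #|~: [set i]|)%N.
    by rewrite cardsCs finset.setCK card_ord cards1 subn_gt0 (leq_ltn_trans k_gt0).
  by move=> /card_gt0P[j]; rewrite !inE eq_sym => h; exists j.
have [S [cS iS jS]] := subset_avoiding k_gt0 lt_kn ji.
have qE (S' : {set 'I_n}) : rtr (uconj V (delta_mx i i) *m uconj V (rdiag (fun l => (l \in S')%:R)))
    = (i \in S')%:R :> R.
  rewrite -(uconjM _ _ hV) /rtr (uconj_tr _ hV) /rdiag mul_mx_diag /mxtrace.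
  rewrite (bigD1 i) //= big1 ?addr0 => [|l li]; last by rewrite !mxE (negbTE li) mul0r.
  by rewrite !mxE !eqxx mul1r.
have card1 (l : 'I_n) : l \notin S -> #|l |: S| = k by move=> lS; rewrite cardsU1 lS cS add1n prednK.
split.
  exists (uconj V (rdiag (fun l => (l \in i |: S)%:R))).
    by apply: uconj_proj hV _; apply/rdiag_proj/card1.
  by rewrite qE !inE eqxx.
exists (uconj V (rdiag (fun l => (l \in j |: S)%:R))).
  by apply: uconj_proj hV _; apply/rdiag_proj/card1.
by rewrite qE !inE (negbTE ji) (negbTE iS).
Qed.

Lemma rank1_plane_rtr E Q (x y : R) : rank_proj k Q ->
  rtr ((rscale x E + rscale y 1%:M) *m Q) = x * rtr (E *m Q) + k%:R * y.
Proof.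
by move=> hQ; rewrite mulmxDl rtrD -!scalemxAl !rtrZ (rtr1_proj hQ) [y * _]mulrC.
Qed.

Lemma plane_norm_le (q x y : R) : 0 <= q -> q <= 1 ->
  `|x * q + y| <= `|x + y| \/ `|x * q + y| <= `|y|.
Proof.
move=> q0 q1; have [h|h] := lerP `|x * q + y| `|y|; [by right|left].
have : `|x * q + y| <= q * `|x + y| + (1 - q) * `|y|.
  have -> : x * q + y = q * (x + y) + (1 - q) * y by ring.
  apply: le_trans (ler_normD _ _) _.
  by rewrite !normrM (ger0_norm q0) (@ger0_norm _ (1 - q)) ?subr_ge0.
move: `|x * q + y| `|x + y| `|y| h => u w v h h'.
have h2 : (1 - q) * v <= (1 - q) * u by rewrite ler_wpM2l ?subr_ge0 // ltW.
have [q00|q00] := eqVneq q 0; first by move: h'; rewrite q00; lra.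
have qp : 0 < q by rewrite lt_neqAle eq_sym q00.
by rewrite -(ler_pM2l qp); lra.
Qed.

(* [E - (2k)^-1 I] is equidistant from the two norming faces of the plane
   spanned by [E] and [I], hence parallel to the whole plane. *)
Lemma balanced_parallel E (x y : R) : rank_proj 1 E ->
  parallel_k k (rscale 1 E + rscale (- (2 * k%:R)^-1) 1%:M) (rscale x E + rscale y 1%:M).
Proof.
move=> hE; have [hE1 _] := hE.
have hpl (u v : R) : is_herm (rscale u E + rscale v 1%:M).
  by apply: hermD; apply: herm_rscale; [exact: hE1|exact: herm1].
have k0 : k%:R != 0 :> R by rewrite pnatr_eq0 -lt0n.
apply/parallel_norming; [exact: lt_kn|exact: hpl|exact: hpl|].
have half : k%:R * - (2 * k%:R)^-1 = - 2^-1 :> R by field.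
have [[Q1 hQ1 q1] [Q0 hQ0 q0]] := rank1_extremes hE.
have vE Q : rank_proj k Q -> rtr ((rscale 1 E + rscale (- (2 * k%:R)^-1) 1%:M) *m Q)
    = rtr (E *m Q) - 2^-1 by move=> hQ; rewrite (rank1_plane_rtr _ _ _ hQ) half mul1r.
have h2 : `|- 2^-1| = 2^-1 :> R by rewrite normrN ger0_norm ?invr_ge0.
have wv : wk k (rscale 1 E + rscale (- (2 * k%:R)^-1) 1%:M) = 2^-1.
  apply: wk_unique; [exact: lt_kn|exact: hpl| |].
    move=> Q hQ; rewrite (vE _ hQ); have [] := rtr_rank1_bounds hE hQ.
    by move: (rtr _) => q l u; rewrite ler_norml; apply/andP; split; lra.
  by exists Q0; [exact: hQ0|rewrite (vE _ hQ0) q0 sub0r].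
have [ub _] := wkP lt_kn (hpl x y); rewrite wv.
have [_ [Q hQ hw]] := wkP lt_kn (hpl x y).
have [b0 b1] := rtr_rank1_bounds hE hQ.
rewrite (rank1_plane_rtr _ _ _ hQ) in hw.
have [h|h] := plane_norm_le x (k%:R * y) b0 b1.
  exists Q1; first exact: hQ1.
  apply: conj.
    rewrite (vE _ hQ1) q1.
    by have -> : 1 - 2^-1 = 2^-1 :> R; [field|rewrite ger0_norm ?invr_ge0].
  apply/eqP; rewrite eq_le ub //= -hw (rank1_plane_rtr _ _ _ hQ1) q1 mulr1.
  exact: h.
exists Q0; first exact: hQ0.
apply: conj; first by rewrite (vE _ hQ0) q0 sub0r; exact: h2.
apply/eqP; rewrite eq_le ub //= -hw (rank1_plane_rtr _ _ _ hQ0) q0 mulr0 add0r.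
exact: h.
Qed.

Lemma balanced_unique F (a b : R) : rank_proj 1 F -> a != 0 ->
  (forall x y, parallel_k k (rscale a F + rscale b 1%:M) (rscale x F + rscale y 1%:M)) ->
  b = - a / (2 * k%:R).
Proof.
move=> hF a0 hpar; have [hF1 _] := hF.
have hpl (u v : R) : is_herm (rscale u F + rscale v 1%:M).
  by apply: hermD; apply: herm_rscale; [exact: hF1|exact: herm1].
have k0 : k%:R != 0 :> R by rewrite pnatr_eq0 -lt0n.
have [[Q1 hQ1 q1] [Q0 hQ0 q0]] := rank1_extremes hF.
have [ub _] := wkP lt_kn (hpl a b).
have ub1 := ub _ hQ1; have ub0 := ub _ hQ0.
rewrite (rank1_plane_rtr _ _ _ hQ1) q1 mulr1 in ub1.
rewrite (rank1_plane_rtr _ _ _ hQ0) q0 mulr0 add0r in ub0.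
(* Two probes: [F] is normed only where its trace [q] is 1, and [- F + I / k], of value [1 - q],
   only where [q] is 0. Both faces therefore norm the given matrix, whence [|a + k b| = |k b|]. *)
have /(parallel_norming lt_kn (hpl a b) (hpl 1 0))[P hP [e1 e2]] := hpar 1 0.
have /(parallel_norming lt_kn (hpl a b) (hpl (-1) (k%:R^-1)))[P' hP' [e1' e2']] := hpar (-1) (k%:R^-1).
have [ubF _] := wkP lt_kn (hpl 1 0); have [ubF' _] := wkP lt_kn (hpl (-1) (k%:R^-1)).
have h := ubF _ hQ1.
rewrite -e2 (rank1_plane_rtr _ _ _ hQ1) (rank1_plane_rtr _ _ _ hP) q1 mulr0 !addr0 !mul1r normr1 in h.
have h' := ubF' _ hQ0.
rewrite -e2' (rank1_plane_rtr _ _ _ hQ0) (rank1_plane_rtr _ _ _ hP') q0 mulr0 add0r divff // normr1 mulN1r in h'.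
have [b0 b1] := rtr_rank1_bounds hF hP; have [b0' b1'] := rtr_rank1_bounds hF hP'.
rewrite (rank1_plane_rtr _ _ _ hP) in e1; rewrite (rank1_plane_rtr _ _ _ hP') in e1'.
move: (rtr (F *m P)) (rtr (F *m P')) b0 b1 b0' b1' e1 e1' h h' => q q' b0 b1 b0' b1' e1 e1' h h'.
have qE : q = 1 by apply/eqP; rewrite eq_le b1; rewrite (ger0_norm b0) in h.
have qE' : q' = 0.
  have q1' : 0 <= - q' + 1 by rewrite addrC subr_ge0.
  by apply/eqP; rewrite eq_le b0' andbT; rewrite (ger0_norm q1') lerDr oppr_ge0 in h'.
rewrite qE mulr1 in e1; rewrite qE' mulr0 add0r in e1'.
have /eqP : `|a + k%:R * b| = `|k%:R * b|.
  by apply/eqP; rewrite eq_le; apply/andP; split; [rewrite e1'|rewrite e1].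
move=> /eqP/(norm_add_cancel a0) ->.
by field.
Qed.

End NormInvariance.

(** * Unital preservers in dimension above two *)

Lemma dimension_eq (F : numFieldType) (a N K : F) : K != 0 -> a != 1 ->
  1 = a + (1 - a) / (2 * K) * N -> N == 2 * K.
Proof.
move=> K0 a1 e; have a1' : 1 - a != 0 by rewrite subr_eq0 eq_sym.
have K2 : 2 * K != 0 by rewrite mulf_neq0 // pnatr_eq0.
apply/eqP/(mulfI a1')/(mulIf (invr_neq0 K2)); rewrite mulfK //.
by rewrite mulrAC; apply: (addrI a); rewrite -e addrC subrK.
Qed.

Section Forward.
Variable R : realType.
Local Notation C := R[i].
Variables (n k : nat).
Implicit Types (A B E F P Q X Y U V : 'M[C]_n).
Hypotheses (k_gt0 : (0 < k)%N) (lt_kn : (k < n)%N).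
Local Notation D i := (delta_mx i i : 'M[C]_n).
Local Notation rC x := ((x%:C)%C : C).
Variable T : 'M[C]_n -> 'M[C]_n.
Hypothesis T_lin : herm_real_linear T.
Hypothesis T_bij : herm_bijective T.
Hypothesis T_par : forall A B, is_herm A -> is_herm B ->
  parallel_k k A B -> parallel_k k (T A) (T B).
Hypothesis T_one : T 1%:M = 1%:M.

Lemma unital_commutant_preserver : commutant_preserver k (complexify T).
Proof.
have [inj surj] := T_bij; split.
- by move=> a X Y; rewrite complexifyD // complexifyZ.
- exact: complexify_inj.
- move=> Y; have [A hA TA] := surj _ (reh_herm Y); have [B hB TB] := surj _ (imh_herm Y).
  exists (A + 'i%C *: B); rewrite (complexifyE T hA hB) TA TB.
  exact/esym/cartesianE.
- exact: complexify_adj.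
- by rewrite (complexify_herm T_lin (@herm1 R n)) T_one.
move=> P hP; have [Q hQ h] := commutant_image k_gt0 lt_kn T_lin inj T_par hP.
by exists Q.
Qed.

Lemma parallel_plane E F (a b : R) : rank_proj 1 E -> rank_proj 1 F -> a != 0 ->
  T E = rscale a F + rscale b 1%:M -> b = (1 - a) / (2 * k%:R).
Proof.
move=> hE hF a0 TE; have [hE1 _] := hE; have [hF1 _] := hF.
have hs (u : R) X : is_herm X -> is_herm (rscale u X) by exact: herm_rscale.
have h1 := @herm1 R n.
have Tpl (u v : R) : T (rscale u E + rscale v 1%:M) = rscale (u * a) F + rscale (u * b + v) 1%:M.
  rewrite (T_add T_lin (hs _ _ hE1) (hs _ _ h1)) (T_scale T_lin _ hE1) (T_scale T_lin _ h1).
  by rewrite T_one TE rscaleDr !rscaleA -addrA -rscaleD.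
have hpl (u v : R) : is_herm (rscale u E + rscale v 1%:M).
  by apply: hermD; apply: hs.
(* [T] carries the plane of [E] and the identity onto that of [F] and the identity, so the balanced
   matrix has an image parallel to a whole plane. The arguments [x / a] and [y - x / a * b] invert
   this map of planes. *)
have key x y : parallel_k k (rscale a F + rscale (b - (2 * k%:R)^-1) 1%:M)
    (rscale x F + rscale y 1%:M).
  have aux X1 X2 Y1 Y2 : is_herm X1 -> is_herm X2 -> parallel_k k X1 X2 ->
      T X1 = Y1 -> T X2 = Y2 -> parallel_k k Y1 Y2.
    by move=> g1 g2 h <- <-; apply: T_par.
  apply: (aux _ _ _ _ (hpl _ _) (hpl _ _)
    (balanced_parallel k_gt0 lt_kn (x / a) (y - x / a * b) hE)).
    by rewrite Tpl !mul1r.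
  by rewrite Tpl (divfK a0) [_ + (_ - _)]addrC (subrK (x / a * b)).
have := balanced_unique k_gt0 lt_kn hF a0 key => /eqP.
by rewrite subr_eq => /eqP ->; rewrite mulrBl mul1r addrC mulNr.
Qed.

Lemma unital_form : (2 < n)%N -> exists (a : R) W, [/\ a != 0, unitary W,
    a = 1 \/ n = (2 * k)%N &
    (forall A, is_herm A -> T A = rscale a (uconj W A) +
        ((1 - a) / (2 * k%:R))%:C%C * \tr A *: 1%:M) \/
    (forall A, is_herm A -> T A = rscale a (uconj W A^T) +
        ((1 - a) / (2 * k%:R))%:C%C * \tr A *: 1%:M)].
Proof.
move=> n2; have cp := unital_commutant_preserver.
have [a [be [S [a0 LE S_lin S_adj [S_one S_frame]]]]] := cp_decompose cp k_gt0 lt_kn n2.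
have [W hW SW] := frame_preserver_form S_lin S_adj S_one S_frame (ltnW n2).
set g := (1 - a) / (2 * k%:R).
have i0 : 'I_n by exists 0%N; apply: leq_ltn_trans lt_kn.
have hD V i : unitary V -> rank_proj 1 (uconj V (D i)).
  by move=> hV; apply: uconj_proj hV (delta_proj1 _ _).
have LD V i : unitary V ->
    complexify T (uconj V (D i)) = rC a *: S (uconj V (D i)) + rC g *: 1%:M.
  move=> hV; have hE := hD V i hV; have [hF _] := S_frame V hV; have hFi := hF i.
  rewrite LE; congr (_ + _ *: _).
  have hE1 := proj1 hE.
  have TE : T (uconj V (D i)) = rscale a (S (uconj V (D i))) + be (uconj V (D i)) *: 1%:M.
    by rewrite -(complexify_herm T_lin hE1) LE.
  have be_real : be (uconj V (D i)) = rC (complex.Re (be (uconj V (D i)))).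
    rewrite RRe_real //; apply/CrealP.
    have := T_herm T_lin hE1; rewrite TE /is_herm adjmxD.
    rewrite (herm_rscale a (proj1 hFi)) adjmxZ adjmx1 => /addrI/matrixP/(_ i0 i0).
    by rewrite !mxE eqxx !mulr1.
  rewrite be_real in TE *; congr real_complex_def.
  exact: parallel_plane hE hFi a0 TE.
have S0 : S 0 = 0 by have := S_lin (-1) 0 0; rewrite scaler0 addr0 scaleN1r addNr.
have SD X Y : S (X + Y) = S X + S Y by have := S_lin 1 X Y; rewrite !scale1r.
have SZ b X : S (b *: X) = b *: S X by have := S_lin b X 0; rewrite S0 !addr0.
have TE A : is_herm A -> T A = rC a *: S A + rC g * \tr A *: 1%:M.
  move=> hA; rewrite -(complexify_herm T_lin hA).
  have [V [d [hV ->]]] := herm_spectral hA.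
  rewrite rdiag_sum uconj_sum (cp_sum cp) (big_morph S SD S0) scaler_sumr.
  rewrite raddf_sum /= mulr_sumr scaler_suml -big_split; apply: eq_bigr => i _ /=.
  rewrite uconjZ (cpZ cp) (LD V i hV) SZ mxtraceZ.
  have [_ [_ ->]] := hD V i hV.
  by rewrite mulr1 scalerDr !scalerA [rC a * _]mulrC [rC g * _]mulrC.
exists a, W; split=> //; last first.
  by case: SW => SW; [left|right] => A hA; rewrite TE // /rscale SW.
(* At the identity the formula reads [1 = a + (1 - a) n / (2k)], which leaves only [a = 1] or
   [n = 2k]. *)
have := TE _ (@herm1 R n); rewrite T_one S_one mxtrace1.
move=> /matrixP/(_ i0 i0); rewrite !mxE eqxx !mulr1.
rewrite -[n%:R](rmorph_nat (real_complex R)) -rmorphM -rmorphD -[1 in X in X -> _](rmorph1 (real_complex R)).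
move=> /complexI e.
have [a1|a1] := eqVneq a 1; [by left|right].
apply/eqP; rewrite -(eqr_nat R) natrM; apply: (dimension_eq _ a1 e).
by rewrite pnatr_eq0 -lt0n.
Qed.

End Forward.

(** * The case n = 2k *)

Section HalfDimension.
Variable R : realType.
Local Notation C := R[i].
Variables (n k : nat).
Implicit Types (A B P Q X Y U V : 'M[C]_n).
Hypotheses (k_gt0 : (0 < k)%N) (lt_kn : (k < n)%N).

Let nR : n%:R != 0 :> R.
Proof. by rewrite pnatr_eq0 -lt0n (leq_ltn_trans (leq0n k) lt_kn). Qed.

Definition tracepart A := rtr A / n%:R.

Lemma traceless_part A : is_herm A ->
  exists A0, [/\ is_herm A0, \tr A0 = 0 & A = A0 + rscale (tracepart A) 1%:M].
Proof.
move=> hA; exists (A - rscale (tracepart A) 1%:M).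
have h1 : is_herm (rscale (tracepart A) 1%:M : 'M[C]_n) by apply/herm_rscale/herm1.
have hB : is_herm (A - rscale (tracepart A) 1%:M) by apply/hermD/hermN.
split; [exact: hB| |by rewrite subrK].
have r1 : rtr (1%:M : 'M[C]_n) = n%:R by rewrite /rtr mxtrace1 Re_nat.
by rewrite (rtr_herm hB) rtrB rtrZ /tracepart r1 (divfK nR) subrr.
Qed.

Lemma scalar_tr (a : R) : \tr (rscale a 1%:M : 'M[C]_n) = (a * n%:R)%:C%C.
Proof. by rewrite mxtraceZ mxtrace1 rmorphM rmorph_nat. Qed.

Lemma traceless_scalar0 A a : A = a%:M -> \tr A = 0 -> A = 0.
Proof.
move=> -> /eqP; rewrite mxtrace_scalar -mulr_natr mulf_eq0 => /orP[/eqP->|].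
  by rewrite raddf0.
by rewrite pnatr_eq0 => /eqP n0; move: lt_kn; rewrite n0.
Qed.

Lemma TEA_scale (a : R) A B : a != 0 -> is_herm A -> is_herm B ->
  TEA_k k (rscale a A) (rscale a B) <-> TEA_k k A B.
Proof.
move=> a0 hA hB; rewrite /TEA_k -rscaleDr.
rewrite !wk_rscale //; last exact: hermD.
rewrite -mulrDr; split=> [|->//]; apply: mulfI.
by rewrite normr_eq0.
Qed.

Hypothesis nk : n = (2 * k)%N.

(** By [wk_traceless_shift] the radius is a traceless contribution plus a scalar one, both
    subadditive; equality of the totals forces equality in each. *)
Lemma traceless_split (a b x y : R) A B : is_herm A -> is_herm B -> \tr A = 0 -> \tr B = 0 ->
  TEA_k k (A + rscale x 1%:M) (B + rscale y 1%:M) <->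
  TEA_k k A B /\ `|x + y| = `|x| + `|y|.
Proof.
move=> hA hB tA tB; rewrite /TEA_k.
have -> : A + rscale x 1%:M + (B + rscale y 1%:M) = (A + B) + rscale (x + y) 1%:M.
  by rewrite addrACA rscaleD.
have tAB : \tr (A + B) = 0 by rewrite mxtraceD tA tB addr0.
rewrite (wk_traceless_shift lt_kn _ nk (hermD hA hB) tAB).
rewrite (wk_traceless_shift lt_kn _ nk hA tA) (wk_traceless_shift lt_kn _ nk hB tB).
rewrite addrACA -mulrDr.
have kR : k%:R != 0 :> R by rewrite pnatr_eq0 -lt0n.
split=> [h|[-> ->//]].
have h1 := wk_le_add lt_kn hA hB.
have h2 : k%:R * `|x + y| <= k%:R * (`|x| + `|y|) by rewrite ler_wpM2l // ler_normD.
have [|-> /(mulfI kR) ->//] := norming_sum h1 h2.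
by rewrite h.
Qed.

Lemma TEA_unital (M : 'M[C]_n -> 'M[C]_n) : herm_real_linear M -> M 1%:M = 1%:M ->
  (forall A, is_herm A -> \tr A = 0 -> \tr (M A) = 0) ->
  (forall A B, is_herm A -> is_herm B -> \tr A = 0 -> \tr B = 0 ->
     TEA_k k A B -> TEA_k k (M A) (M B)) ->
  forall A B, is_herm A -> is_herm B -> TEA_k k A B -> TEA_k k (M A) (M B).
Proof.
move=> M_lin M1 M_tr M_TEA A B /traceless_part[A0 [hA tA ->]] /traceless_part[B0 [hB tB ->]].
move: (tracepart A) (tracepart B) => x y.
have h1 := @herm1 R n.
have ME X t : is_herm X -> M (X + rscale t 1%:M) = M X + rscale t 1%:M.
  move=> hX; rewrite (T_add M_lin hX (herm_rscale t h1)) (T_scale M_lin t h1).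
  by rewrite M1.
move=> /(traceless_split 0 0 x y hA hB tA tB)[hT hxy].
rewrite (ME _ _ hA) (ME _ _ hB).
apply/(traceless_split 0 0 x y (T_herm M_lin hA) (T_herm M_lin hB) (M_tr _ hA tA) (M_tr _ hB tB)).
by split; [apply: M_TEA|].
Qed.

(** Write [T A = A0 + t I] with [A0] traceless. The pair [A], [A - 2 t I] is parallel, with images
    [A0 + t I] and [A0 - t I]. Their sum loses the scalar parts and their difference the traceless
    ones, so [t = 0] or [A0 = 0]; in the latter case injectivity gives [A = t I], and again
    [t = 0]. *)
Lemma unital_trace (T : 'M[C]_n -> 'M[C]_n) : herm_real_linear T ->
  (forall A B, is_herm A -> is_herm B -> T A = T B -> A = B) ->
  (forall A B, is_herm A -> is_herm B -> parallel_k k A B -> parallel_k k (T A) (T B)) ->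
  T 1%:M = 1%:M -> forall A, is_herm A -> \tr A = 0 -> \tr (T A) = 0.
Proof.
move=> T_lin T_inj T_par T1 A hA tA.
have h1 := @herm1 R n.
have hs (u : R) X : is_herm X -> is_herm (rscale u X) by exact: herm_rscale.
have [A0 [hA0 tA0 TAE]] := traceless_part (T_herm T_lin hA).
move: (tracepart (T A)) TAE => t TAE.
suff t0 : t = 0 by rewrite TAE t0 rscale0 addr0.
have kR : 0 < k%:R :> R by rewrite ltr0n.
have par1 : parallel_k k A (A + rscale (- (2 * t)) 1%:M).
  exists 1; split; first by left.
  have -> : A + rscale 1 (A + rscale (- (2 * t)) 1%:M) = rscale 2 A + rscale (- (2 * t)) 1%:M.
    by rewrite rscale1 addrA -{1 2}(rscale1 A) -rscaleD.
  have t2A : \tr (rscale 2 A) = 0 by rewrite mxtraceZ tA mulr0.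
  rewrite (wk_traceless_shift lt_kn _ nk (hs _ _ hA) t2A) (wk_traceless_shift lt_kn _ nk hA tA).
  by rewrite (wk_rscale _ lt_kn hA) (gtr0_norm (ltr0Sn R 1)) mulrDl !mul1r addrA.
have hA' : is_herm (A + rscale (- (2 * t)) 1%:M) by apply: hermD hA (hs _ _ h1).
have TA' : T (A + rscale (- (2 * t)) 1%:M) = A0 + rscale (- t) 1%:M.
  rewrite (T_add T_lin hA (hs _ _ h1)) (T_scale T_lin _ h1) T1 TAE -addrA -rscaleD.
  by have -> : t + - (2 * t) = - t by ring.
have := T_par _ _ hA hA' par1; rewrite TA' TAE => -[mu [hmu e]].
have {e} := etrans e (congr2 +%R (wk_traceless_shift lt_kn t nk hA0 tA0)
  (wk_traceless_shift lt_kn (- t) nk hA0 tA0)).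
rewrite normrN; case: hmu => ->.
  have -> : A0 + rscale t 1%:M + rscale 1 (A0 + rscale (- t) 1%:M) = rscale 2 A0 + rscale 0 1%:M.
    by rewrite rscale1 addrACA -rscaleD subrr -{1 2}(rscale1 A0) -rscaleD.
  have t2A : \tr (rscale 2 A0) = 0 by rewrite mxtraceZ tA0 mulr0.
  rewrite (wk_traceless_shift lt_kn _ nk (hs _ _ hA0) t2A) (wk_rscale _ lt_kn hA0).
  rewrite (gtr0_norm (ltr0Sn R 1)) normr0 mulr0 addr0 => h.
  have : k%:R * `|t| = 0 by move: (wk k A0) (k%:R * `|t|) h => u v h; lra.
  by move=> /eqP; rewrite mulf_eq0 (gt_eqF kR) normr_eq0 => /eqP.
have -> : A0 + rscale t 1%:M + rscale (-1) (A0 + rscale (- t) 1%:M) = 0 + rscale (2 * t) 1%:M.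
  rewrite rscaleDr addrACA rscaleA -rscaleD rscaleN1 subrr; congr (_ + rscale _ _).
  by ring.
rewrite (wk_traceless_shift lt_kn _ nk (@adjmx0 R n) (raddf0 _)).
have -> : wk k (0 : 'M[C]_n) = 0.
  by rewrite -(rscale0 A0) (wk_rscale _ lt_kn hA0) normr0 mul0r.
rewrite normrM (gtr0_norm (ltr0Sn R 1)) add0r => h.
have w0 : wk k A0 = 0 by move: (wk k A0) `|t| (k%:R : R) h => u v w h; lra.
have [a Aa] := wk_eq0_scalar k_gt0 lt_kn hA0 w0.
have A00 := traceless_scalar0 Aa tA0.
have AE : A = rscale t 1%:M.
  apply: (T_inj _ _ hA (hs _ _ h1)).
  by rewrite (T_scale T_lin _ h1) T1 TAE A00 add0r.
move: tA; rewrite AE scalar_tr => /(@complexI R)/eqP.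
by rewrite mulf_eq0 (negbTE nR) orbF => /eqP.
Qed.

End HalfDimension.

(** * Traceless matrices of size two *)

Section TwoByTwo.
Variable R : realType.
Local Notation C := R[i].
Implicit Types (A B Q V : 'M[C]_2).

(** In an eigenbasis of [Q], such an [A] is diagonal with opposite entries, and [Q + Q - 1%:M] is
    the reflection with entries 1 and -1. *)
Lemma traceless_commuting2 A Q : is_herm A -> \tr A = 0 -> rank_proj 1 Q ->
  A *m Q = Q *m A -> A = rscale (rtr (A *m Q)) (Q + Q - 1%:M).
Proof.
move=> hA tA hQ; have [V [i [hV QE]]] := rank1_diag hQ.
pose X := uconj (adjmx V) A.
have AE : A = uconj V X by rewrite /X uconjKV.
have hX : is_herm X by apply: uconj_herm.
clearbody X.
have tX : \tr X = 0 by rewrite -tA AE (uconj_tr _ hV).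
rewrite QE AE -!(uconjM _ _ hV) => /(congr1 (uconj (adjmx V))); rewrite !(uconjK _ hV) => cX.
rewrite /rtr (uconj_tr _ hV) -(uconj1 hV) -uconjD.
have uB Y Z : uconj V Y - uconj V Z = uconj V (Y - Z).
  by rewrite /uconj mulmxBr mulmxBl.
rewrite uB.
rewrite /rscale -uconjZ; congr uconj.
have mulr_delta a b : (X *m delta_mx i i) a b = X a i * (b == i)%:R.
  rewrite mxE (bigD1 i) //= big1 ?addr0 => [|l li]; rewrite [X in _ * X]mxE ?eqxx //.
  by rewrite (negbTE li) mulr0.
have mull_delta a b : (delta_mx i i *m X) a b = (a == i)%:R * X i b.
  rewrite mxE (bigD1 i) //= big1 ?addr0 => [|l li]; rewrite [X in X * _]mxE ?eqxx ?andbT //.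
  by rewrite (negbTE li) andbF mul0r.
have cE a b : X a i * (b == i)%:R = (a == i)%:R * X i b.
  by rewrite -mulr_delta cX mull_delta.
have trXE : \tr (X *m delta_mx i i) = X i i.
  rewrite /mxtrace (bigD1 i) //= big1 ?addr0 => [|j ji]; rewrite mulr_delta.
    by rewrite eqxx mulr1.
  by rewrite (negbTE ji) mulr0.
have Xii : (complex.Re (X i i))%:C%C = X i i.
  by rewrite RRe_real //; apply/CrealP; rewrite -adjmxE hX.
have two (a b : 'I_2) : a != i -> b != i -> a = b.
  move=> ai bi; apply/eqP; move: a b i ai bi {cE mulr_delta mull_delta trXE Xii cX hQ QE}.
  by do 3 case=> [[|[|?]] ?] //.
rewrite trXE Xii; apply/matrixP=> a b; rewrite !mxE.
have [->|ai] := eqVneq a i; have [->|bi] := eqVneq b i.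
- by rewrite ?eqxx /= addrK mulr1.
- have := cE i b; rewrite (negbTE bi) eqxx mulr0 mul1r => <-.
  by rewrite ?[i == b]eq_sym ?(negbTE bi) /= addr0 subrr mulr0.
- have := cE a i; rewrite (negbTE ai) eqxx mulr1 mul0r => ->.
  by rewrite ?(negbTE ai) /= addr0 subrr mulr0.
rewrite -(two a b ai bi) eqxx /= addr0 sub0r mulrN1.
apply/eqP; rewrite -addr_eq0 addrC -tX /mxtrace (bigD1 i) //= (bigD1 a) //= big1 ?addr0 //.
by move=> l /andP[li la]; rewrite (two l a li ai) eqxx in la.
Qed.

(** A common norming projection makes both matrices multiples of one reflection, with coefficients
    sharing the sign [s]; linear maps keep this relation. *)
Lemma TEA_traceless2 (M : 'M[C]_2 -> 'M[C]_2) A B : herm_real_linear M ->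
  is_herm A -> is_herm B -> \tr A = 0 -> \tr B = 0 -> TEA_k 1 A B -> TEA_k 1 (M A) (M B).
Proof.
move=> M_lin hA hB tA tB /(wk_add_norming (ltnSn 1) hA hB)[Q hQ [s [s1 eA eB]]].
have abs (x w : R) : 0 <= w -> s * x = w -> `|x| = w.
  by move=> w0 sx; rewrite -[LHS]mul1r -s1 -normrM sx ger0_norm.
have wA := wk_ge0 (ltnSn 1) hA; have wB := wk_ge0 (ltnSn 1) hB.
have nA := abs _ _ wA eA; have nB := abs _ _ wB eB.
have AE := traceless_commuting2 hA tA hQ (norming_comm (ltnSn 1) hA hQ nA).
have BE := traceless_commuting2 hB tB hQ (norming_comm (ltnSn 1) hB hQ nB).
move: (rtr (A *m Q)) (rtr (B *m Q)) eA eB nA nB AE BE => x y eA eB nA nB -> ->.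
have hN : is_herm (Q + Q - 1%:M).
  have [q _] := hQ; apply: hermD; last exact/hermN/herm1.
  exact: hermD.
have hMN := T_herm M_lin hN.
rewrite !(T_scale M_lin _ hN) /TEA_k -rscaleD !(wk_rscale _ (ltnSn 1) hMN) -mulrDl.
congr (_ * _); rewrite nA nB -eA -eB -mulrDr -[LHS]mul1r -s1 -normrM mulrDr eA eB.
by rewrite ger0_norm // addr_ge0.
Qed.

End TwoByTwo.

(** * Rescaling, isometries and the three implications *)

Section Scaling.
Variable R : realType.
Local Notation C := R[i].
Variables (n k : nat).
Implicit Types (A B P Q X Y U V : 'M[C]_n).
Hypotheses (k_gt0 : (0 < k)%N) (lt_kn : (k < n)%N).

Lemma rscale_linear (mu : R) (T : 'M[C]_n -> 'M[C]_n) : herm_real_linear T ->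
  herm_real_linear (fun A => rscale mu (T A)).
Proof.
move=> [h1 h2]; split=> [A hA|a b A B hA hB]; first exact/herm_rscale/h1.
rewrite (h2 a b A B hA hB) rscaleDr !rscaleA.
by rewrite ![mu * _]mulrC.
Qed.

Lemma rscaleK (mu : R) X : mu != 0 -> rscale mu^-1 (rscale mu X) = X.
Proof. by move=> mu0; rewrite rscaleA mulVf // rscale1. Qed.

Lemma rscale_bijective (mu : R) (T : 'M[C]_n -> 'M[C]_n) : mu != 0 ->
  herm_bijective T -> herm_bijective (fun A => rscale mu (T A)).
Proof.
move=> mu0 [inj surj]; split=> [A B hA hB h|B hB].
  by apply: inj => //; rewrite -(rscaleK (T A) mu0) h (rscaleK _ mu0).
have [A hA TA] := surj _ (herm_rscale mu^-1 hB); exists A; first exact: hA.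
by rewrite TA rscaleA mulfV // rscale1.
Qed.

Lemma parallel_rscale (mu : R) A B : is_herm A -> is_herm B ->
  parallel_k k A B -> parallel_k k (rscale mu A) (rscale mu B).
Proof.
move=> hA hB /(parallel_norming lt_kn hA hB)[Q hQ [e1 e2]].
apply/(parallel_norming lt_kn (herm_rscale mu hA) (herm_rscale mu hB)).
exists Q; first exact: hQ.
by split; rewrite -scalemxAl rtrZ normrM (wk_rscale _ lt_kn) // (e1, e2).
Qed.

Lemma TEA_isometry (f : 'M[C]_n -> 'M[C]_n) A B : is_herm A -> is_herm B ->
  (forall X, is_herm X -> wk k (f X) = wk k X) -> f (A + B) = f A + f B ->
  TEA_k k A B -> TEA_k k (f A) (f B).
Proof.
by move=> hA hB hf fD; rewrite /TEA_k -fD (hf _ hA) (hf _ hB) (hf _ (hermD hA hB)).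
Qed.

Lemma TEA_uconj U A B : unitary U -> is_herm A -> is_herm B ->
  TEA_k k A B -> TEA_k k (uconj U A) (uconj U B).
Proof.
move=> hU hA hB; apply: (TEA_isometry hA hB); last exact: uconjD.
by move=> X hX; apply: wk_uconj.
Qed.

Lemma TEA_uconj_tr U A B : unitary U -> is_herm A -> is_herm B ->
  TEA_k k A B -> TEA_k k (uconj U A^T) (uconj U B^T).
Proof.
move=> hU hA hB; apply: (@TEA_isometry (fun X => uconj U X^T) _ _ hA hB).
  by move=> X hX; rewrite (wk_uconj lt_kn hU (herm_tr hX)) wk_tr.
by rewrite raddfD /= uconjD.
Qed.

Lemma parallel_of_TEA_preserving (T : 'M[C]_n -> 'M[C]_n) : herm_real_linear T ->
  (forall A B, is_herm A -> is_herm B -> TEA_k k A B -> TEA_k k (T A) (T B)) ->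
  forall A B, is_herm A -> is_herm B -> parallel_k k A B -> parallel_k k (T A) (T B).
Proof.
move=> T_lin hT A B hA hB [mu [hmu e]]; exists mu; split; first exact: hmu.
have mu1 : `|mu| = 1 by case: hmu => ->; rewrite ?normrN1 ?normr1.
have hmB := herm_rscale mu hB.
have w X : is_herm X -> wk k (rscale mu X) = wk k X.
  by move=> hX; rewrite (wk_rscale _ lt_kn hX) mu1 mul1r.
rewrite -(w _ (T_herm T_lin hB)) -(T_scale T_lin _ hB).
by apply: hT => //; rewrite /TEA_k (w _ hB).
Qed.

End Scaling.

(** Condition (c) by itself, convertible to its form in the theorem, so that the cycle of
    implications can be cut into separate lemmas. *)
Definition standard_form (R : realType) n k (T : 'M[R[i]]_n -> 'M[R[i]]_n) :=
  exists (mu : R) (U : 'M[R[i]]_n), mu != 0 /\ unitary U /\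
         [\/ (forall A, is_herm A -> rscale mu (T A) = adjmx U *m A *m U) \/
             (forall A, is_herm A -> rscale mu (T A) = adjmx U *m A^T *m U),
             [/\ n = (2 * k)%N, (2 < n)%N, rscale mu (T 1%:M) = 1%:M &
               exists c : R, c != 0 /\
                 ((forall A, is_herm A -> \tr A = 0 ->
                     rscale mu (T A) = rscale c (adjmx U *m A *m U)) \/
                  (forall A, is_herm A -> \tr A = 0 ->
                     rscale mu (T A) = rscale c (adjmx U *m A^T *m U)))]
           | [/\ n = 2%N, herm_real_linear (fun A => rscale mu (T A)),
                 herm_bijective (fun A => rscale mu (T A)),
                 rscale mu (T 1%:M) = 1%:M &
                 forall A, is_herm A -> \tr (rscale mu (T A)) = \tr A]].

Lemma standard_form_TEA (R : realType) n k (T : 'M[R[i]]_n -> 'M[R[i]]_n) :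
  (0 < k)%N -> (k < n)%N -> herm_real_linear T -> standard_form k T ->
  forall A B, is_herm A -> is_herm B -> TEA_k k A B -> TEA_k k (T A) (T B).
Proof.
move=> k_gt0 lt_kn T_lin [mu [U [mu0 [hU form]]]] A B hA hB hAB.
have hTA := T_herm T_lin hA; have hTB := T_herm T_lin hB.
apply/(TEA_scale lt_kn mu0 hTA hTB).
have M_lin := rscale_linear mu T_lin.
case: form => [[h|h]|[nk _ M1 [c [c0 form]]]|[n2 _ _ M1 Mtr]].
- by rewrite (h _ hA) (h _ hB); exact: TEA_uconj.
- by rewrite (h _ hA) (h _ hB); exact: TEA_uconj_tr.
- apply: (TEA_unital k_gt0 lt_kn nk M_lin M1 _ _ hA hB hAB).
    move=> X hX tX; case: form => h; rewrite (h _ hX tX) mxtraceZ -/(uconj U _) (uconj_tr _ hU).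
      by rewrite tX mulr0.
    by rewrite mxtrace_tr tX mulr0.
  move=> X Y hX hY tX tY hXY; case: form => h; rewrite (h _ hX tX) (h _ hY tY).
    apply/(TEA_scale lt_kn c0 (uconj_herm U hX) (uconj_herm U hY)).
    exact: TEA_uconj.
  apply/(TEA_scale lt_kn c0 (uconj_herm U (herm_tr hX)) (uconj_herm U (herm_tr hY))).
  exact: TEA_uconj_tr.
move: T U T_lin hU A B hA hB hAB hTA hTB M_lin M1 Mtr lt_kn; rewrite n2.
move=> T U T_lin hU A B hA hB hAB hTA hTB M_lin M1 Mtr lt_kn.
have k1 : k = 1%N by apply/eqP; rewrite eqn_leq k_gt0 andbT -ltnS.
rewrite k1 in hAB *.
apply: (@TEA_unital R 2 1 isT isT erefl _ M_lin M1 _ _ A B hA hB hAB).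
  by move=> X hX tX; rewrite (Mtr _ hX).
by move=> X Y hX hY tX tY; exact: (TEA_traceless2 M_lin hX hY tX tY).
Qed.

Lemma parallel_standard_form (R : realType) n k (T : 'M[R[i]]_n -> 'M[R[i]]_n) :
  (2 <= n)%N -> (0 < k)%N -> (k < n)%N -> herm_real_linear T -> herm_bijective T ->
  (forall A B, is_herm A -> is_herm B -> parallel_k k A B -> parallel_k k (T A) (T B)) ->
  standard_form k T.
Proof.
move=> n_ge2 k_gt0 lt_kn T_lin T_bij T_par; have [inj surj] := T_bij.
have h1 := @herm1 R n.
have [c Tc] := T_one k_gt0 lt_kn T_lin T_par surj.
have c0 : c != 0.
  apply/eqP => c0; have : (1%:M : 'M[R[i]]_n) = 0.
    apply: (inj _ _ h1 (@adjmx0 R n)).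
    by rewrite Tc c0 rscale0 (T_zero T_lin).
  move=> /(congr1 mxtrace); rewrite mxtrace1 raddf0 => /eqP.
  by rewrite pnatr_eq0 => /eqP n0; rewrite n0 in n_ge2.
have mu0 : c^-1 != 0 by rewrite invr_neq0.
pose M A := rscale c^-1 (T A).
have M_lin : herm_real_linear M by apply: rscale_linear.
have M_bij : herm_bijective M by apply: rscale_bijective.
have M_par A B : is_herm A -> is_herm B -> parallel_k k A B -> parallel_k k (M A) (M B).
  move=> hA hB hAB; apply: parallel_rscale (T_par _ _ hA hB hAB) => //; exact: T_herm.
have M1 : M 1%:M = 1%:M by rewrite /M Tc (rscaleK _ c0).
have [n_gt2|n_le2] := ltnP 2 n.
  have [a [W [a0 hW anK form]]] := unital_form k_gt0 lt_kn M_lin M_bij M_par M1 n_gt2.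
  exists c^-1, W; split=> //; split=> //.
  (* The scalar term has the factors [1 - a] and [\tr A]: it vanishes for [a = 1], giving (c.1), and
     otherwise [n = 2k] and it vanishes on traceless matrices, giving (c.2). *)
  have [a1|a1] := eqVneq a 1.
    constructor 1; case: form => h; [left|right] => A hA.
      by rewrite -/(M A) (h _ hA) a1 subrr mul0r mul0r scale0r addr0 rscale1.
    by rewrite -/(M A) (h _ hA) a1 subrr mul0r mul0r scale0r addr0 rscale1.
  constructor 2; split=> //; first by case: anK => // /eqP; rewrite (negbTE a1).
  exists a; split=> //; case: form => h; [left|right] => A hA tA.
    by rewrite -/(M A) (h _ hA) tA mulr0 scale0r addr0.
  by rewrite -/(M A) (h _ hA) tA mulr0 scale0r addr0.
have n2 : n = 2%N by apply/eqP; rewrite eqn_leq n_le2.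
have nk : n = (2 * k)%N.
  have : (k < 2)%N by rewrite -n2.
  by move: k_gt0; rewrite n2; case: (k) => [|[|]].
exists c^-1, 1%:M; split=> //; split; first exact: unitary1.
constructor 3; split=> // A hA.
have [A0 [hA0 tA0 AE]] := traceless_part lt_kn hA.
rewrite -/(M A) {}AE; move: (tracepart A) => t.
rewrite (T_add M_lin hA0 (herm_rscale t h1)) (T_scale M_lin t h1) M1 !mxtraceD tA0.
by rewrite (unital_trace k_gt0 lt_kn nk M_lin (proj1 M_bij) M_par M1 hA0 tA0).
Qed.

Theorem theorem1p2 (R : realType) (n k : nat) (T : 'M[R[i]]_n -> 'M[R[i]]_n) :
  (2 <= n)%N -> (1 <= k)%N -> (k < n)%N ->
  herm_real_linear T -> herm_bijective T ->
  let muT (mu : R) := fun A => rscale mu (T A) in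
  [<-> (* (a) *)
        (forall A B, is_herm A -> is_herm B ->
          parallel_k k A B -> parallel_k k (T A) (T B));
        (* (b) *)
        (forall A B, is_herm A -> is_herm B ->
          TEA_k k A B -> TEA_k k (T A) (T B));
        (* (c) *)
       (exists (mu : R) (U : 'M[R[i]]_n), mu != 0 /\ unitary U /\
         [\/ (* (c.1) *)
             (forall A, is_herm A -> muT mu A = adjmx U *m A *m U) \/
             (forall A, is_herm A -> muT mu A = adjmx U *m A^T *m U),
             (* (c.2) *)
             [/\ n = (2 * k)%N, (2 < n)%N, muT mu 1%:M = 1%:M &
               exists c : R, c != 0 /\
                 ((forall A, is_herm A -> \tr A = 0 ->
                     muT mu A = rscale c (adjmx U *m A *m U)) \/
                  (forall A, is_herm A -> \tr A = 0 ->
                     muT mu A = rscale c (adjmx U *m A^T *m U)))]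
           | (* (c.3) *)
             [/\ n = 2%N, herm_real_linear (muT mu), herm_bijective (muT mu),
                 muT mu 1%:M = 1%:M &
                 forall A, is_herm A -> \tr (muT mu A) = \tr A]])].
Proof.
move=> n_ge2 k_gt0 lt_kn T_lin T_bij muT.
have b_a := parallel_of_TEA_preserving lt_kn T_lin.
have c_b := standard_form_TEA k_gt0 lt_kn T_lin.
have a_c := parallel_standard_form n_ge2 k_gt0 lt_kn T_lin T_bij.
tfae.
- by move=> /a_c /c_b.
- by move=> /b_a /a_c.
- by move=> /c_b /b_a.
Qed.
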